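(* Let $\mathfrak{e}\subset\mathbb{R}$ be a regular and compact Parreau--Widom set, $x_*$ a point in $\overline{\mathbb{R}}\setminus\mathfrak{e}$, and $w$ an upper semi-continuous weight on $\mathfrak{e}$. Then $$\limsup_{n\to\infty} W_n(\mathfrak{e},w,x_* )\le 2\,S(\mathfrak{e},w,x_* )\exp[PW(\mathfrak{e},x_* )].$$
   Context: $\overline{\mathbb{R}}=\mathbb{R}\cup\{\infty\}$. A weight on an infinite compact set $\mathfrak{e}$ is an upper semi-continuous function $w:\mathfrak{e}\to[0,\infty)$ that is positive at infinitely many points of $\mathfrak{e}$. $\|\cdot\|_{\mathfrak{e}}$ is the sup norm over $\mathfrak{e}$, $\mathrm{C}(\mathfrak{e})$ is logarithmic capacity, and $g_{\mathfrak{e}}(z,z_0)$ is the Green function of $\overline{\mathbb{C}}\setminus\mathfrak{e}$ with logarithmic pole at $z_0$. Widom factors ($n\ge1$): for finite $x_*$, $$W_n(\mathfrak{e},w,x_* )=e^{n g_{\mathfrak{e}}(x_*,\infty)}\min\{\|wP\|_{\mathfrak{e}}: P \text{ a polynomial},\ \deg P\le n,\ P(x_* )=1\},$$ and for $x_*=\infty$, $$W_n(\mathfrak{e},w,\infty)=\mathrm{C}(\mathfrak{e})^{-n}\min\{\|wP\|_{\mathfrak{e}}: P \text{ monic of degree } n\}.$$ Szegő factor: $S(\mathfrak{e},w,x_* )=\exp\left[\int\log w(z)\,d\omega_{\mathfrak{e}}(z,x_* )\right]\in[0,\infty)$, where $\omega_{\mathfrak{e}}(\cdot,x_* )$ is the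 harmonic measure of $\overline{\mathbb{C}}\setminus\mathfrak{e}$ at $x_*$ (with $\exp(-\infty)=0$; the value $0$ is allowed). $\mathfrak{e}$ is regular if it is regular for potential theory (every point of $\mathfrak{e}$ that is a boundary point of $\overline{\mathbb{C}}\setminus\mathfrak{e}$ is regular for the Dirichlet problem on $\overline{\mathbb{C}}\setminus\mathfrak{e}$). The gaps of $\mathfrak{e}$ are the connected components of $\overline{\mathbb{R}}\setminus\mathfrak{e}$. The Parreau--Widom constant is $PW(\mathfrak{e},x_* )=\sum_\ell g_{\mathfrak{e}}(\zeta_\ell,x_* )$, where $\{\zeta_\ell\}$ are the critical points of $x\mapsto g_{\mathfrak{e}}(x,x_* )$ in the gaps of $\mathfrak{e}$, i.e. the points with $\partial_x g_{\mathfrak{e}}(\zeta_\ell,x_* )=0$, where the derivative at $\infty$ is $\partial_xg_{\mathfrak{e}}(\infty,x_* )=\lim_{x\to\infty}x[g_{\mathfrak{e}}(x,x_* )-g_{\mathfrak{e}}(\infty,x_* )]$. A compact regular $\mathfrak{e}\subset\mathbb{R}$ is a Parreau--Widom set if $PW(\mathfrak{e},x_* )<\infty$; this condition is independent of $x_*\in\overline{\mathbb{R}}\setminus\mathfrak{e}$. *)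

(* Defs.v *)
From HB Require Import structures.
From mathcomp Require Import all_boot all_order all_algebra.
From mathcomp Require Import complex.
From mathcomp Require Import all_classical all_reals all_analysis.

Set Implicit Arguments.
Unset Strict Implicit.
Unset Printing Implicit Defensive.

Import Order.TTheory GRing.Theory Num.Theory.
Import numFieldNormedType.Exports.

Local Open Scope classical_set_scope.
Local Open Scope ring_scope.

(* Potential theory on the Riemann sphere for the complement of a compact set
   e of real numbers. The complex plane is R * R with its product topology,
   the Riemann sphere is its one-point compactification (None is the point at
   infinity), and the extended real line is the one-point compactification
   of R. *)

Notation sphere R := (one_point_compactification (R * R)%type).
Notation xreal R := (one_point_compactification R).

Section sphere.
Context {R : realType}.

Definition finite_pt (p : R * R) : sphere R := Some p.
Definition infty_pt : sphere R := None.
Definition real_pt (t : R) : sphere R := Some (t, 0).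
Definition xreal_pt (x : xreal R) : sphere R :=
  if x is Some t then real_pt t else infty_pt.

(* Euclidean modulus of a point of the plane; the library norm of R * R is
   the maximum norm. *)
Definition modulus (p : R * R) : R := Num.sqrt (p.1 ^+ 2 + p.2 ^+ 2).

(* The chart of the sphere at infinity, z |-> 1 / z. *)
Definition chart_infty (p : R * R) : sphere R :=
  if p == (0, 0) then infty_pt
  else finite_pt (p.1 / (modulus p) ^+ 2, - p.2 / (modulus p) ^+ 2).

Definition C2_on (U : set (R * R)) (u : R * R -> R) :=
  forall v w : R * R, v \in [:: (1, 0); (0, 1)] -> w \in [:: (1, 0); (0, 1)] ->
  forall p, U p ->
    [/\ derivable u p v, derivable ('D_v u) p w
      & {for p, continuous ('D_w ('D_v u))}].

Definition laplacian (u : R * R -> R) (p : R * R) : R :=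
  'D_(1, 0) ('D_(1, 0) u) p + 'D_(0, 1) ('D_(0, 1) u) p.

Definition plane_harmonic (U : set (R * R)) (u : R * R -> R) :=
  C2_on U u /\ forall p, U p -> laplacian u p = 0.

(* Harmonicity on an open subset of the sphere, read in its two charts. *)
Definition harmonic_on (U : set (sphere R)) (u : sphere R -> R) :=
  plane_harmonic (finite_pt @^-1` U) (u \o finite_pt) /\
  plane_harmonic (chart_infty @^-1` U) (u \o chart_infty).

Definition region (V : set (sphere R)) := [/\ V !=set0, open V & connected V].

(* Continuous subharmonic functions in the sense of Ahlfors: for every harmonic
   u on a region V inside U, the function v - u satisfies the maximum principle
   on V. *)
Definition subharmonic_on (U : set (sphere R)) (v : sphere R -> R) :=
  (forall z, U z -> {for z, continuous v}) /\
  forall (V : set (sphere R)) (u : sphere R -> R),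
    region V -> V `<=` U -> harmonic_on V u ->
    forall z, V z -> (forall z', V z' -> v z' - u z' <= v z - u z) ->
    forall z', V z' -> v z' - u z' = v z - u z.

(* The domain whose potential theory is considered. As e lies on the real line
   it has no interior in the sphere, so all its points are boundary points. *)
Definition cdomain (e : set R) : set (sphere R) := ~` (real_pt @` e).

Definition perron_class (e : set R) (phi : R -> R) : set (sphere R -> R) :=
  [set v | subharmonic_on (cdomain e) v /\
    forall t, e t -> forall eps : R, 0 < eps ->
      \forall z \near within (cdomain e) (nbhs (real_pt t)), v z < phi t + eps].

(* Value at z of the Perron solution of the Dirichlet problem with boundary values phi. *)
Definition perron (e : set R) (phi : R -> R) (z : sphere R) : R :=
  sup [set v z | v in perron_class e phi].

Definition regular_point (e : set R) (t : R) :=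
  forall phi : R -> R, {within e, continuous phi} ->
    perron e phi z @[z --> within (cdomain e) (nbhs (real_pt t))] --> phi t.

Definition regular (e : set R) := forall t, e t -> regular_point e t.

(* The singular part at the pole z0: - log |z - z0|, and log |z| at infinity. *)
Definition log_pole (z0 z : sphere R) : R :=
  match z0, z with
  | Some p, Some q => - ln (modulus (q - p))
  | None, Some q => ln (modulus q)
  | _, None => 0
  end.

(* h is the Green function of the domain with pole z0. The value + oo at the
   pole is not recorded: h z0 is irrelevant, as are the values of h on e. *)
Definition green_at (e : set R) (z0 : sphere R) (h : sphere R -> R) :=
  [/\ harmonic_on (cdomain e `\ z0) h,
      forall N, nbhs z0 N ->
        exists M, forall z, cdomain e z -> ~ N z -> `|h z| <= M,
      exists M, \forall z \near z0^', `|h z - log_pole z0 z| <= M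
    & forall t, e t -> regular_point e t ->
        h z @[z --> within (cdomain e) (nbhs (real_pt t))] --> (0 : R)].

(* g z z0 is the value at z of the Green function with pole z0. *)
Definition is_green (e : set R) (g : sphere R -> sphere R -> R) :=
  forall z0, cdomain e z0 -> green_at e z0 (g ^~ z0).

(* omega is the harmonic measure of cdomain e at z; it is a measure on R that
   is carried by e. *)
Definition is_harmonic_measure (e : set R) (z : sphere R)
    (omega : probability (measurableTypeR R) R) :=
  omega e = 1%E /\
  forall phi : R -> R, {within e, continuous phi} ->
    (\int[omega]_(t in e) (phi t)%:E = (perron e phi z)%:E)%E.

Definition log_energy (e : set R) (mu : probability (measurableTypeR R) R) :
    \bar R :=
  (\int[mu]_(s in e) \int[mu]_(t in e) (- lne `|s - t|%:E))%E.

Definition capacity (e : set R) : R :=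
  fine (expeR (- ereal_inf
    [set log_energy e mu | mu in
      [set mu : probability (measurableTypeR R) R | mu e = 1%E]])%E).

Definition weight (e : set R) (w : R -> R) :=
  [/\ forall t, e t -> 0 <= w t,
      forall t, e t -> forall a, w t < a ->
        \forall s \near within e (nbhs t), w s < a
    & infinite_set [set t | e t /\ 0 < w t]].

Definition wnorm (e : set R) (w : R -> R) (P : {poly R[i]}) : R :=
  sup [set w t * Normc.normc P.[t%:C%C] | t in e].

Definition residual_polys (n : nat) (x : R) : set {poly R[i]} :=
  [set P : {poly R[i]} | (size P <= n.+1)%N /\ P.[x%:C%C] = 1].

Definition monic_polys (n : nat) : set {poly R[i]} :=
  [set P : {poly R[i]} | size P = n.+1 /\ P \is monic].

(* Widom factors; g is the Green function of e. The infima are attained, since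
   wnorm e w is a norm on the polynomials when w is a weight on e. *)
Definition widom (e : set R) (g : sphere R -> sphere R -> R) (w : R -> R)
    (x : xreal R) (n : nat) : R :=
  match x with
  | Some t => expR (n%:R * g (real_pt t) infty_pt) *
                inf [set wnorm e w P | P in residual_polys n t]
  | None => (capacity e) ^- n * inf [set wnorm e w P | P in monic_polys n]
  end.

(* Szego factor; omega is the harmonic measure of e at the given point. *)
Definition szego (e : set R) (omega : probability (measurableTypeR R) R)
    (w : R -> R) : \bar R :=
  expeR (\int[omega]_(t in e) lne (w t)%:E)%E.

Definition xcompl (e : set R) : set (xreal R) := ~` (Some @` e).

Definition gap (e : set R) (G : set (xreal R)) :=
  exists2 x, xcompl e x & G = connected_component (xcompl e) x.

(* h has a vanishing derivative along the extended real line; at infinity the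
   derivative is lim t (h t - h oo). *)
Definition critical (h : xreal R -> R) (x : xreal R) :=
  match x with
  | Some t => is_derive t (1 : R) (fun s : R => h (Some s)) 0
  | None =>
      (t * (h (Some t) - h None) @[t --> +oo] --> (0 : R)) /\
      (t * (h (Some t) - h None) @[t --> -oo] --> (0 : R))
  end.

(* The pole x is removed since the Green function is + oo there. *)
Definition green_critical (e : set R) (g : sphere R -> sphere R -> R)
    (x : xreal R) : set (xreal R) :=
  [set zeta | [/\ exists2 G, gap e G & G zeta, zeta != x
    & critical (fun y => g (xreal_pt y) (xreal_pt x)) zeta]].

Definition PW (e : set R) (g : sphere R -> sphere R -> R) (x : xreal R) :
    \bar R :=
  \esum_(zeta in green_critical e g x) (g (xreal_pt zeta) (xreal_pt x))%:E.

(* For regular compact e the finiteness of PW does not depend on the choice of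
   the point x outside e. *)
Definition parreau_widom (e : set R) (g : sphere R -> sphere R -> R)
    (x : xreal R) :=
  (PW e g x < +oo)%E.

End sphere.

(* Main.v *)
(* Let n be large and let Q > 0 be a polynomial with w Q <= 1 on e. In the coordinate
   tau = 1 / (x - t), or tau = t when x is infinite, e becomes a compact subset K of the
   line with the pole at infinity, and Q becomes a polynomial q of degree at most n up to
   the factor (x - t)^n. Exchanging nodes in a configuration of n + 1 points of K yields a
   polynomial T that alternates between the values q and - q at these points, with
   |T| <= (1 + eps) |q| on K and a leading coefficient A which bounds W_n by
   exp(n G) (1 + eps) / A, where exp(- G) is the capacity of K.

   For real |c| <= 1 the roots of T - c q interlace the nodes. Take N points c_k on a thin
   ellipse around [-1, 1] such that the product of the 2 |r - c_k| is at least 1 for all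
   real r: then (|q| / 2)^N is at most the product of the |T - c_k q|, and each of these is
   bounded by a real T - c q with its variable slightly shifted off the real line. The mean
   of log |tau - rho| over the harmonic measure is at most the Green function at rho minus
   G, and between two nodes the Green function is at most its value at a critical point of
   the corresponding gap; hence int log Q d omega <= log (2 A) - n G + PW. Finally Q is
   chosen with - int log Q d omega close to int log w d omega. *)

(* The ellipse discretises a potential. The equilibrium measure mu of [-1, 1], a set of capacity
   1/2, satisfies int log (2 |r - c|) dmu(c) >= 0 for all real r; with r = T / q this reads log |q|
   <= log 2 + int log |T - c q| dmu(c), which is where the factor 2 of the theorem comes from.
   Finitely many points on [-1, 1] itself would give logarithmic poles; points on a thin ellipse do
   not, and the error they cause is absorbed by the shift off the real line. The leading
   coefficients A - c q_n have logarithmic mean at most log A by concavity, as the real parts of the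
   points sum to zero.

   On the side of potential theory, harmonic measure is accessible only through Perron solutions,
   and the Green function only through its defining properties. The extension of log |t - z| is
   therefore written down explicitly as log |. - z| - g(., oo) + g(., z). Evaluating it at the given
   point calls for the symmetry of g, and hence for harmonicity in the pole, where no derivatives
   are at hand: this is why the minimum principle is proved for functions that are harmonic in
   Blaschke's sense. *)
Require Import Defs.
From mathcomp Require Import all_boot all_order all_algebra complex polyrcf.
From mathcomp Require Import all_classical all_reals all_analysis measurable_realfun.
From mathcomp Require Import ring lra.
From mathcomp Require finmap.

Set Implicit Arguments.
Unset Strict Implicit.
Unset Printing Implicit Defensive.

Import Order.TTheory GRing.Theory Num.Theory.
Import numFieldNormedType.Exports.
Local Open Scope classical_set_scope.
Local Open Scope ring_scope.

(** * Near-optimal interpolation nodes *)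

Section interpolation.
Context {R : realType}.
Implicit Types (f : R -> R) (s : seq R) (y z t : R).

Definition nodal s y t : R := \prod_(z <- s | z != y) (t - z).

(** On distinct nodes s, a polynomial p of degree below [size s] with |p| <= f on s has top
    coefficient equal to the sum of p(y) / nodal s y y, hence bounded by this cost. [node_poly]
    attains the bound: it interpolates the values f y * sg (nodal s y y). *)
Definition node_cost f s : R := \sum_(y <- s) f y / `|nodal s y y|.

Definition node_poly f s : {poly R} :=
  \sum_(y <- s) (f y / `|nodal s y y|) *: \prod_(z <- s | z != y) ('X - z%:P).

Lemma perm_nodal s s' : perm_eq s s' -> nodal s =2 nodal s'.
Proof. by move=> ss' y t; exact: perm_big. Qed.

Lemma perm_node_cost f s s' : perm_eq s s' -> node_cost f s = node_cost f s'.
Proof.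
move=> ss'; rewrite /node_cost (perm_big _ ss') /=.
by apply: eq_bigr => y _; rewrite (perm_nodal ss').
Qed.

Lemma perm_node_poly f s s' : perm_eq s s' -> node_poly f s = node_poly f s'.
Proof.
move=> ss'; rewrite /node_poly (perm_big _ ss') /=.
apply: eq_bigr => y _; rewrite (perm_nodal ss'); congr (_ *: _).
exact: perm_big.
Qed.

Lemma nodal_neq0 s y t : t \notin [seq z <- s | z != y] -> nodal s y t != 0.
Proof.
move=> ty; rewrite /nodal prodf_seq_neq0; apply/allP => z zs; apply/implyP => zy.
by rewrite subr_eq0; apply: contra ty => /eqP ->; rewrite mem_filter zy.
Qed.

Lemma nodal_diag_neq0 s y : nodal s y y != 0.
Proof. by apply: nodal_neq0; rewrite mem_filter eqxx. Qed.

Lemma nodal_off s y t : uniq s -> t \in s -> t != y -> nodal s y t = 0.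
Proof.
move=> us ts ty; apply/eqP; rewrite /nodal prodf_seq_eq0; apply/hasP.
by exists t => //; rewrite ty subrr eqxx.
Qed.

Lemma horner_node_poly f s t :
  (node_poly f s).[t] = \sum_(y <- s) f y / `|nodal s y y| * nodal s y t.
Proof.
rewrite /node_poly horner_sum; apply: eq_bigr => y _.
rewrite hornerZ horner_prod; congr (_ * _).
by apply: eq_bigr => z _; rewrite hornerXsubC.
Qed.

Lemma node_poly_at f s y : uniq s -> y \in s ->
  (node_poly f s).[y] = f y * Num.sg (nodal s y y).
Proof.
move=> us ys; rewrite horner_node_poly (bigD1_seq y) //= big1_seq ?addr0.
  rewrite -mulrA; congr (_ * _); apply: (canLR (mulKf _)).
    by rewrite normr_eq0 nodal_diag_neq0.
  by rewrite mulrC -numEsg.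
move=> z /andP[zy zs]; have yz : y != z by rewrite eq_sym.
by rewrite (nodal_off us ys yz) mulr0.
Qed.

Let size_nodal s y : uniq s -> y \in s ->
  size (\prod_(z <- s | z != y) ('X - z%:P)) = size s.
Proof.
move=> us ys; rewrite -big_filter size_prod_XsubC size_filter.
by rewrite -(count_predC (pred1 y) s) count_uniq_mem // ys.
Qed.

Lemma size_node_poly f s : uniq s -> (size (node_poly f s) <= size s)%N.
Proof.
move=> us; rewrite /node_poly big_seq.
apply: (leq_trans (size_sum _ _ _)); apply/bigmax_leqP_seq => y ys _.
by rewrite (leq_trans (size_scale_leq _ _)) // size_nodal.
Qed.

Lemma coef_node_poly f s : uniq s ->
  (node_poly f s)`_(size s).-1 = node_cost f s.
Proof.
move=> us; rewrite /node_poly coef_sum /node_cost.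
apply: eq_big_seq => y ys; rewrite coefZ -(size_nodal us ys).
rewrite -[X in _ * X]/(lead_coef _) lead_coef_prod_XsubC mulr1 //.
Qed.

Lemma node_cost_exchange f (y0 : R) (s1 : seq R) t :
  let s := y0 :: s1 in
  let T := (node_poly f s).[t] in
  uniq s -> t \notin s -> 0 < Num.sg T * nodal s y0 t ->
  (forall y, y \in s1 -> Num.sg T * nodal s y t <= Num.sg T * nodal s y0 t) ->
  node_cost f (t :: s1) = node_cost f s - (`|T| - f t) / `|nodal s y0 t|.
Proof.
move=> s T us; rewrite inE negb_or => /andP[ty0 ts1] l0 lmax.
have /andP[y0s1 us1] := us.
have sy0 : nodal s y0 t = \prod_(z <- s1) (t - z).
  rewrite /nodal big_cons eqxx /= big_seq_cond [RHS]big_seq.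
  apply: eq_bigl => z; case zs : (z \in s1) => //=.
  by apply: contraNneq y0s1 => <-.
have nt : nodal (t :: s1) t t = nodal s y0 t.
  rewrite sy0 /nodal big_cons eqxx /= big_seq_cond [RHS]big_seq.
  apply: eq_bigl => z; case zs : (z \in s1) => //=.
  by apply: contraNneq ts1 => <-.
have l0n : nodal s y0 t != 0 by apply: contraTneq l0 => ->; rewrite mulr0 ltxx.
rewrite {1 2}/node_cost !big_cons nt.
have E y : y \in s1 -> f y / `|nodal (t :: s1) y y| =
    f y / `|nodal s y y| - f y / `|nodal s y y| * nodal s y t / nodal s y0 t.
  move=> ys1.
  have yy0 : y0 != y by apply: contraNneq y0s1 => ->.
  have yt : t != y by apply: contraNneq ts1 => ->.
  set P := \prod_(z <- s1 | z != y) (y - z).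
  have P0 : P != 0 by apply: nodal_diag_neq0.
  have -> : nodal (t :: s1) y y = (y - t) * P by rewrite /nodal big_cons yt.
  have -> : nodal s y y = (y - y0) * P by rewrite /nodal big_cons yy0.
  have e1 : nodal s y t / nodal s y0 t = (t - y0) / (t - y).
    rewrite sy0 (bigD1_seq y) //= /nodal big_cons yy0.
    field; rewrite subr_eq0 yt /=.
    by apply: (@nodal_neq0 s1 y t); rewrite mem_filter (negbTE ts1) andbF.
  have pos : 0 <= (y0 - y) / (t - y).
    have -> : (y0 - y) / (t - y) = 1 - nodal s y t / nodal s y0 t.
      by rewrite e1; field; rewrite subr_eq0.
    rewrite subr_ge0.
    have -> : nodal s y t / nodal s y0 t =
       (Num.sg T * nodal s y t) / (Num.sg T * nodal s y0 t).
      have sT : Num.sg T != 0 by apply: contraTneq l0 => ->; rewrite mul0r ltxx.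
      by field; rewrite l0n.
    by rewrite ler_pdivrMr // mul1r lmax.
  rewrite -[_ * nodal s y t / _]mulrA e1 !normrM.
  have -> : `|y - t| = `|t - y| by rewrite distrC.
  have h : `|y - y0| / `|t - y| = (y0 - y) / (t - y).
    by rewrite distrC -normf_div ger0_norm.
  have n1 : `|t - y| != 0 by rewrite normr_eq0 subr_eq0.
  have n2 : `|y - y0| != 0 by rewrite normr_eq0 subr_eq0 eq_sym.
  have n3 : `|P| != 0 by rewrite normr_eq0.
  have n4 : t - y != 0 by rewrite subr_eq0.
  have -> : f y / (`|t - y| * `|P|) =
     f y / (`|y - y0| * `|P|) * (`|y - y0| / `|t - y|).
    by field; rewrite n1 n2 n3.
  by rewrite h; field; rewrite n4 n2 n3.
rewrite (eq_big_seq _ E) sumrB -mulr_suml.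
have TE : T = f y0 / `|nodal s y0 y0| * nodal s y0 t +
   \sum_(y <- s1) f y / `|nodal s y y| * nodal s y t.
  by rewrite /T horner_node_poly big_cons.
have nT : `|T| / `|nodal s y0 t| = T / nodal s y0 t.
  rewrite -normf_div ger0_norm //.
  have -> : T / nodal s y0 t = `|T| / (Num.sg T * nodal s y0 t).
    have sT : Num.sg T != 0 by apply: contraTneq l0 => ->; rewrite mul0r ltxx.
    by rewrite normrEsg; field; rewrite l0n sT.
  by rewrite divr_ge0 // ltW.
rewrite mulrBl nT TE.
have n5 : `|nodal s y0 t| != 0 by rewrite normr_eq0.
have n6 : `|nodal s y0 y0| != 0 by rewrite normr_eq0 nodal_diag_neq0.
by field; rewrite l0n n5 n6.
Qed.

Lemma exists_argmax (s : seq R) (F : R -> R) : s != [::] ->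
  exists2 y, y \in s & forall z, z \in s -> F z <= F y.
Proof.
elim: s => // a s IH _; have [->|s0] := eqVneq s [::].
  by exists a; rewrite ?inE // => z; rewrite inE => /eqP ->.
have [y ys ymax] := IH s0; have [ay|ya] := leP (F a) (F y).
  exists y; first by rewrite inE ys orbT.
  by move=> z; rewrite inE => /predU1P[->|/ymax].
exists a; first by rewrite inE eqxx.
by move=> z; rewrite inE => /predU1P[->//|/ymax /le_trans]; apply; exact: ltW.
Qed.

(* A configuration of almost minimal cost works, since exchanging one of its
   nodes for a point where the inequality fails lowers the cost. *)
Lemma near_optimal_nodes (K : set R) (B : R) f (n : nat) (theta : R) :
  (forall t, K t -> `|t| <= B) -> (forall t, K t -> 0 < f t) ->
  (exists s, [/\ uniq s, size s = n.+1 & forall y, y \in s -> K y]) ->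
  0 < theta ->
  exists s, [/\ uniq s, size s = n.+1, forall y, y \in s -> K y
    & forall t, K t -> `|(node_poly f s).[t]| <= f t + theta].
Proof.
move=> KB Kf [s0 [us0 ss0 s0K]] theta0.
have B0 : 0 <= B.
  case: s0 us0 ss0 s0K => [//|y s0] _ _ /(_ y (mem_head _ _)) /KB.
  exact: le_trans.
(* Points of K are at most 2 B apart, so [D] bounds every |nodal s y0 t|. An exchange at a bad point
   t then lowers the cost by at least theta / D, more than s exceeds the infimum. *)
pose D : R := (2 * B + 1) ^+ n.
have D0 : 0 < D by rewrite exprn_gt0 //; move: B0; clear; lra.
pose S := [set node_cost f s | s in
  [set s : seq R | [/\ uniq s, size s = n.+1 & forall y, y \in s -> K y]]].
have S0 : S !=set0 by exists (node_cost f s0), s0.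
have cost0 s : (forall y, y \in s -> K y) -> 0 <= node_cost f s.
  move=> sK; rewrite /node_cost big_seq; apply: sumr_ge0 => y ys.
  by apply: divr_ge0 => //; exact/ltW/Kf/sK.
have infS : has_inf S by split=> //; exists 0 => _ [s [_ _ sK] <-]; exact: cost0.
have [_ [s [us ss sK] <-] slt] := inf_adherent (divr_gt0 theta0 D0) infS.
exists s; split=> // t Kt; rewrite leNgt; apply/negP => Tt.
set T := (node_poly f s).[t] in Tt.
have T0 : 0 < `|T| by apply: le_lt_trans Tt; by move: (Kf _ Kt) theta0; clear; lra.
have ts : t \notin s.
  apply/negP => ts; move: Tt; rewrite /T node_poly_at // normrM.
  rewrite normr_sg nodal_diag_neq0 mulr1 gtr0_norm; [|exact: Kf] => h.
  by move: theta0 h; clear; lra.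
have sN : s != [::] by rewrite -size_eq0 ss.
have [y0 y0s ymax] := exists_argmax (fun y => Num.sg T * nodal s y t) sN.
(* Otherwise all signed values are nonpositive, while |T| is a combination of them with nonnegative
   coefficients. *)
have l0 : 0 < Num.sg T * nodal s y0 t.
  rewrite ltNge; apply/negP => l0; move: T0; rewrite ltNge => /negP; apply.
  rewrite normrEsg {2}/T horner_node_poly mulr_sumr big_seq.
  apply: sumr_le0 => y ys; rewrite mulrCA mulr_ge0_le0 //.
    by apply: divr_ge0 => //; exact/ltW/Kf/sK.
  exact: le_trans (ymax _ ys) l0.
have pm : perm_eq s (y0 :: rem y0 s) by exact: perm_to_rem.
have E : node_cost f (t :: rem y0 s) =
    node_cost f s - (`|T| - f t) / `|nodal s y0 t|.
  rewrite (perm_node_cost f pm) (perm_nodal pm) /T (perm_node_poly f pm).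
  apply: node_cost_exchange.
  - by rewrite -(perm_uniq pm).
  - by rewrite -(perm_mem pm).
  - by rewrite -(perm_node_poly f pm) -(perm_nodal pm).
  move=> y ys; rewrite -(perm_node_poly f pm) -!(perm_nodal pm).
  by apply: ymax; exact: mem_rem ys.
have sK' y : y \in t :: rem y0 s -> K y.
  by rewrite inE => /predU1P[->//|/mem_rem /sK].
have u' : uniq (t :: rem y0 s).
  by rewrite /= rem_uniq // andbT; apply: contra ts => /mem_rem.
have s' : size (t :: rem y0 s) = n.+1 by rewrite /= size_rem // ss.
have : inf S <= node_cost f (t :: rem y0 s).
  by apply: ge_inf; [exact: infS.2|exists (t :: rem y0 s)].
rewrite E leNgt => /negP; apply.
rewrite ltrBlDr; apply: (lt_le_trans slt); rewrite lerD2l.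
have lD : `|nodal s y0 t| <= D.
  rewrite /nodal normr_prod -big_filter /D.
  have -> : n = size [seq z <- s | z != y0].
    rewrite size_filter; apply: succn_inj; rewrite -ss.
    by rewrite -(count_predC (pred1 y0) s) count_uniq_mem // y0s.
  have : forall z, z \in [seq z <- s | z != y0] -> `|t - z| <= 2 * B + 1.
    move=> z; rewrite mem_filter => /andP[_ /sK /KB zB].
    by move: (KB _ Kt) (ler_normB t z) zB; clear; lra.
  elim: {s us ss sK slt T Tt T0 ts sN y0 y0s ymax l0 pm E sK' u' s'}
    [seq z <- s | z != y0] => [|z l IH] zB; first by rewrite big_nil.
  rewrite big_cons exprS ler_pM ?zB ?mem_head //.
    by rewrite prodr_ge0.
  by apply: IH => z' z'l; rewrite zB // inE z'l orbT.
have n0 : 0 < `|nodal s y0 t|.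
  by rewrite normr_gt0; apply: contraTneq l0 => ->; rewrite mulr0 ltxx.
rewrite ler_pM //; first exact: ltW.
- by rewrite invr_ge0 ltW.
- by move: Tt theta0; clear; lra.
- by rewrite lef_pV2 ?posrE.
Qed.

End interpolation.

(** * Points on a thin ellipse around [-1, 1] *)

Section ellipse.
Context {R : realType}.

Local Notation Re := (@complex.Re R).
Local Notation Im := (@complex.Im R).

Definition sqnorm (z : R[i]) : R := Re z ^+ 2 + Im z ^+ 2.

Lemma sqnormM z w : sqnorm (z * w) = sqnorm z * sqnorm w.
Proof. by case: z w => [a b] [c d]; rewrite /sqnorm /=; ring. Qed.

Lemma sqnorm_prod (I : Type) (r : seq I) (f : I -> R[i]) :
  sqnorm (\prod_(i <- r) f i) = \prod_(i <- r) sqnorm (f i).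
Proof.
elim/big_rec2 : _ => [|i x y _ <-]; last by rewrite sqnormM.
by rewrite /sqnorm /= expr1n expr0n addr0.
Qed.

Lemma sqnormX z n : sqnorm (z ^+ n) = sqnorm z ^+ n.
Proof.
elim: n => [|n IH]; last by rewrite !exprS sqnormM IH.
by rewrite !expr0 /sqnorm /= expr1n expr0n addr0.
Qed.

Lemma sqnorm_ge0 z : 0 <= sqnorm z.
Proof. by rewrite addr_ge0 ?sqr_ge0. Qed.

(* The nodes are (u + 1/u)/2 for the roots u = rho (x + i y) of
   X^N = i rho^N. With r = (s + 1/s)/2, the product equals
   |s^N - i rho^N|^2 |s^-N - i rho^N|^2 / rho^(2N), and s is either real or of
   modulus one. *)
Lemma ellipse_nodes (rho : R) (N : nat) : 1 < rho -> 3 <= rho ^+ N ->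
  (1 < N)%N ->
  exists u : seq (R * R), [/\ size u = N,
    forall v, v \in u -> v.1 ^+ 2 + v.2 ^+ 2 = 1,
    \sum_(v <- u) v.1 = 0 &
    forall r, 1 <= \prod_(v <- u)
      (4 * ((r - (rho + rho^-1) / 2 * v.1) ^+ 2
          + ((rho - rho^-1) / 2 * v.2) ^+ 2))].
Proof.
move=> rho1 rhoN N1.
have rho0 : 0 < rho by apply: lt_trans rho1.
have rhoV : rho != 0 by rewrite gt_eqF.
set P := rho ^+ N.
(* Thanks to the factor i, |s^N - i P|^2 = s^(2N) + P^2 for real s of either sign. *)
have [us] := closed_field_poly_normal ('X^N - ('i * (P)%:C)%C%:P : {poly R[i]}).
have N0 : (0 < N)%N by exact: ltnW.
have -> : lead_coef ('X^N - ('i * P%:C)%C%:P : {poly R[i]}) = 1.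
  exact: lead_coefXnsubC.
rewrite scale1r => usE.
have sus : size us = N.
  by have := congr1 (size : {poly R[i]} -> nat) usE; rewrite size_XnsubC // size_prod_XsubC => -[].
have usroot u : u \in us -> u ^+ N = ('i * P%:C)%C.
  move=> uus; have : root ('X^N - ('i * P%:C)%C%:P) u by rewrite usE root_prod_XsubC.
  by rewrite rootE !hornerE subr_eq0 => /eqP.
have usn u : u \in us -> sqnorm u = rho ^+ 2.
  move=> /usroot /(congr1 sqnorm); rewrite sqnormX sqnormM.
  have -> : sqnorm 'i%C = 1 by rewrite /sqnorm /=; ring.
  have -> : sqnorm P%:C%C = (rho ^+ 2) ^+ N.
    by rewrite /sqnorm /= expr0n addr0 /P -!exprM mulnC.
  rewrite mul1r => /eqP; rewrite eqrXn2 ?sqnorm_ge0 ?sqr_ge0 //.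
  by move=> /eqP.
have ussum : \sum_(u <- us) u = 0.
  apply/eqP; rewrite -oppr_eq0 -coefPn_prod_XsubC ?sus -?lt0n // -usE.
  rewrite coefB coefXn coefC; have /negbTE -> : N.-1 != N.
    by case: (N) N1 => // m _; rewrite /= neq_ltn ltnSn.
  have /negbTE -> : N.-1 != 0%N by case: (N) N1 => [|[]].
  by rewrite subrr.
exists [seq (Re u / rho, Im u / rho) | u <- us]; split.
- by rewrite size_map.
- move=> v /mapP[u uus ->] /=; rewrite !expr_div_n -mulrDl.
  by rewrite -/(sqnorm u) usn // divff // expf_neq0.
- rewrite big_map /= -mulr_suml.
  suff -> : \sum_(j <- us) Re j = 0 by rewrite mul0r.
  have : Re (\sum_(u <- us) u) = 0 by rewrite ussum.
  by rewrite (big_morph Re (id1 := 0) (op1 := +%R)) // => -[? ?] [? ?].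
move=> r; rewrite big_map /=.
have [s [s0 ss sW]] : exists s : R[i], [/\ s != 0, s + s^-1 = (2 * r)%:C%C &
     1 <= sqnorm (s ^+ N - 'i%C * P%:C%C) * sqnorm (s^-1 ^+ N - 'i%C * P%:C%C)
       / P ^+ 2 ].
  have P3 : 3 <= P by [].
  have P0 : 0 < P by apply: lt_le_trans P3.
  have [r1|r1] := leP (r ^+ 2) 1.
    pose s : R[i] := (r +i* Num.sqrt (1 - r ^+ 2))%C.
    pose s' : R[i] := (r -i* Num.sqrt (1 - r ^+ 2))%C.
    have sqE : Num.sqrt (1 - r ^+ 2) ^+ 2 = 1 - r ^+ 2.
      by rewrite sqr_sqrtr // subr_ge0.
    have ss' : s * s' = 1.
      apply/eqP; rewrite eq_complex /=; apply/andP; split; apply/eqP; last by ring.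
      by rewrite mulrN opprK -!expr2 sqE; ring.
    have s0 : s != 0.
      by apply: contra_eq_neq ss' => ->; rewrite mul0r eq_sym oner_eq0.
    have s'E : s^-1 = s' by apply: (mulfI s0); rewrite ss' divff.
    exists s; split=> //.
      rewrite s'E; apply/eqP; rewrite eq_complex /=.
      by apply/andP; split; apply/eqP; ring.
    rewrite s'E.
    have : s ^+ N * s' ^+ N = 1 by rewrite -exprMn ss' expr1n.
    have : sqnorm (s ^+ N) = 1.
      by rewrite sqnormX /sqnorm /= sqE addrC subrK expr1n.
    case: (s ^+ N) => [a b]; case: (s' ^+ N) => [c d].
    rewrite /sqnorm /= => ab /eqP; rewrite eq_complex /= => /andP[/eqP e1 /eqP e2].
    have cE : c = a.
      have : a * (a * c - b * d) + b * (a * d + b * c) = (a ^+2 + b ^+ 2) * c by ring.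
      by rewrite e1 e2 ab; lra.
    have dE : d = - b.
      have : - b * (a * c - b * d) + a * (a * d + b * c) = (a ^+2 + b ^+ 2) * d by ring.
      by rewrite e1 e2 ab; lra.
    have b1 : b ^+ 2 <= 1 by rewrite -ab lerDr sqr_ge0.
    rewrite ler_pdivlMr ?exprn_gt0 // mul1r cE dE {cE dE e1 e2 c d}.
    set E := (X in _ <= X).
    (* With s^N = a + i b of modulus one, the product is (1 + P^2)^2 - 4 P^2 b^2 >= (P^2 - 1)^2,
       which is at least P^2 as P >= 3. *)
    have -> : E = (a ^+ 2 + b ^+ 2 + P ^+ 2) ^+ 2 - 4 * P ^+ 2 * b ^+ 2.
      by rewrite /E; ring.
    rewrite ab.
    have : P ^+ 2 * b ^+ 2 <= P ^+ 2 by rewrite ler_piMr ?sqr_ge0.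
    move=> h.
    have h2 : 9 <= P ^+ 2.
      by move: P3; clear; nra.
    have -> : (1 + P ^+ 2) ^+ 2 = 1 + 2 * P ^+ 2 + P ^+ 2 * P ^+ 2 by ring.
    have : 9 * P ^+ 2 <= P ^+ 2 * P ^+ 2 by rewrite ler_pM2r ?exprn_gt0.
    by move: h h2; clear; lra.
  pose q := Num.sqrt (r ^+ 2 - 1).
  have qE : q ^+ 2 = r ^+ 2 - 1 by rewrite sqr_sqrtr // subr_ge0 ltW.
  have rq : (r + q) * (r - q) = 1.
    have -> : (r + q) * (r - q) = r ^+ 2 - q ^+ 2 by ring.
    by rewrite qE; ring.
  have s0 : r + q != 0.
    by apply: contra_eq_neq rq => ->; rewrite mul0r eq_sym oner_eq0.
  have s'E : (r + q)^-1 = r - q by apply: (mulfI s0); rewrite rq divff.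
  exists (r + q)%:C%C; split.
  - by rewrite eq_complex /= negb_and s0.
  - by rewrite -fmorphV s'E -rmorphD; congr _%:C%C; ring.
  rewrite -fmorphV -!rmorphXn /sqnorm /= ler_pdivlMr ?exprn_gt0 // mul1r.
  set E := (X in _ <= X).
  have -> : E = (((r + q) ^+ N) ^+ 2 + P ^+ 2) * (((r + q)^-1 ^+ N) ^+ 2 + P ^+ 2).
    by rewrite /E; ring.
  rewrite (le_trans (_ : P ^+ 2 <= P ^+ 2 * P ^+ 2)) //.
    by rewrite ler_peMl ?sqr_ge0 // exprn_ege1 //; move: P3; clear; lra.
  by rewrite ler_pM ?sqr_ge0 // lerDr sqr_ge0.
apply: (le_trans sW).
have Ps t : t ^+ N - 'i%C * P%:C%C = \prod_(u <- us) (t - u).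
  have := congr1 (horner ^~ t) usE; rewrite !hornerE /= => ->.
  by rewrite horner_prod; apply: eq_bigr => u _; rewrite hornerXsubC.
rewrite !Ps -sqnormM -big_split /= sqnorm_prod.
have -> : P ^+ 2 = \prod_(u <- us) rho ^+ 2.
  by rewrite big_const_seq count_predT sus iter_mulr_1 /P -!exprM mulnC.
rewrite -prodf_div le_eqVlt; apply/orP; left; apply/eqP.
apply: eq_big_seq => u uus.
(* 1 - 2 r u + u^2 = 2 u ((u + 1/u) / 2 - r), whose squared modulus is 4 rho^2 times the squared
   distance from r to the ellipse point. *)
have -> : (s - u) * (s^-1 - u) = 1 - u * (2 * r)%:C%C + u ^+ 2.
  by rewrite -ss; field.
have := usn u uus; case: u {uus} => x y; rewrite /sqnorm /= => xy.
set b := rho^-1 ^+ 2.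
have bS : b * (x ^+ 2 + y ^+ 2) = 1 by rewrite xy -exprMn mulVf // expr1n.
have e1 : rho * rho^-1 = 1 by rewrite divff.
apply: (canLR (mulfK _)); first by rewrite expf_neq0.
have -> : (rho + rho^-1) / 2 * (x / rho) = (x + b * x) / 2.
  by rewrite /b -[in RHS](mulr1 x) -[in x * 1]e1; field.
have -> : (rho - rho^-1) / 2 * (y / rho) = (y - b * y) / 2.
  by rewrite /b -[in RHS](mulr1 y) -[in y * 1]e1; field.
rewrite -xy; apply/eqP; rewrite -subr_eq0; apply/eqP.
transitivity ((1 - b * (x ^+ 2 + y ^+ 2)) *
  (- 2 * x * (2 * r - x) - 2 * y ^+ 2 + b * (x ^+ 2 + y ^+ 2) + 1)).
  by field.
by rewrite bS subrr mul0r.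
Qed.

End ellipse.

(** * Interlacing of roots and nodes *)

Section interlacing.
Context {R : realType}.

(** The signs of [nodal s y y] alternate along the sorted nodes, so p changes sign in each of the n
    intervals between neighbours, and these roots exhaust its degree. The last node lies to the
    right of all roots and gives the sign of the leading coefficient. *)
Lemma interlacing_roots (n : nat) (s : seq R) (p : {poly R}) :
  sorted <%R s -> size s = n.+1 -> (size p <= n.+1)%N ->
  (forall y, y \in s -> 0 < p.[y] * nodal s y y) ->
  exists r : seq R, [/\ size r = n,
    forall i, (i < n)%N -> s`_i < r`_i < s`_i.+1,
    p = p`_n *: \prod_(z <- r) ('X - z%:P) & 0 < p`_n].
Proof.
move=> ss sz sp sgn.
have us : uniq s by exact: (sorted_uniq lt_trans ltxx).
have ltn_s i j : (i < j)%N -> (j < n.+1)%N -> s`_i < s`_j.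
  move=> ij jn; apply: (sorted_ltn_nth lt_trans) => //; rewrite inE sz //.
  exact: ltn_trans jn.
have prodI (i : nat) : (i < n)%N -> p.[s`_i] * p.[s`_i.+1] < 0.
  move=> ip.
  set a := s`_i; set b := s`_i.+1.
  have ab : a < b by rewrite ltn_s.
  have As : a \in s by rewrite mem_nth // sz; apply: ltn_trans ip _.
  have Bs : b \in s by rewrite mem_nth // sz.
  have nn : nodal s a a * nodal s b b < 0.
    have Bs' : b \in rem a s by rewrite (mem_rem_uniq _ us) inE Bs gt_eqF.
    have pm : perm_eq s [:: a, b & rem b (rem a s)].
      by rewrite (permPl (perm_to_rem As)) perm_cons perm_to_rem.
    (* No node lies between the neighbours a and b: every other node contributes factors a - z and b
       - z of equal sign, and only a - b and b - a have opposite signs. *)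
    have nI z : z \in rem b (rem a s) -> [/\ z != a, z != b & 0 < (a - z) * (b - z)].
      rewrite mem_rem_uniq ?rem_uniq // inE /= mem_rem_uniq // inE => /and3P[zb za].
      move=> zs; split=> //; rewrite -(nth_index 0 zs).
      have ks : (index z s < n.+1)%N by rewrite -sz index_mem.
      have ka : index z s != i by apply: contra za => /eqP h; rewrite /a -h nth_index.
      have kb : index z s != i.+1 by apply: contra zb => /eqP h; rewrite /b -h nth_index.
      case: (ltngtP (index z s) i) ka => // ki _.
        have h := ltn_s _ _ ki (leqW ip).
        by rewrite mulr_gt0 // subr_gt0 // (lt_trans h).
      have {kb}ki : (i.+1 < index z s)%N by rewrite ltn_neqAle eq_sym kb.
      have h := ltn_s _ _ ki ks.
      by rewrite nmulr_lgt0 // subr_lt0 // (lt_trans ab).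
    rewrite !(perm_nodal pm) /nodal !big_cons !eqxx /= (gt_eqF ab) (lt_eqF ab) /=.
    rewrite mulrACA -[X in _ * X]opprK -/(GRing.opp _).
    set X := (X in - - X); have : 0 < X.
      rewrite /X; set r := rem b _ in nI *.
      have E c : (forall z, z \in r -> z != c) ->
          \prod_(z <- r | z != c) (c - z) = \prod_(z <- r) (c - z).
        move=> h; rewrite big_seq_cond [RHS]big_seq; apply: eq_bigl => z.
        by case zr : (z \in r) => //=; rewrite h.
      rewrite !E; [|by move=> z /nI[]..].
      by rewrite -big_split /= big_seq prodr_gt0 // => z /nI[].
    move=> X0; rewrite opprK nmulr_rlt0 //.
    by rewrite nmulr_rlt0 ?subr_lt0 // subr_gt0.
  have := mulr_gt0 (sgn _ As) (sgn _ Bs); rewrite mulrACA.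
  by rewrite nmulr_lgt0.
have rt (i : 'I_n) : exists x, s`_i < x < s`_i.+1 /\ root p x.
  have [||x xi rx] := @poly_ivtoo _ p s`_i s`_i.+1.
  - by rewrite ltW // ltn_s // ltnS.
  - exact: prodI.
  by exists x; move: xi; rewrite in_itv.
have [f fP] := choice rt.
pose r := [seq f i | i <- enum 'I_n].
have sr : size r = n by rewrite size_map size_enum_ord.
have rE (i : 'I_n) : r`_i = f i by rewrite (nth_map i) ?size_enum_ord // nth_ord_enum.
have rI i : (i < n)%N -> s`_i < r`_i < s`_i.+1.
  by move=> ip; have := fP (Ordinal ip); rewrite -rE /= => -[].
have rroot : all (root p) r.
  by apply/allP => _ /mapP[i _ ->]; case: (fP i).
have ru : uniq r.
  apply: (sorted_uniq lt_trans ltxx); apply/(sortedP 0) => i; rewrite sr => ip.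
  have /andP[_ h1] := rI i (ltnW ip); have /andP[h2 _] := rI i.+1 ip.
  exact: lt_trans h1 h2.
have s0 : s`_0 \in s by rewrite mem_nth // sz.
have p0 : p != 0 by apply: contraTneq (sgn _ s0) => ->; rewrite horner0 mul0r ltxx.
have sp' : size p = n.+1.
  by apply/eqP; rewrite eqn_leq sp /= -[in X in (X < _)%N]sr max_poly_roots.
have pE : p = p`_n *: \prod_(z <- r) ('X - z%:P).
  have -> : p`_n = lead_coef p by rewrite lead_coefE sp'.
  by apply: all_roots_prod_XsubC; rewrite ?sp' ?sr ?uniq_rootsE.
exists r; split=> //.
have sn : s`_n \in s by rewrite mem_nth // sz.
have := sgn _ sn; rewrite {1}pE hornerZ -mulrA pmulr_lgt0 //.
rewrite mulr_gt0 //.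
  rewrite horner_prod big_seq prodr_gt0 // => z zr; rewrite hornerXsubC subr_gt0.
  rewrite -(nth_index 0 zr).
  have zi : (index z r < n)%N by rewrite -sr index_mem.
  have /andP[_ h] := rI _ zi; apply: (lt_le_trans h).
  have [->//|ne] := eqVneq (index z r).+1 n.
  by rewrite ltW // ltn_s // ltn_neqAle ne.
rewrite /nodal big_seq_cond prodr_gt0 // => z /andP[zs zn]; rewrite subr_gt0.
rewrite -(nth_index 0 zs) ltn_s //.
have : (index z s < n.+1)%N by rewrite -sz index_mem.
rewrite ltnS leq_eqVlt => /predU1P[h|//].
by move: zn; rewrite -h nth_index // eqxx.
Qed.

End interlacing.

(** * Positive normalised functionals *)

Section mean.
Context {R : realType} (e : set R).

(** Abstracts phi |-> [perron e phi z], which is defined for arbitrary phi but linear only on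
    functions continuous on e. *)
Definition mean (L : (R -> R) -> R) := [/\
  forall f g : R -> R, {within e, continuous f} -> {within e, continuous g} ->
    L (f \+ g) = L f + L g,
  forall (k : R) (f : R -> R), {within e, continuous f} -> L (fun t => k * f t) = k * L f,
  forall f g : R -> R, {within e, continuous f} -> {within e, continuous g} ->
    (forall t, e t -> f t <= g t) -> L f <= L g
  & L (cst 1) = 1].

Lemma within_continuous_cst (c : R) : {within e, continuous (cst c : R -> R)}.
Proof. by move=> x; exact: cvg_cst. Qed.

Lemma within_continuous_sum (I : Type) (l : seq I) (F : I -> R -> R) :
  (forall i, {within e, continuous (F i)}) ->
  {within e, continuous (fun t => \sum_(i <- l) F i t)}.
Proof.
move=> cF; elim: l => [|i l IH].
  under eq_fun do rewrite big_nil; exact: within_continuous_cst.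
under eq_fun do rewrite big_cons.
by move=> x; apply: cvgD; [exact: cF|exact: IH].
Qed.

Lemma mean_cst L c : mean L -> L (cst c) = c.
Proof.
move=> [_ LZ _ L1]; have := LZ c (cst 1) (@within_continuous_cst 1).
rewrite L1 mulr1 => E; rewrite -[RHS]E.
by congr L; apply/funext => t; rewrite /cst mulr1.
Qed.

Lemma mean_sum L (I : Type) (l : seq I) (F : I -> R -> R) : mean L ->
  (forall i, {within e, continuous (F i)}) ->
  L (fun t => \sum_(i <- l) F i t) = \sum_(i <- l) L (F i).
Proof.
move=> mL cF; have [LD LZ Lle L1] := mL; elim: l => [|i l IH].
  rewrite big_nil -[RHS](mean_cst 0 mL); congr L.
  by apply/funext => t; rewrite big_nil.
rewrite big_cons -IH -LD //; last exact: within_continuous_sum.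
by congr L; apply/funext => t; rewrite big_cons.
Qed.

End mean.

(** * Averaging log |T - c q| over the ellipse *)

Section main.
Context {R : realType}.

Definition dist2 (p : R * R) (t : R) : R := Num.sqrt ((t - p.1) ^+ 2 + p.2 ^+ 2).

Lemma dist2_gt0 p t : 0 < p.2 -> 0 < dist2 p t.
Proof.
by move=> p0; rewrite /dist2 sqrtr_gt0 ltr_wpDl ?sqr_ge0 // exprn_gt0.
Qed.

Lemma dist2_ge1 p t : `|t - p.1| <= dist2 p t.
Proof. by rewrite /dist2 -sqrtr_sqr ler_wsqrtr // lerDl sqr_ge0. Qed.

Lemma dist2_ge2 p t : 0 <= p.2 -> p.2 <= dist2 p t.
Proof.
move=> p0; rewrite /dist2 -{1}(ger0_norm p0) -sqrtr_sqr ler_wsqrtr //.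
by rewrite lerDr sqr_ge0.
Qed.

Lemma ln_prod (I : eqType) (l : seq I) (F : I -> R) :
  (forall i, i \in l -> 0 < F i) ->
  ln (\prod_(i <- l) F i) = \sum_(i <- l) ln (F i).
Proof.
elim: l => [|i l IH] F0; first by rewrite !big_nil ln1.
have Fl j : j \in l -> 0 < F j by move=> jl; apply: F0; rewrite inE jl orbT.
rewrite !big_cons lnM ?IH // posrE; first by apply: F0; rewrite mem_head.
by rewrite big_seq prodr_gt0.
Qed.

Lemma exists_exprn_ge (rho B : R) : 1 < rho -> exists N, (1 < N)%N /\ B <= rho ^+ N.
Proof.
move=> rho1; have d0 : 0 < rho - 1 by rewrite subr_gt0.
have [n nB] : exists n : nat, B / (rho - 1) <= n%:R.
  exists (Num.bound `|B / (rho - 1)|).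
  by apply: (le_trans (ler_norm _)); apply/ltW/archi_boundP.
exists n.+2; split=> //; rewrite ler_pdivrMr // in nB.
apply: (le_trans nB); apply: (@le_trans _ _ (1 + n%:R * (rho - 1))).
  by rewrite lerDr.
have H k : 1 + k%:R * (rho - 1) <= rho ^+ k.
  elim: k => [|k IH]; first by rewrite mul0r addr0 expr0.
  rewrite exprS; apply: le_trans (ler_wpM2l (ltW (lt_trans ltr01 rho1)) IH).
  have : 0 <= k%:R * ((rho - 1) * (rho - 1)) by rewrite mulr_ge0 // mulr_ge0 // ltW.
  rewrite -natr1; lra.
by apply: (le_trans (H n)); rewrite ler_weXn2l ?(ltW rho1) // -addn2 leq_addr.
Qed.

(** The ellipse point c = (rho + 1/rho) x / 2 + i (rho - 1/rho) y / 2 is within rho - 1 of the real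
    number x, and the left-hand side is |X - c q|. *)
Lemma ellipse_dist (rho x y X q : R) : 1 < rho -> x ^+ 2 + y ^+ 2 = 1 ->
  Num.sqrt ((X - (rho + rho^-1) / 2 * x * q) ^+ 2
     + ((rho - rho^-1) / 2 * y * q) ^+ 2) <= `|X - x * q| + (rho - 1) * `|q|.
Proof.
move=> rho1 xy.
have rho0 : 0 < rho by apply: lt_trans rho1.
set a := rho^-1.
have aE : rho * a = 1 by rewrite divff // gt_eqF.
have a0 : 0 < a by rewrite invr_gt0.
have d0 : 0 <= rho - 1 by rewrite subr_ge0 ltW.
have D0 : 0 <= `|X - x * q| + (rho - 1) * `|q| by rewrite addr_ge0 // mulr_ge0.
rewrite -[leRHS]ger0_norm // -sqrtr_sqr ler_wsqrtr //.
set A := (rho + a) / 2 - 1.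
have -> : X - (rho + a) / 2 * x * q = (X - x * q) - A * x * q by rewrite /A; ring.
have a1 : a <= 1 by rewrite invf_le1 // ltW.
have Ale : `|A| <= rho - 1.
  have A0 : 0 <= A.
    have : 0 <= (rho - 1) ^+ 2 * (a / 2).
      by rewrite mulr_ge0 ?sqr_ge0 // divr_ge0 // ltW.
    rewrite (_ : _ * _ = A) // /A.
    have -> : (rho - 1) ^+ 2 * (a / 2) = (rho * (rho * a) - 2 * (rho * a) + a) / 2 by ring.
    by rewrite aE; field.
  by rewrite ger0_norm // /A; lra.
have q2 : q ^+ 2 = `|q| ^+ 2 by rewrite real_normK // num_real.
have X2 : (X - x * q) ^+ 2 = `|X - x * q| ^+ 2 by rewrite real_normK // num_real.
have x1 : `|x| <= 1.
  by rewrite -(@expr_le1 _ 2) // real_normK ?num_real // -xy lerDl sqr_ge0.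
have h1 : - ((X - x * q) * (A * x * q) *+ 2) <=
    `|X - x * q| * ((rho - 1) * `|q|) *+ 2.
  rewrite -mulNrn lerMn2r /= (le_trans (ler_norm _)) // normrN !normrM.
  by rewrite ler_wpM2l // ler_wpM2r // -[leRHS]mulr1 ler_pM.
have B0 : 0 <= (rho - a) / 2 by rewrite divr_ge0 //; lra.
have h2 : (A * x * q) ^+ 2 + ((rho - a) / 2 * y * q) ^+ 2 <= ((rho - 1) * `|q|) ^+ 2.
  rewrite exprMn [leRHS]exprMn -q2 [X in _ + X]exprMn -mulrDl ler_wpM2r ?sqr_ge0 //.
  rewrite [(A * x) ^+ 2]exprMn [((rho - a) / 2 * y) ^+ 2]exprMn.
  have hA : A ^+ 2 <= (rho - 1) ^+ 2 by rewrite -(@real_normK _ A) ?num_real // ler_pXn2r // ?nnegrE.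
  have hB : ((rho - a) / 2) ^+ 2 <= (rho - 1) ^+ 2.
    rewrite ler_pXn2r ?nnegrE //.
    have : 0 <= (rho - 1) * (1 - a) by rewrite mulr_ge0 // subr_ge0.
    have -> : (rho - 1) * (1 - a) = rho - (rho * a) - 1 + a by ring.
    rewrite aE; lra.
  by rewrite -[leRHS]mulr1 -[in X in _ <= _ * X]xy mulrDr lerD // ler_wpM2r ?sqr_ge0.
rewrite (sqrrB (X - x * q)) (sqrrD `|X - x * q|) -X2 -!addrA lerD2l.
by rewrite [leRHS]addrA -mulr2n lerD.
Qed.

End main.

Section main.
Context {R : realType}.

(** Potential theory enters only through the hypotheses: h stands for the Green function in the
    coordinate m, G for its Robin constant, and [PW] bounds the sums of h over points that interlace
    the nodes. Each ellipse point is replaced by a nearby real number v.1 in [-1, 1], for which T -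
    v.1 q0 has interlacing roots; the height tau pays for the replacement. *)
Lemma main_inequality (e : set R) (L : (R -> R) -> R) (n : nat) (m a : R -> R)
    (G PW qB : R) (h : R * R -> R) (s : seq R) (q0 T : {poly R}) :
  mean e L ->
  (forall t, e t -> 0 < a t) ->
  (forall t, e t -> `|q0.[m t]| <= qB) ->
  (forall t, e t -> q0.[m t] != 0) ->
  {within e, continuous (fun t => ln (a t ^+ n * `|q0.[m t]|))} ->
  (forall p, 0 < p.2 -> {within e, continuous (fun t => ln (a t * dist2 p (m t)))}) ->
  (forall p, 0 < p.2 -> L (fun t => ln (a t * dist2 p (m t))) <= h p - G) ->
  (forall eps, 0 < eps -> exists2 tau, 0 < tau & forall rho,
     s`_0 <= rho <= s`_n -> h (rho, tau) <= h (rho, 0) + eps) ->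
  (forall r : seq R, size r = n ->
     (forall i, (i < n)%N -> s`_i < r`_i < s`_i.+1) ->
     \sum_(z <- r) h (z, 0) <= PW) ->
  sorted <%R s -> size s = n.+1 -> (size T <= n.+1)%N -> (size q0 <= n.+1)%N ->
  (forall y, y \in s -> 0 < T.[y] * nodal s y y) ->
  (forall y, y \in s -> `|T.[y]| = `|q0.[y]|) ->
  L (fun t => ln (a t ^+ n * `|q0.[m t]|)) <= ln (2 * T`_n) - n%:R * G + PW.
Proof.
move=> mL a0 qmB qm0 cQ ck Lk hunif hPW ss sz sT sq Tsgn Tq.
have [LD LZ Lle L1] := mL.
have step eta eps : 0 < eta -> 0 < eps ->
  L (fun t => ln (a t ^+ n * `|q0.[m t]|)) <=
  ln (2 * (1 + eps)) + ln ((1 + eta) * T`_n) - n%:R * G + PW + n%:R * eps.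
  move=> eta0 eps0; set A1 := (1 + eta) * T`_n.
  (* At the nodes |T| = |q0|, so T - c q0 may vanish there when |c| = 1; the factor 1 + eta makes
     the signs strict. *)
  pose P c := (1 + eta) *: T - c *: q0.
  have PE c x : (P c).[x] = (1 + eta) * T.[x] - c * q0.[x] by rewrite !hornerE.
  have Pn c : (P c)`_n = A1 - c * q0`_n by rewrite coefB !coefZ.
  have roots c : `|c| <= 1 -> exists r : seq R, [/\ size r = n,
    forall i, (i < n)%N -> s`_i < r`_i < s`_i.+1,
    P c = (P c)`_n *: \prod_(z <- r) ('X - z%:P) & 0 < (P c)`_n].
    move=> c1; apply: interlacing_roots => //.
      rewrite (leq_trans (size_polyD _ _)) // geq_max size_polyN.
      by rewrite !(leq_trans (size_scale_leq _ _)).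
    move=> y ys; rewrite PE mulrBl subr_gt0 -mulrA.
    rewrite (le_lt_trans (ler_norm _)) // !normrM -Tq // -mulrA -normrM.
    rewrite [`|T.[y] * _|]gtr0_norm ?Tsgn // (@le_lt_trans _ _ (T.[y] * nodal s y y)) //.
      by rewrite ler_piMl // ltW // Tsgn.
    by rewrite ltr_pMl ?Tsgn // ltrDl.
  have rootsx c : exists r : seq R, `|c| <= 1 -> [/\ size r = n,
    forall i, (i < n)%N -> s`_i < r`_i < s`_i.+1,
    P c = (P c)`_n *: \prod_(z <- r) ('X - z%:P) & 0 < (P c)`_n].
    by have [/roots [r rP]|c1] := pselect (`|c| <= 1); [exists r|exists [::]].
  have [rr rrP] := choice rootsx.
  (* A lower bound for the leading coefficient of [P c], uniform in |c| <= 1; it is positive because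
     c = 1 and c = -1 are both allowed. *)
  set lm := A1 - `|q0`_n|.
  have lm0 : 0 < lm.
    have h1 : 0 < A1 - q0`_n by have [_ _ _] := rrP 1 ltac:(by rewrite normr1); rewrite Pn mul1r.
    have h2 : 0 < A1 + q0`_n.
      by have [_ _ _] := rrP (-1) ltac:(by rewrite normrN normr1); rewrite Pn mulN1r opprK.
    by rewrite subr_gt0 ltr_norml; apply/andP; split; move: h1 h2; clear; lra.
  have lmP c : `|c| <= 1 -> lm <= (P c)`_n.
    move=> c1; rewrite Pn /lm lerB //.
    by rewrite (le_trans (ler_norm _)) // normrM ler_piMl.
  have A10 : 0 < A1 by apply: lt_le_trans lm0 _; rewrite /lm gerBl.
  have [tau tau0 htau] := hunif _ eps0.
  have qB0 : 0 < `|qB| + 1 by rewrite ltr_wpDl.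
  (* Makes the ellipse error delta * |q0| at most eps * lm * tau^n, and lm * tau^n is at most the
     leading coefficient times the product of n distances [dist2 (z, tau)], each of them at least
     tau. *)
  set delta := eps * lm * tau ^+ n / (`|qB| + 1).
  have delta0 : 0 < delta by rewrite divr_gt0 // !mulr_gt0 // exprn_gt0.
  have rho1 : 1 < 1 + delta by rewrite ltrDl.
  have [N [N1 N3]] := exists_exprn_ge 3 rho1.
  have [u [su uc usum uprod]] := ellipse_nodes rho1 N3 N1.
  have u1 v : v \in u -> `|v.1| <= 1.
    move=> /uc uv; rewrite -(@expr_le1 _ 2) // real_normK ?num_real //.
    by rewrite -uv lerDl sqr_ge0.
  pose k (v : R * R) : R := 2 * (1 + eps) * (P v.1)`_n.
  have k0 (v : R * R) : v \in u -> 0 < k v.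
    by move=> /u1 v1; have [_ _ _ ?] := rrP _ v1; rewrite !mulr_gt0 // addr_gt0.
  (* With X = (1 + eta) T and F v >= 2 |X - c q0|, the lower bound for the product over the ellipse
     gives |q0|^N <= prod F v. The n-th power of a t is then distributed over the n distances in
     each F v. *)
  have pw t : e t -> N%:R * ln (a t ^+ n * `|q0.[m t]|) <=
      \sum_(v <- u) (ln (k v) + \sum_(z <- rr v.1) ln (a t * dist2 (z, tau) (m t))).
    move=> et; set X := (1 + eta) * T.[m t]; set q := q0.[m t].
    have at0 := a0 t et.
    have q_gt0 : 0 < `|q| by rewrite normr_gt0 qm0.
    pose F (v : R * R) := k v * \prod_(z <- rr v.1) dist2 (z, tau) (m t).
    have d0 z : 0 < dist2 (z, tau) (m t) by exact: dist2_gt0.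
    have F0 v : v \in u -> 0 < F v by move=> vu; rewrite mulr_gt0 ?k0 // prodr_gt0.
    have Fle v : v \in u ->
      4 * ((X - (1 + delta + (1 + delta)^-1) / 2 * v.1 * q) ^+ 2
         + ((1 + delta - (1 + delta)^-1) / 2 * v.2 * q) ^+ 2) <= F v ^+ 2.
      move=> vu; have [sr rI PrE Pv0] := rrP _ (u1 _ vu).
      set E := (_ ^+ 2 + _ ^+ 2).
      have E0 : 0 <= E by rewrite addr_ge0 ?sqr_ge0.
      rewrite -(sqr_sqrtr E0) (_ : 4 = 2 ^+ 2) -?exprMn; last by ring.
      have F2 : 2 * Num.sqrt E <= F v.
        rewrite /F /k -!mulrA ler_pM2l //.
        rewrite (le_trans (ellipse_dist _ _ rho1 (uc _ vu))) //.
        have -> : X - v.1 * q = (P v.1)`_n * \prod_(z <- rr v.1) (m t - z).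
          rewrite -PE PrE hornerZ coefZ.
          rewrite (_ : (\prod_(z <- rr v.1) ('X - z%:P))`_n = 1) ?mulr1.
            rewrite horner_prod; congr (_ * _).
            by apply: eq_bigr => z _; rewrite hornerXsubC.
          have := monic_prod_XsubC (rr v.1) xpredT id.
          by rewrite monicE lead_coefE size_prod_XsubC sr => /eqP.
        rewrite [1 + delta - 1]addrAC subrr add0r [leRHS]mulrDl mul1r lerD //.
          rewrite normrM gtr0_norm // ler_pM2l // normr_prod ler_prod // => z _.
          by rewrite normr_ge0 (dist2_ge1 (z, tau)).
        have -> : delta * `|q| = eps * (lm * tau ^+ n) * (`|q| / (`|qB| + 1)).
          by rewrite /delta; ring.
        apply: (@le_trans _ _ (eps * (lm * tau ^+ n) * 1)).
          rewrite ler_pM2l ?mulr_gt0 ?exprn_gt0 // ler_pdivrMr // mul1r.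
          rewrite (le_trans (qmB _ et)) // (le_trans (ler_norm _)) //.
          by rewrite lerDl.
        rewrite mulr1 ler_pM2l // ler_pM ?exprn_ge0 ?(ltW lm0) ?(ltW tau0) ?lmP ?u1 //.
        have <- : \prod_(z <- rr v.1) tau = tau ^+ n.
          by rewrite big_const_seq count_predT sr iter_mulr_1.
        apply: ler_prod => z _.
        by rewrite (ltW tau0) (dist2_ge2 (p := (z, tau))) // ltW.
      have F00 := ltW (F0 _ vu).
      by rewrite ler_pXn2r // nnegrE; apply: mulr_ge0 => //; exact: sqrtr_ge0.
    have qF : `|q| ^+ N <= \prod_(v <- u) F v.
      have PF0 : 0 <= \prod_(v <- u) F v.
        by rewrite big_seq; apply: prodr_ge0 => v vu; exact: ltW (F0 _ vu).
      rewrite -(@ler_pXn2r _ 2) // ?nnegrE ?exprn_ge0 //.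
      rewrite -prodrXl -exprM mulnC exprM real_normK ?num_real //.
      apply: (@le_trans _ _ (\prod_(v <- u) (q ^+ 2 *
          (4 * ((X / q - (1 + delta + (1 + delta)^-1) / 2 * v.1) ^+ 2
             + ((1 + delta - (1 + delta)^-1) / 2 * v.2) ^+ 2))))).
        rewrite big_split /= big_const_seq count_predT su iter_mulr_1.
        by rewrite ler_peMr // exprn_ge0 // sqr_ge0.
      rewrite big_seq [leRHS]big_seq ler_prod // => v vu; apply/andP; split.
        by rewrite mulr_ge0 ?sqr_ge0 // mulr_ge0 // addr_ge0 // sqr_ge0.
      apply: le_trans (Fle v vu); rewrite le_eqVlt; apply/orP; left; apply/eqP.
      have qn0 : q != 0 by exact: qm0.
      have d1 : 1 + delta != 0 by rewrite gt_eqF // addr_gt0.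
      by field; rewrite qn0 d1.
    have sr v : v \in u -> size (rr v.1) = n by move=> /u1 /rrP[].
    have aF v : v \in u ->
        ln (k v) + \sum_(z <- rr v.1) ln (a t * dist2 (z, tau) (m t)) =
        ln (a t ^+ n * F v).
      move=> vu; rewrite -ln_prod => [|z _]; last by rewrite mulr_gt0.
      rewrite -lnM ?posrE ?k0 //; last by rewrite prodr_gt0 // => z _; rewrite mulr_gt0.
      congr ln; rewrite big_split /= big_const_seq count_predT sr // iter_mulr_1 /F.
      by ring.
    rewrite (eq_big_seq _ aF) -ln_prod => [|v vu]; last first.
      by rewrite mulr_gt0 ?F0 // exprn_gt0.
    rewrite mulr_natl -lnXn ?mulr_gt0 ?exprn_gt0 // ler_ln ?posrE; last 2 first.
    - by rewrite exprn_gt0 // mulr_gt0 // exprn_gt0.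
    - by rewrite big_seq prodr_gt0 // => v vu; rewrite mulr_gt0 ?F0 // exprn_gt0.
    rewrite exprMn big_split /= big_const_seq count_predT su iter_mulr_1.
    by rewrite ler_wpM2l // !exprn_ge0 // ltW.
  have N0 : 0 < N%:R :> R by rewrite ltr0n ltnW.
  rewrite -(ler_pM2l N0) -LZ //.
  have cs (v : R * R) : {within e, continuous (fun t => ln (k v) +
      \sum_(z <- rr v.1) ln (a t * dist2 (z, tau) (m t)))}.
    move=> x; apply: cvgD; first exact: cvg_cst.
    by apply: within_continuous_sum => z; apply: ck.
  apply: (@le_trans _ _ (L (fun t => \sum_(v <- u) (ln (k v) +
      \sum_(z <- rr v.1) ln (a t * dist2 (z, tau) (m t)))))).
    apply: Lle => //; last exact: within_continuous_sum.
    by move=> x; apply: cvgM; [exact: cvg_cst|exact: cQ].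
  rewrite (mean_sum _ mL) //.
  apply: (@le_trans _ _ (\sum_(v <- u) (ln (2 * (1 + eps)) + ln (P v.1)`_n
      + (PW + n%:R * eps - n%:R * G)))).
    rewrite big_seq [leRHS]big_seq ler_sum // => v vu.
    have [sr rI _ Pv0] := rrP _ (u1 _ vu).
    rewrite (LD (cst (ln (k v))) (fun t => \sum_(z <- rr v.1) _)); last 2 first.
    - exact: within_continuous_cst.
    - by apply: within_continuous_sum => z; apply: ck.
    rewrite (mean_cst _ mL) (mean_sum _ mL) => [|z]; last exact: ck.
    rewrite /k lnM ?posrE //; last by rewrite mulr_gt0 // addr_gt0.
    rewrite lerD2l.
    apply: (@le_trans _ _ (\sum_(z <- rr v.1) (h (z, 0) + (eps - G)))).
      rewrite big_seq [leRHS]big_seq ler_sum // => z zr.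
      apply: (le_trans (Lk (z, tau) tau0)); rewrite addrA lerD2r; apply: htau.
      rewrite -(nth_index 0 zr).
      have zn : (index z (rr v.1) < n)%N by rewrite -sr index_mem.
      have sn i j : (i <= j)%N -> (j < n.+1)%N -> s`_i <= s`_j.
        move=> ij jn; apply: (sorted_leq_nth le_trans lexx) => //.
        - by apply: sub_sorted ss => ? ?; exact: ltW.
        - by rewrite inE sz (leq_ltn_trans ij).
        - by rewrite inE sz.
      have /andP[l1 l2] := rI _ zn; apply/andP; split.
        by apply: le_trans (ltW l1); rewrite sn // leqW.
      by apply: (le_trans (ltW l2)); rewrite sn.
    rewrite big_split /= big_const_seq count_predT sr iter_addr_0 -(mulr_natl (eps - G)).
    rewrite mulrBr addrA lerB // lerD2r.
    exact: hPW.
  set W := PW + n%:R * eps - n%:R * G.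
  rewrite big_split /= big_const_seq count_predT su iter_addr_0 -(mulr_natl W).
  rewrite big_split /= big_const_seq count_predT su iter_addr_0 -(mulr_natl (ln _)).
  (* ln (A1 (1 - x)) <= ln A1 - x with x proportional to v.1, and the v.1 sum to zero: the
     dependence of the leading coefficient on the ellipse point averages out. *)
  have lnP : \sum_(v <- u) ln (P v.1)`_n <= N%:R * ln A1.
    apply: (@le_trans _ _ (\sum_(v <- u) (ln A1 - v.1 * (q0`_n / A1)))).
      rewrite big_seq [leRHS]big_seq ler_sum // => v vu.
      have [_ _ _ Pv0] := rrP _ (u1 _ vu).
      have -> : (P v.1)`_n = A1 * (1 - v.1 * (q0`_n / A1)).
        by rewrite Pn; field; rewrite gt_eqF.
      have P1 : 0 < 1 - v.1 * (q0`_n / A1).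
        by rewrite -(pmulr_rgt0 _ A10); move: Pv0; rewrite Pn; congr (0 < _); field; rewrite gt_eqF.
      rewrite lnM ?posrE // lerD2l le_ln1Dx //.
      by move: P1; set w := v.1 * _; clear; lra.
    rewrite big_split /= sumrN -mulr_suml usum mul0r subr0.
    by rewrite big_const_seq count_predT su iter_addr_0 mulr_natl.
  rewrite -(lerD2l (N%:R * (ln (2 * (1 + eps)) + W))) in lnP.
  move: lnP; rewrite /W; clear; set S := \sum_(v <- u) _; set A := ln A1; set B := ln _.
  by move=> h; apply: le_trans (le_trans _ h) _; rewrite le_eqVlt; apply/orP; left; apply/eqP; ring.
(* Interlacing for T itself gives 0 < T_n, so that the logarithms below can be split. *)
have [_ [_ _ _ T0]] : exists r : seq R, [/\ size r = n,
    forall i, (i < n)%N -> s`_i < r`_i < s`_i.+1,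
    T = T`_n *: \prod_(z <- r) ('X - z%:P) & 0 < T`_n].
  exact: interlacing_roots.
apply/ler_addgt0Pr => x x0.
have n2 : 0 < n%:R + 2 :> R by rewrite ltr_wpDl.
(* The total loss consists of two terms ln (1 + y) <= y and of n y. *)
set y := x / (n%:R + 2).
have y0 : 0 < y by rewrite divr_gt0.
have yE : x = y * (n%:R + 2) by rewrite /y divfK // gt_eqF.
apply: (le_trans (step y y y0 y0)).
have ly : ln (1 + y) <= y by rewrite le_ln1Dx //; move: y0; clear; lra.
have y1 : 0 < 1 + y by rewrite addr_gt0.
rewrite !lnM ?posrE //.
rewrite yE; move: ly; clear; set a := ln _; set b := ln 2; lra.
Qed.

End main.

(** * Harmonic functions in the plane *)

Section fourpoint.
Context {R : realType}.
Implicit Types (u : R * R -> R) (p q : R * R).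

(** The difference approximation of r^2 times the Laplacian. Unlike derivatives, it can be estimated
    for functions known only through bounds on finite linear combinations of their values. *)
Definition four_point u p (r : R) : R :=
  u (p.1 + r, p.2) + u (p.1 - r, p.2) + u (p.1, p.2 + r) + u (p.1, p.2 - r)
  - 4 * u p.

(* Blaschke's asymptotic form of harmonicity at a point *)
Definition asym_harmonic u p := forall eps : R, 0 < eps ->
  exists2 d : R, 0 < d &
    forall r, 0 < r -> r < d -> `|four_point u p r| <= eps * r ^+ 2.

Lemma line_derive u p (v : R * R) (r : R) : derivable u (p + r *: v) v ->
  is_derive r (1 : R) (fun s : R => u (p + s *: v)) ('D_v u (p + r *: v)).
Proof.
move=> du.
have E : (fun h : R => h^-1 *: (((fun s : R => u (p + s *: v)) \o shift r) (h *: 1) -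
      u (p + r *: v))) = (fun h : R => h^-1 *: ((u \o shift (p + r *: v)) (h *: v) -
      u (p + r *: v))).
  apply/funext => h /=; congr (_ *: (u _ - _)).
  have -> : h *: (1 : R) = h by exact: mulr1.
  by rewrite scalerDl addrCA.
by apply: DeriveDef; [rewrite /derivable E|rewrite /derive E].
Qed.

(** F' is only assumed to be differentiable at 0, so instead of Taylor's formula the mean value
    theorem is applied to F s + F (- s) - F2 s^2, whose derivative is o(s). *)
Lemma second_difference (F F' : R -> R) (F2 d : R) : 0 < d ->
  (forall r, `|r| < d -> is_derive r (1 : R) F (F' r)) ->
  is_derive (0 : R) (1 : R) F' F2 ->
  forall eps : R, 0 < eps -> exists2 d' : R, 0 < d' & forall r, 0 < r -> r < d' ->
    `|F r + F (- r) - 2 * F 0 - F2 * r ^+ 2| <= eps * r ^+ 2.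
Proof.
move=> d0 dF [dF'1 dF'2] eps eps0.
have e20 : 0 < eps / 2 by rewrite divr_gt0.
have : \forall h \near 0^', `|F2 - h^-1 *: (F' (h *: 1 + 0) - F' 0)| < eps / 2.
  have := dF'1; rewrite /derivable => /cvg_ex[l hl].
  have le : l = F2 by rewrite -dF'2; apply/esym/cvg_lim.
  rewrite le in hl; move/cvgr_dist_lt : hl => /(_ _ e20); by apply: filterS.
move=> [d1 /= d10 hd1].
have F'B c : `|c| < d1 -> `|F' c - F' 0 - F2 * c| <= eps / 2 * `|c|.
  move=> cd; have [->|c0] := eqVneq c 0; first by rewrite subrr mulr0 subrr normr0 mulr0.
  have := hd1 c; rewrite /ball_ /= sub0r normrN => /(_ cd c0).
  have -> : c *: (1 : R) = c by exact: mulr1.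
  rewrite addr0 => h.
  have -> : F' c - F' 0 - F2 * c = - (F2 - c^-1 * (F' c - F' 0)) * c by field.
  by rewrite normrM normrN ler_wpM2r // ltW.
exists (Num.min d d1); first by rewrite lt_min d0.
move=> r r0; rewrite lt_min => /andP[rd rd1].
pose phi (s : R) := F s + F (- s) - F2 * s ^+ 2.
have dphi s : `|s| < d ->
    is_derive s (1 : R) phi (F' s - F' (- s) - F2 * (2 * s)).
  move=> sd; have d1s := dF s sd.
  have d2s : is_derive s (1 : R) (fun s => F (- s)) (- F' (- s)).
    have dFN := dF (- s) ltac:(by rewrite normrN).
    have := @is_derive1_comp _ F -%R s (F' (- s)) (- 1) dFN _.
    rewrite mulrN1; apply.
  rewrite /phi; apply: is_derive_eq.
  by rewrite /GRing.scale /=; ring.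
have [c /andP[c0 cr] phiE] : exists2 c, 0 < c < r & phi r - phi 0 =
    (F' c - F' (- c) - F2 * (2 * c)) * (r - 0).
  have sub x : 0 <= x -> x <= r -> `|x| < d.
    by move=> x0 xr; rewrite ger0_norm // (le_lt_trans xr).
  have [x||c] := @MVT _ phi (fun s => F' s - F' (- s) - F2 * (2 * s)) 0 r r0.
  - by rewrite in_itv /= => /andP[x0 xr]; apply/dphi/sub; exact: ltW.
  - apply: derivable_within_continuous => x; rewrite in_itv /= => /andP[x0 xr].
    by have [] := dphi x (sub x x0 xr).
  - by rewrite in_itv /= => cr ->; exists c.
have -> : F r + F (- r) - 2 * F 0 - F2 * r ^+ 2 = phi r - phi 0.
  by rewrite /phi oppr0 expr0n /= mulr0; ring.
rewrite phiE subr0 normrM (gtr0_norm r0) expr2 [leRHS]mulrA ler_pM2r //.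
have cd1 : `|c| < d1 by rewrite gtr0_norm // (lt_trans cr).
have h1 := F'B c cd1.
have h2 := F'B (- c) ltac:(by rewrite normrN).
have -> : F' c - F' (- c) - F2 * (2 * c) =
    (F' c - F' 0 - F2 * c) - (F' (- c) - F' 0 - F2 * (- c)) by ring.
rewrite (le_trans (ler_normB _ _)) //.
rewrite (normrN c) (gtr0_norm c0) in h2; rewrite (gtr0_norm c0) in h1.
rewrite (le_trans (lerD h1 h2)) // (le_trans _ (ler_wpM2l (ltW eps0) (ltW cr))) //.
by rewrite le_eqVlt; apply/orP; left; apply/eqP; field.
Qed.

Lemma open_box (U : set (R * R)) p : open U -> U p ->
  exists2 d : R, 0 < d & forall q, `|q.1 - p.1| < d -> `|q.2 - p.2| < d -> U q.
Proof.
move=> oU Up; have /nbhs_ballP[d /= d0 dU] := open_nbhs_nbhs (conj oU Up).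
exists d => // -[a b] /= h1 h2; apply: dU; split => /=.
  by rewrite /ball /= distrC.
by rewrite /ball /= distrC.
Qed.

Lemma shift_e1 p (s : R) : p + s *: (1, 0) = (p.1 + s, p.2).
Proof. by case: p => a b; congr (_, _) => /=; rewrite /GRing.scale /= ?mulr1 ?mulr0 ?addr0. Qed.

Lemma shift_e2 p (s : R) : p + s *: (0, 1) = (p.1, p.2 + s).
Proof. by case: p => a b; congr (_, _) => /=; rewrite /GRing.scale /= ?mulr1 ?mulr0 ?addr0. Qed.

Lemma four_point_split u p (r A B : R) : A + B = 0 -> four_point u p r =
    (u (p.1 + r, p.2) + u (p.1 - r, p.2) - 2 * u p - A * r ^+ 2)
  + (u (p.1, p.2 + r) + u (p.1, p.2 - r) - 2 * u p - B * r ^+ 2).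
Proof. by rewrite /four_point addrC => /eqP; rewrite addr_eq0 => /eqP ->; ring. Qed.

Lemma harmonic_asym (U : set (R * R)) u p : open U -> plane_harmonic U u -> U p ->
  asym_harmonic u p.
Proof.
move=> oU [C2u lu] Up eps eps0.
have [d d0 dU] := open_box oU Up.
have e20 : 0 < eps / 2 by rewrite divr_gt0.
have H (v : R * R) : v \in [:: (1, 0); (0, 1)] ->
    (forall s, `|s| < d -> U (p + s *: v)) ->
    exists2 d' : R, 0 < d' & forall r, 0 < r -> r < d' ->
    `|u (p + r *: v) + u (p + (- r) *: v) - 2 * u p - 'D_v ('D_v u) p * r ^+ 2|
      <= eps / 2 * r ^+ 2.
  move=> vI vU.
  have p0 : p = p + 0 *: v by rewrite scale0r addr0.
  have [||d' d'0 hd'] := second_difference (F := fun s => u (p + s *: v))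
      (F' := fun s => 'D_v u (p + s *: v)) (F2 := 'D_v ('D_v u) p) d0 _ _ e20.
  - move=> r rd; apply: line_derive.
    by have [h _ _] := C2u v v vI vI _ (vU r rd); exact: h.
  - rewrite {2}p0; apply: line_derive; rewrite -p0.
    by have [_ h _] := C2u v v vI vI p Up; exact: h.
  by exists d' => // r r0 rd'; have := hd' r r0 rd'; rewrite scale0r addr0.
have [|s sd|d1 d10 h1] := H (1, 0).
- by rewrite !inE eqxx.
- by rewrite shift_e1; apply: dU => /=; [rewrite addrAC subrr add0r|rewrite subrr normr0].
have [|s sd|d2 d20 h2] := H (0, 1).
- by rewrite !inE eqxx orbT.
- by rewrite shift_e2; apply: dU => /=; [rewrite subrr normr0|rewrite addrAC subrr add0r].
exists (Num.min d1 d2); first by rewrite lt_min d10.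
move=> r r0; rewrite lt_min => /andP[rd1 rd2].
have := h1 r r0 rd1; have := h2 r r0 rd2; rewrite !shift_e1 !shift_e2 => {}h2 {}h1.
rewrite (four_point_split u p r (lu p Up)).
rewrite (le_trans (ler_normD _ _)) //.
have -> : eps * r ^+ 2 = eps / 2 * r ^+ 2 + eps / 2 * r ^+ 2 by field.
exact: (lerD h1 h2).
Qed.

Lemma MVT_le (f df : R -> R) (a b C : R) : a <= b ->
  (forall t, a <= t <= b -> is_derive t (1 : R) f (df t) /\ `|df t| <= C) ->
  `|f b - f a| <= C * (b - a).
Proof.
move=> ab H.
have [x||c cI ->] := @MVT_segment _ f df a b ab.
- by rewrite in_itv /= => /andP[ax xb]; have /H[] : a <= x <= b by rewrite !ltW.
- apply: derivable_within_continuous => x; rewrite in_itv /= => xI.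
  by have [[]] := H x xI.
rewrite normrM (ger0_norm (_ : 0 <= b - a)) ?subr_ge0 // ler_wpM2r ?subr_ge0 //.
by move: cI; rewrite in_itv /= => /H[].
Qed.

Lemma bounded_partials_continuous u p (d C : R) : 0 < d ->
  (forall q, `|q.1 - p.1| < d -> `|q.2 - p.2| < d ->
    forall v, v \in [:: (1, 0); (0, 1)] -> derivable u q v /\ `|'D_v u q| <= C) ->
  {for p, continuous u}.
Proof.
move=> d0 H.
have C0 : 0 <= C.
  have [] := H p _ _ (1, 0); rewrite ?subrr ?normr0 ?inE ?eqxx //.
  by move=> _; apply: le_trans.
have I1 : ((1, 0) : R * R) \in [:: (1, 0); (0, 1)] by rewrite inE eqxx.
have I2 : ((0, 1) : R * R) \in [:: (1, 0); (0, 1)] by rewrite !inE eqxx orbT.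
have seg (v q : R * R) (s : R) : v \in [:: (1, 0); (0, 1)] ->
    (forall t, `|t| <= `|s| -> `|(q + t *: v).1 - p.1| < d /\ `|(q + t *: v).2 - p.2| < d) ->
    `|u (q + s *: v) - u q| <= C * `|s|.
  move=> vI B.
  pose f (t : R) := u (q + t *: v); pose df (t : R) := 'D_v u (q + t *: v).
  have D t : `|t| <= `|s| -> is_derive t (1 : R) f (df t) /\ `|df t| <= C.
    move=> /B[b1 b2]; have [h1 h2] := H _ b1 b2 v vI.
    by split; [exact: line_derive h1|exact: h2].
  have -> : u (q + s *: v) = f s by [].
  have -> : u q = f 0 by rewrite /f scale0r addr0.
  move: f df D => f df D {B}.
  have [s0|s0] := leP 0 s.
    have -> : `|s| = s - 0 by rewrite subr0 ger0_norm.
    apply: (MVT_le s0) => t /andP[t0 ts]; apply: D.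
    by rewrite !ger0_norm.
  have -> : `|s| = 0 - s by rewrite sub0r ltr0_norm.
  rewrite distrC; apply: (MVT_le (ltW s0)) => t /andP[ts t0]; apply: D.
  by rewrite !ler0_norm ?lerN2 // ltW.
apply/cvgrPdist_lt => /= eps eps0.
have e0 : 0 < eps / (2 * C + 1) by rewrite divr_gt0 // ltr_wpDl // mulr_ge0.
near=> q.
have [h1 h2] : `|q.1 - p.1| < Num.min d (eps / (2 * C + 1)) /\
    `|q.2 - p.2| < Num.min d (eps / (2 * C + 1)).
  have : ball p (Num.min d (eps / (2 * C + 1))) q.
    near: q; have m0 : 0 < Num.min d (eps / (2 * C + 1)) by rewrite lt_min d0.
    exact: (nbhsx_ballx p _ m0).
  by move=> -[]; rewrite /ball /= distrC => ?; rewrite distrC.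
move: h1 h2; rewrite !lt_min => /andP[h1d h1] /andP[h2d h2].
have E1 : p + (q.1 - p.1) *: (1, 0) = (q.1, p.2) by rewrite shift_e1 addrC subrK.
have E2 : (q.1, p.2) + (q.2 - p.2) *: (0, 1) = q.
  by rewrite shift_e2 /= addrC subrK; case: (q).
have s1 := seg (1, 0) p (q.1 - p.1) I1.
have s2 := seg (0, 1) (q.1, p.2) (q.2 - p.2) I2.
rewrite E1 in s1; rewrite E2 in s2.
have {}s1 : `|u (q.1, p.2) - u p| <= C * `|q.1 - p.1|.
  apply: s1 => t tq; rewrite shift_e1 /= subrr normr0; split=> //.
  by rewrite addrAC subrr add0r (le_lt_trans tq).
have {}s2 : `|u q - u (q.1, p.2)| <= C * `|q.2 - p.2|.
  apply: s2 => t tq; rewrite shift_e2 /=; split=> //.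
  by rewrite addrAC subrr add0r (le_lt_trans tq).
have -> : u p - u q = - (u q - u (q.1, p.2)) - (u (q.1, p.2) - u p) by ring.
rewrite (le_lt_trans (ler_normB _ _)) // normrN.
apply: (le_lt_trans (lerD s2 s1)); rewrite -mulrDr.
have K : 0 < 2 * C + 1 by rewrite ltr_wpDl // mulr_ge0.
apply: (@le_lt_trans _ _ (C * (2 * (eps / (2 * C + 1))))).
  by rewrite ler_wpM2l // mulr2n mulrDl mul1r lerD // ltW.
have -> : C * (2 * (eps / (2 * C + 1))) = eps * ((2 * C) / (2 * C + 1)).
  by field; rewrite gt_eqF.
by rewrite gtr_pMr // ltr_pdivrMr // mul1r ltrDl.
Unshelve. all: by end_near. Qed.

Lemma locally_bounded (f : R * R -> R) p : {for p, continuous f} ->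
  exists2 d : R, 0 < d & forall q, `|q.1 - p.1| < d -> `|q.2 - p.2| < d ->
    `|f q| <= `|f p| + 1.
Proof.
move=> /cvgrPdist_lt /(_ 1 ltr01) /nbhs_ballP[d /= d0 dU].
exists d => // q h1 h2.
have := dU q; rewrite /ball /= => /(_ _)/ltW; rewrite distrC => h.
have {}h : `|f q - f p| <= 1.
  by apply: h; split => /=; rewrite /ball /= distrC.
rewrite -lerBlDl (le_trans _ h) //.
exact: lerB_dist.
Qed.

Lemma basis_bound (f : R * R -> R * R -> R) p :
  (forall v, v \in [:: (1, 0); (0, 1)] -> {for p, continuous (f v)}) ->
  exists d C : R, 0 < d /\ forall q, `|q.1 - p.1| < d -> `|q.2 - p.2| < d ->
    forall v, v \in [:: (1, 0); (0, 1)] -> `|f v q| <= C.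
Proof.
move=> cf.
have c1 := cf (1, 0) ltac:(by rewrite inE eqxx).
have c2 := cf (0, 1) ltac:(by rewrite !inE eqxx orbT).
have [d1 d10 b1] := locally_bounded c1.
have [d2 d20 b2] := locally_bounded c2.
exists (Num.min d1 d2), (Num.max (`|f (1, 0) p| + 1) (`|f (0, 1) p| + 1)).
split; first by rewrite lt_min d10.
move=> q; rewrite !lt_min => /andP[h1 h2] /andP[k1 k2] v.
by rewrite !inE le_max => /orP[]/eqP ->; rewrite (b1, b2) ?orbT.
Qed.

Lemma C1_continuous u p (d : R) : 0 < d ->
  (forall q, `|q.1 - p.1| < d -> `|q.2 - p.2| < d ->
    forall v, v \in [:: (1, 0); (0, 1)] -> derivable u q v) ->
  (forall v, v \in [:: (1, 0); (0, 1)] -> {for p, continuous ('D_v u)}) ->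
  {for p, continuous u}.
Proof.
move=> d0 du cu; have [d1 [C [d10 HC]]] := basis_bound cu.
apply: (@bounded_partials_continuous _ _ (Num.min d d1) C).
  by rewrite lt_min d0.
move=> q; rewrite !lt_min => /andP[h1 h2] /andP[k1 k2] v vI.
by split; [exact: (du q h1 k1 v vI)|exact: (HC q h2 k2 v vI)].
Qed.

(** [C2_on] states continuity for second derivatives only. Bounded partial derivatives give
    continuity, so continuity descends from the second derivatives to the first ones and then to
    u. *)
Lemma C2_continuous (U : set (R * R)) u p : open U -> C2_on U u -> U p ->
  {for p, continuous u}.
Proof.
move=> oU C2u Up; have [d d0 dU] := open_box oU Up.
apply: (C1_continuous d0) => [q h1 h2 v vI|v vI].
  by have [h _ _] := C2u v v vI vI _ (dU q h1 h2); exact: h.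
apply: (C1_continuous d0) => [q h1 h2 w wI|w wI].
  by have [_ h _] := C2u v w vI wI _ (dU q h1 h2); exact: h.
by have [_ _ h] := C2u v w vI wI p Up; exact: h.
Qed.

End fourpoint.

(** * The minimum principle in the plane *)

Section plane.
Context {R : realType}.
Implicit Types (u k : R * R -> R) (p q : R * R) (B : set (R * R)).

Lemma sqr_modulus p : modulus p ^+ 2 = p.1 ^+ 2 + p.2 ^+ 2.
Proof. by rewrite sqr_sqrtr // addr_ge0 ?sqr_ge0. Qed.

Lemma modulus_ge0 p : 0 <= modulus p. Proof. exact: sqrtr_ge0. Qed.

Lemma modulus_ge1 p : `|p.1| <= modulus p.
Proof. by rewrite -sqrtr_sqr ler_wsqrtr // lerDl sqr_ge0. Qed.

Lemma modulus_ge2 p : `|p.2| <= modulus p.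
Proof. by rewrite -sqrtr_sqr ler_wsqrtr // lerDr sqr_ge0. Qed.

Lemma modulus_le p : modulus p <= `|p.1| + `|p.2|.
Proof.
rewrite -(@ler_pXn2r _ 2) ?nnegrE ?modulus_ge0 ?addr_ge0 // sqr_modulus.
rewrite sqrrD !real_normK ?num_real // addrAC lerDl.
by rewrite mulrn_wge0 // mulr_ge0.
Qed.

Lemma compact_plane (S : set (R * R)) (M : R) : closed S ->
  (forall q, S q -> modulus q <= M) -> compact S.
Proof.
move=> cS SM.
have cI : compact `[(- M), M]%classic by exact: segment_compact.
apply: (subclosed_compact cS (compact_setX cI cI)) => q /SM qM.
by split; rewrite /= in_itv /= -ler_norml (le_trans _ qM) // ?modulus_ge1 ?modulus_ge2.
Qed.

Lemma near_plane (P : set (R * R)) p : nbhs p P ->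
  exists2 d : R, 0 < d & forall q, `|q.1 - p.1| < d -> `|q.2 - p.2| < d -> P q.
Proof.
move=> /nbhs_ballP[d /= d0 dU]; exists d => // q h1 h2; apply: dU.
by split; rewrite /ball /= distrC.
Qed.

Lemma sqr_sum_continuous : continuous (fun q : R * R => q.1 ^+ 2 + q.2 ^+ 2).
Proof.
move=> q; under eq_fun do rewrite !expr2.
by apply: cvgD; apply: cvgM; (exact: cvg_fst || exact: cvg_snd).
Qed.

(** If k were negative somewhere, m = k - eta |q|^2 would have a local minimum z0 off B. There the
    four-point difference of m is nonnegative, that of eta |q|^2 is 4 eta r^2, and that of k is at
    most 2 eta r^2 for small r. *)
Lemma min_principle B k : closed B ->
  (forall p, ~ B p -> {for p, continuous k} /\ asym_harmonic k p) ->
  (forall p, B p -> forall eps : R, 0 < eps -> \forall q \near p, ~ B q -> - eps < k q) ->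
  (forall eps : R, 0 < eps -> exists M, forall q, M < modulus q -> ~ B q -> - eps < k q) ->
  forall p, ~ B p -> 0 <= k p.
Proof.
move=> cB kD kB kinf z1 Bz1; rewrite leNgt; apply/negP => kz1.
set eps := - k z1 / 2.
have eps0 : 0 < eps by rewrite divr_gt0 // oppr_gt0.
have [M HM] := kinf _ eps0.
pose S := [set q | ~ B q /\ k q <= - eps].
have oB : open (~` B) by exact: closed_openC.
have cS : closed S.
  rewrite -[S]setCK; apply: open_closedC; rewrite openE => q Sq.
  rewrite /interior; have [Bq|Bq] := pselect (B q).
    have := kB q Bq _ eps0; apply: filterS => q' h [/h].
    by rewrite ltNge => /negP.
  have kq : - eps < k q by rewrite ltNge; apply/negP => kq; apply: Sq.
  have [ck _] := kD q Bq.
  have H : \forall q' \near q, - eps < k q' by exact: cvgr_gt ck _ kq.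
  by apply: filterS H => q' h [_]; rewrite leNgt h.
have SM q : S q -> modulus q <= M.
  by move=> [Bq kq]; rewrite leNgt; apply/negP => /HM/(_ Bq); rewrite ltNge kq.
have Sc : compact S by exact: compact_plane SM.
have Sz1 : S z1 by split=> //; rewrite /eps; lra.
(* The quadratic term is thus at most eps = - k z1 / 2 wherever |q|^2 <= M^2 + 1. *)
set eta := eps / (M ^+ 2 + 1).
have M1 : 0 < M ^+ 2 + 1 by rewrite ltr_wpDl ?sqr_ge0.
have eta0 : 0 < eta by rewrite divr_gt0.
pose m q := k q - eta * (q.1 ^+ 2 + q.2 ^+ 2).
have mc : {within S, continuous m}.
  apply: continuous_in_subspaceT => q; rewrite inE => -[Bq _].
  have [ck _] := kD q Bq.
  apply: cvgB; first exact: ck.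
  apply: cvgM; first exact: cvg_cst.
  exact: sqr_sum_continuous.
have [z0 Sz0 z0min] := compact_EVT_min (ex_intro _ z1 Sz1) Sc mc.
rewrite inE in Sz0; have [Bz0 kz0] := Sz0.
have [_ kh] := kD z0 Bz0.
have [d d0 hd] := kh _ (mulr_gt0 (@ltr0Sn R 1) eta0).
have [d1 d10 hd1] := open_box oB Bz0.
have Mz0 : z0.1 ^+ 2 + z0.2 ^+ 2 <= M ^+ 2.
  rewrite -sqr_modulus ler_pXn2r ?nnegrE ?modulus_ge0 ?SM //.
  by apply: le_trans (modulus_ge0 z0) (SM _ Sz0).
(* Shifting one coordinate of z0 by at most d2 and 1 increases |z0|^2 by at most 1, which keeps it
   below M^2 + 1. *)
set d2 := 1 / (2 * (`|z0.1| + `|z0.2|) + 1).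
have d20 : 0 < d2 by rewrite divr_gt0 // ltr_wpDl // mulr_ge0 // addr_ge0.
have [r [r0 rd rd1 rd2 r1]] : exists r : R, [/\ 0 < r, r < d, r < d1, r <= d2 & r <= 1].
  exists (Num.min (Num.min (d / 2) (d1 / 2)) (Num.min d2 1)).
  rewrite !lt_min !gt_min !ge_min !divr_gt0 ?lexx ?d20 ?ltr01 ?orbT //; split=> //.
    by apply/orP; left; apply/orP; left; lra.
  by apply/orP; left; apply/orP; right; lra.
(* z0 minimises m over S only. A point q outside S has k q > - eps, hence m q > - 2 eps = k z1 >= m
   z1. *)
have near_min q : ~ B q -> q.1 ^+ 2 + q.2 ^+ 2 <= M ^+ 2 + 1 -> m z0 <= m q.
  move=> Bq qM; have [kq|kq] := leP (k q) (- eps).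
    by apply: z0min; rewrite inE.
  have : m z0 <= m z1 by apply: z0min; rewrite inE.
  move=> /le_trans; apply; rewrite /m.
  have h1 : 0 <= eta * (z1.1 ^+ 2 + z1.2 ^+ 2).
    by rewrite mulr_ge0 ?(ltW eta0) // addr_ge0 ?sqr_ge0.
  have h2 : eta * (q.1 ^+ 2 + q.2 ^+ 2) <= eps.
    by rewrite (le_trans (ler_wpM2l (ltW eta0) qM)) // /eta divfK // gt_eqF.
  have e : k z1 = - (2 * eps) by rewrite /eps; field.
  by move: h1 h2 kq; rewrite e; clear; lra.
have bnd (a b : R) : `|a| <= `|z0.1| + `|z0.2| -> (b = r \/ b = - r) ->
    (a + b) ^+ 2 <= a ^+ 2 + 1.
  move=> az br.
  have rz : r * (2 * (`|z0.1| + `|z0.2|) + 1) <= 1.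
    by rewrite -ler_pdivlMr // ltr_wpDl // mulr_ge0 // addr_ge0.
  have h : 2 * (a * b) <= 2 * (r * (`|z0.1| + `|z0.2|)).
    rewrite ler_pM2l // (le_trans (ler_norm _)) // normrM mulrC.
    have -> : `|b| = r by case: br => ->; rewrite ?normrN gtr0_norm.
    by rewrite ler_pM2l.
  have b2 : b ^+ 2 <= r.
    have -> : b ^+ 2 = r ^+ 2 by case: br => ->; rewrite ?sqrrN.
    by rewrite expr2 ler_piMl // ltW.
  by rewrite sqrrD; move: h b2 rz; rewrite -mulr_natl; clear; lra.
have n1 : `|z0.1| <= `|z0.1| + `|z0.2| by rewrite lerDl.
have n2 : `|z0.2| <= `|z0.1| + `|z0.2| by rewrite lerDr.
have e1 (b : R) : b = r \/ b = - r -> m z0 <= m (z0.1 + b, z0.2).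
  move=> br; apply: near_min; last first.
    by have := bnd _ _ n1 br; move: Mz0; rewrite /=; clear; lra.
  apply: hd1 => /=; last by rewrite subrr normr0.
  rewrite addrAC subrr add0r.
  by case: br => ->; rewrite ?normrN gtr0_norm.
have e2 (b : R) : b = r \/ b = - r -> m z0 <= m (z0.1, z0.2 + b).
  move=> br; apply: near_min; last first.
    by have := bnd _ _ n2 br; move: Mz0; rewrite /=; clear; lra.
  apply: hd1 => /=; first by rewrite subrr normr0.
  rewrite addrAC subrr add0r.
  by case: br => ->; rewrite ?normrN gtr0_norm.
have := hd r r0 rd; rewrite /four_point.
have := e1 r (or_introl erefl); have := e1 (- r) (or_intror erefl).
have := e2 r (or_introl erefl); have := e2 (- r) (or_intror erefl).
rewrite /m /= => h1 h2 h3 h4 h5.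
have := le_trans (ler_norm _) h5.
have r2 : 0 < eta * r ^+ 2 by rewrite mulr_gt0 // exprn_gt0.
move: h1 h2 h3 h4 r2; clear; rewrite !sqrrD !sqrrN; nra.
Qed.

End plane.

(** * Calculus of harmonic functions and the logarithm of the distance *)

Section harmonic.
Context {R : realType}.
Implicit Types (u : R * R -> R) (p q v w y : R * R) (U : set (R * R)).
Notation basis := [:: (1, 0); (0, 1)].

(** D and E are explicit candidates for the first and second derivatives. D v agrees with the
    derivative of u only on U, and openness of U lets the second derivatives be computed from D. *)
Lemma plane_harmonicI U u (D : R * R -> R * R -> R) (E : R * R -> R * R -> R * R -> R) :
  open U ->
  (forall v, v \in basis -> forall p, U p -> is_derive p v u (D v p)) ->
  (forall v w, v \in basis -> w \in basis -> forall p, U p ->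
     is_derive p w (D v) (E v w p)) ->
  (forall v w, v \in basis -> w \in basis -> forall p, U p ->
     {for p, continuous (E v w)}) ->
  (forall p, U p -> E (1, 0) (1, 0) p + E (0, 1) (0, 1) p = 0) ->
  plane_harmonic U u.
Proof.
move=> oU dD dE cE lE.
have I1 : ((1, 0) : R * R) \in basis by rewrite inE eqxx.
have I2 : ((0, 1) : R * R) \in basis by rewrite !inE eqxx orbT.
have nearU p : U p -> \forall q \near p, U q by move=> Up; exact: open_nbhs_nbhs.
have nD v p : v \in basis -> U p -> \forall q \near p, D v q = 'D_v u q.
  move=> vI Up; apply: filterS (nearU p Up) => q Uq.
  by have [_ h] := dD v vI q Uq; rewrite h.
have dD2 v w p : v \in basis -> w \in basis -> U p ->
    is_derive p w ('D_v u) (E v w p).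
  by move=> vI wI Up; apply: near_eq_is_derive (nD v p vI Up) (dE v w vI wI p Up).
split; last first.
  move=> p Up; rewrite /laplacian.
  have [_ ->] := dD2 _ _ p I1 I1 Up; have [_ ->] := dD2 _ _ p I2 I2 Up.
  exact: lE.
move=> v w vI wI p Up; split.
- by have [h _] := dD v vI p Up; exact: h.
- by have [h _] := dD2 v w p vI wI Up; exact: h.
have nE : \forall q \near p, E v w q = 'D_w ('D_v u) q.
  apply: filterS (nearU p Up) => q Uq.
  by have [_ h] := dD2 v w q vI wI Uq; rewrite h.
have [_ ED] := dD2 v w p vI wI Up.
have H : 'D_w ('D_v u) @ p --> E v w p.
  by apply: cvg_trans (cE v w vI wI p Up); apply: near_eq_cvg; exact: nE.
rewrite -ED in H; exact: H.
Qed.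

Lemma plane_harmonicE U u v w p : plane_harmonic U u -> v \in basis -> w \in basis ->
  U p -> [/\ is_derive p v u ('D_v u p), is_derive p w ('D_v u) ('D_w ('D_v u) p)
   & {for p, continuous ('D_w ('D_v u))}].
Proof.
move=> [C2u _] vI wI Up; have [h1 h2 h3] := C2u v w vI wI p Up.
by split; [exact: derivableP h1|exact: derivableP h2|exact: h3].
Qed.

Lemma plane_harmonicD U u1 u2 : open U ->
  plane_harmonic U u1 -> plane_harmonic U u2 -> plane_harmonic U (u1 \+ u2).
Proof.
move=> oU h1 h2; apply: (@plane_harmonicI U (u1 \+ u2) (fun v p => 'D_v u1 p + 'D_v u2 p)
  (fun v w p => 'D_w ('D_v u1) p + 'D_w ('D_v u2) p)).
- exact: oU.
- move=> v vI p Up.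
  have [a1 _ _] := plane_harmonicE h1 vI vI Up.
  have [a2 _ _] := plane_harmonicE h2 vI vI Up.
  exact: (is_deriveD a1 a2).
- move=> v w vI wI p Up.
  have [_ a1 _] := plane_harmonicE h1 vI wI Up.
  have [_ a2 _] := plane_harmonicE h2 vI wI Up.
  exact: (is_deriveD a1 a2).
- move=> v w vI wI p Up.
  have [_ _ a1] := plane_harmonicE h1 vI wI Up.
  have [_ _ a2] := plane_harmonicE h2 vI wI Up.
  exact: (cvgD a1 a2).
- move=> p Up; have [_ l1] := h1; have [_ l2] := h2.
  have := l1 p Up; have := l2 p Up; rewrite /laplacian => e2 e1.
  rewrite -[RHS](addr0 0) -[X in _ = X + _]e1 -[X in _ = _ + X]e2.
  exact: addrACA.
Qed.

Lemma plane_harmonicZ U u (c : R) : open U ->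
  plane_harmonic U u -> plane_harmonic U (fun p => c * u p).
Proof.
move=> oU h1; apply: (@plane_harmonicI _ _ (fun v => c \*: 'D_v u)
  (fun v w => c \*: 'D_w ('D_v u))).
- exact: oU.
- move=> v vI p Up; have [a1 _ _] := plane_harmonicE h1 vI vI Up.
  exact: (is_deriveZ c a1).
- move=> v w vI wI p Up; have [_ a1 _] := plane_harmonicE h1 vI wI Up.
  exact: (is_deriveZ c a1).
- move=> v w vI wI p Up; have [_ _ a1] := plane_harmonicE h1 vI wI Up.
  exact: (cvgZl_tmp a1).
- move=> p Up; have [_ l1] := h1; have := l1 p Up; rewrite /laplacian => e1.
  rewrite -[RHS](mulr0 c) -[X in _ = _ * X]e1; exact/esym/mulrDr.
Qed.

Lemma plane_harmonic_cst U (c : R) : open U -> plane_harmonic U (cst c).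
Proof.
move=> oU; apply: (@plane_harmonicI _ _ (fun v => cst 0) (fun v w => cst 0)) => //.
- by move=> *; exact: cvg_cst.
- by move=> p _; exact: addr0.
Qed.

Lemma plane_harmonicS U V u : V `<=` U -> plane_harmonic U u -> plane_harmonic V u.
Proof.
move=> VU [c l]; split=> [v w vI wI p /VU Up|p /VU]; last exact: l.
exact: (c v w vI wI p Up).
Qed.

Lemma eq_plane_harmonic U u1 u2 : open U -> (forall p, U p -> u1 p = u2 p) ->
  plane_harmonic U u1 -> plane_harmonic U u2.
Proof.
move=> oU e h1; apply: (@plane_harmonicI _ _ (fun v => 'D_v u1)
  (fun v w => 'D_w ('D_v u1))).
- exact: oU.
- move=> v vI p Up; have [a1 _ _] := plane_harmonicE h1 vI vI Up.
  apply: near_eq_is_derive a1; have : \forall q \near p, U q by exact: open_nbhs_nbhs.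
  by apply: filterS => q /e.
- by move=> v w vI wI p Up; have [_ a1 _] := plane_harmonicE h1 vI wI Up; exact: a1.
- by move=> v w vI wI p Up; have [_ _ a1] := plane_harmonicE h1 vI wI Up; exact: a1.
- by have [_ l1] := h1; exact: l1.
Qed.

Lemma is_derive_line u p v (l : R) :
  is_derive (0 : R) (1 : R) (fun h : R => u (p + h *: v)) l -> is_derive p v u l.
Proof.
have E : (fun h : R => u (p + h *: v)) = (fun h : R => u (h *: v + p)).
  by apply/funext => h; rewrite addrC.
rewrite E => -[d1 d2]; apply: DeriveDef; first by apply/derivable1P.
rewrite -d2 /derive; set g1 := fun h => h^-1 *: _; set g2 := fun h => h^-1 *: _.
suff -> : g1 = g2 by [].
by rewrite funeqE /g1 /g2 => h /=; rewrite addr0 scale0r add0r [_%:A]mulr1.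
Qed.

Lemma open_punctured y : open (~` [set y] : set (R * R)).
Proof. by apply: closed_openC; exact: (accessible_closed_set1 (hausdorff_accessible (@norm_hausdorff _ _))). Qed.

Definition lnd y p : R := ln (modulus (p - y)).

Lemma sqdist_gt0 p y : p != y -> 0 < (p.1 - y.1) ^+ 2 + (p.2 - y.2) ^+ 2.
Proof.
case: p y => [a b] [c d] /=; rewrite xpair_eqE negb_and => ne.
rewrite lt_neqAle addr_ge0 ?sqr_ge0 // andbT eq_sym paddr_eq0 ?sqr_ge0 //.
by rewrite !sqrf_eq0 !subr_eq0 negb_and.
Qed.

Lemma lndE y p : p != y -> lnd y p = ln ((p.1 - y.1) ^+ 2 + (p.2 - y.2) ^+ 2) / 2.
Proof.
move=> /sqdist_gt0 h; rewrite /lnd /modulus /=.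
set N := _ + _ in h *; rewrite -{2}(sqr_sqrtr (ltW h)) lnXn ?sqrtr_gt0 //.
by rewrite mulr2n -mulr_natl; field.
Qed.

Lemma plane_harmonic_lnd y : plane_harmonic (~` [set y]) (lnd y).
Proof.
pose N p : R := (p.1 - y.1) ^+ 2 + (p.2 - y.2) ^+ 2.
pose A v p : R := (p.1 - y.1) * v.1 + (p.2 - y.2) * v.2.
have N0 p : p != y -> N p != 0 by move=> /sqdist_gt0 /lt0r_neq0.
have yE p : (~` [set y]) p -> p != y by move=> /= h; apply/eqP.
have dN p v : is_derive (0 : R) (1 : R) (fun h : R => N (p + h *: v)) (2 * A v p).
  have -> : (fun h : R => N (p + h *: v)) =
     (fun h : R => N p + (2 * A v p) * h + (v.1 ^+ 2 + v.2 ^+ 2) * h ^+ 2).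
    by apply/funext => h; rewrite /N /A /= /GRing.scale /=; ring.
  apply: is_derive_eq; rewrite /GRing.scale /=; ring.
have dA p v w : is_derive (0 : R) (1 : R) (fun h : R => A v (p + h *: w))
    (w.1 * v.1 + w.2 * v.2).
  have -> : (fun h : R => A v (p + h *: w)) =
     (fun h : R => A v p + (w.1 * v.1 + w.2 * v.2) * h).
    by apply/funext => h; rewrite /A /= /GRing.scale /=; ring.
  apply: is_derive_eq; rewrite /GRing.scale /=; ring.
have line0 p v : p + (0 : R) *: v = p by rewrite scale0r addr0.
have c1 : continuous (fun p : R * R => p.1 - y.1).
  by move=> p; apply: cvgB; [exact: cvg_fst|exact: cvg_cst].
have c2 : continuous (fun p : R * R => p.2 - y.2).
  by move=> p; apply: cvgB; [exact: cvg_snd|exact: cvg_cst].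
have cN : continuous N.
  move=> p; rewrite /N; under eq_fun do rewrite !expr2.
  by apply: cvgD; [exact: (cvgM (c1 p) (c1 p))|exact: (cvgM (c2 p) (c2 p))].
have cA v : continuous (A v).
  move=> p; rewrite /A; apply: cvgD.
    by apply: cvgM; [exact: c1|exact: cvg_cst].
  by apply: cvgM; [exact: c2|exact: cvg_cst].
(* With N = |p - y|^2 and A v = <p - y, v>, the logarithm of |p - y| has the gradient A v / N and
   the Hessian <v, w> / N - 2 A v A w / N^2. *)
apply: (@plane_harmonicI _ (lnd y) (fun v p => A v p / N p)
  (fun v w p => (w.1 * v.1 + w.2 * v.2) / N p - 2 * A v p * A w p / N p ^+ 2)).
- exact: open_punctured.
- move=> v _ p /yE py; apply: (@near_eq_is_derive _ _ _ (fun p => ln (N p) / 2)).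
    have : \forall q \near p, (~` [set y]) q.
      by apply: open_nbhs_nbhs; split; [exact: open_punctured|exact/eqP].
    by apply: filterS => q /yE qy; rewrite lndE.
  apply: is_derive_line.
  have Np : 0 < N (p + (0 : R) *: v) by rewrite line0 sqdist_gt0.
  have dl := @is_derive1_comp _ (@ln R) (fun h : R => N (p + h *: v)) _ _ _ (is_derive1_ln Np) (dN p v).
  have := is_deriveZ (2^-1 : R) dl.
  have -> : (2^-1 : R) \*: (@ln R \o (fun h : R => N (p + h *: v))) =
     (fun h : R => ln (N (p + h *: v)) / 2).
    by apply/funext => h; rewrite /= mulrC.
  move=> h; apply: (is_derive_eq h); rewrite line0 /GRing.scale /=.
  by field; exact: N0.
- move=> v w _ _ p /yE py; apply: is_derive_line.
  have Np : N (p + (0 : R) *: w) != 0 by rewrite line0 N0.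
  have dV := @is_deriveV _ (fun h : R => N (p + h *: w)) _ _ _ Np (dN p w).
  have dM := is_deriveM (dA p v w) dV.
  apply: (is_derive_eq dM); rewrite line0 /GRing.scale /=.
  by field; exact: N0.
- move=> v w _ _ p /yE py.
  have cV : (N q)^-1 @[q --> p] --> (N p)^-1 by apply: cvgV; [exact: N0|exact: cN].
  apply: cvgB; first by apply: cvgM => //; exact: cvg_cst.
  under eq_fun do rewrite expr2 invfM.
  rewrite expr2 invfM; apply: cvgM; last exact: cvgM.
  apply: cvgM; last exact: cA.
  by apply: cvgM; [exact: cvg_cst|exact: cA].
- move=> p /yE py; rewrite /A /=.
  have -> : (1 * 1 + 0 * 0) / N p - 2 * ((p.1 - y.1) * 1 + (p.2 - y.2) * 0) *
     ((p.1 - y.1) * 1 + (p.2 - y.2) * 0) / N p ^+ 2 +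
     ((0 * 0 + 1 * 1) / N p - 2 * ((p.1 - y.1) * 0 + (p.2 - y.2) * 1) *
     ((p.1 - y.1) * 0 + (p.2 - y.2) * 1) / N p ^+ 2) =
     2 * (N p / N p ^+ 2) - 2 * ((p.1 - y.1) ^+ 2 + (p.2 - y.2) ^+ 2) / N p ^+ 2.
    by field; exact: N0.
  by rewrite /N; ring.
Qed.

End harmonic.

(** * Neighbourhoods of infinity and the chart 1 / z *)

Section sphere_topology.
Context {R : realType}.
Implicit Types (p q : R * R) (z : sphere R).

Lemma bounded_modulus (K : set (R * R)) : compact K ->
  exists M, forall q, K q -> modulus q <= M.
Proof.
move=> /compact_bounded[M [_ KM]]; exists ((M + 1) + (M + 1)) => q Kq.
have qM : `|q| <= M + 1 by apply: KM => //; rewrite ltrDl.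
rewrite (le_trans (modulus_le q)) // lerD // (le_trans _ qM) //.
  by rewrite /Num.norm /= le_max lexx.
by rewrite /Num.norm /= le_max lexx orbT.
Qed.

Lemma near_inftyP (P : set (sphere R)) : nbhs (infty_pt : sphere R) P ->
  exists M, forall q, M < modulus q -> P (finite_pt q).
Proof.
move=> [K [cK _] KP]; have [M KM] := bounded_modulus cK.
exists M => q Mq; apply: KP; left; exists q => // /KM.
by rewrite leNgt Mq.
Qed.

Lemma modulus_continuous : continuous (@modulus R).
Proof.
move=> q; apply: (@continuous_comp _ _ _ (fun q : R * R => q.1 ^+ 2 + q.2 ^+ 2) Num.sqrt).
  exact: sqr_sum_continuous.
exact: sqrt_continuous.
Qed.

Lemma infty_near (P : set (sphere R)) M : P infty_pt ->
  (forall q, M < modulus q -> P (finite_pt q)) -> nbhs (infty_pt : sphere R) P.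
Proof.
move=> P0 PM; exists [set q | modulus q <= M].
  have cM : closed [set q : R * R | modulus q <= M].
    have := @preimage_closed _ _ (@modulus R) [set x : R | x <= M].
    by apply; [move=> q _; exact: modulus_continuous|exact: closed_le].
  split; last exact: cM.
  by apply: (compact_plane (M := M) cM).
move=> z [[q /= qM <-]|->//]; apply: PM; rewrite ltNge; exact/negP.
Qed.

Lemma continuous_infty (f : sphere R -> R) : {for infty_pt, continuous f} ->
  forall eps : R, 0 < eps -> exists M, forall q, M < modulus q ->
    `|f (finite_pt q) - f infty_pt| < eps.
Proof.
move=> cf eps eps0; apply: (@near_inftyP [set z | `|f z - f infty_pt| < eps]).
have h : \forall z \near (infty_pt : sphere R), `|f infty_pt - f z| < eps.
  exact: cvgr_dist_lt cf _ eps0.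
by apply: filterS h => z /=; rewrite distrC.
Qed.

Lemma chart_inftyE p : p != (0, 0) ->
  chart_infty p = finite_pt (p.1 / (modulus p) ^+ 2, - p.2 / (modulus p) ^+ 2).
Proof. by rewrite /chart_infty => /negbTE ->. Qed.

Lemma modulus_gt0 p : p != (0, 0) -> 0 < modulus p.
Proof.
move=> p0; have := sqdist_gt0 p0; rewrite !subr0 -sqr_modulus.
by rewrite exprn_even_gt0 //= => m0; rewrite lt_neqAle eq_sym m0 modulus_ge0.
Qed.

Definition inv_pt p : R * R := (p.1 / (modulus p) ^+ 2, - p.2 / (modulus p) ^+ 2).

Lemma modulus_inv p : p != (0, 0) -> modulus (inv_pt p) = (modulus p)^-1.
Proof.
move=> p0; have m0 := modulus_gt0 p0.
apply/eqP; rewrite -(@eqrXn2 _ 2) ?modulus_ge0 ?invr_ge0 ?modulus_ge0 //.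
apply/eqP; rewrite sqr_modulus /inv_pt /= exprVn.
rewrite !expr_div_n sqrrN -mulrDl -sqr_modulus.
by field; rewrite gt_eqF.
Qed.

Lemma inv_pt_neq0 p : p != (0, 0) -> inv_pt p != (0, 0).
Proof.
move=> p0; apply/eqP => e; have := modulus_inv p0.
rewrite e /modulus /= expr0n addr0 sqrtr0 => /esym/eqP.
by rewrite invr_eq0 gt_eqF // modulus_gt0.
Qed.

Lemma inv_ptK p : p != (0, 0) -> inv_pt (inv_pt p) = p.
Proof.
move=> p0; have m0 := modulus_gt0 p0.
rewrite {1}/inv_pt modulus_inv // exprVn invrK /inv_pt /=.
by case: p p0 m0 => a b p0 m0; congr (_, _) => /=; field; rewrite gt_eqF.
Qed.

Lemma chart_infty_continuous : continuous (@chart_infty R).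
Proof.
move=> p; have [->|p0] := eqVneq p (0, 0).
  move=> P; rewrite {1}/chart_infty eqxx => NP.
  have [M MP] := near_inftyP NP.
  have M1 : 0 < `|M| + 1 by rewrite ltr_wpDl.
  have : \forall q \near ((0, 0) : R * R), modulus q < (`|M| + 1)^-1.
    have := @modulus_continuous (0, 0).
    rewrite /continuous_at {2}/modulus /= expr0n addr0 sqrtr0 => h.
    by apply: cvgr_lt h _ _; rewrite invr_gt0.
  apply: filterS => q qM; have [->|q0] := eqVneq q (0, 0).
    by rewrite /= /chart_infty eqxx; exact: (nbhs_singleton NP).
  rewrite /= chart_inftyE //; apply: MP; rewrite modulus_inv //.
  have m0 := modulus_gt0 q0.
  rewrite (@lt_le_trans _ _ (`|M| + 1)) //.
    by rewrite (le_lt_trans (ler_norm _)) // ltrDl.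
  by rewrite -[leLHS]invrK lef_pV2 ?posrE ?invr_gt0 // ltW.
have nE : \forall q \near p, finite_pt (inv_pt q) = chart_infty q.
  have : \forall q \near p, (~` [set (0, 0)] : set (R * R)) q.
    by apply: open_nbhs_nbhs; split; [exact: open_punctured|exact/eqP].
  by apply: filterS => q /eqP q0; rewrite chart_inftyE.
have cp : {for p, continuous (fun q => finite_pt (inv_pt q))}.
  apply: (@continuous_comp _ _ _ inv_pt (@finite_pt R)); last first.
    exact: one_point_compactification_some_continuous.
  have m0 : modulus p ^+ 2 != 0 by rewrite expf_neq0 // gt_eqF // modulus_gt0.
  have cV : (modulus q ^+ 2)^-1 @[q --> p] --> (modulus p ^+ 2)^-1.
    apply: cvgV => //; under eq_fun do rewrite sqr_modulus.
    by rewrite sqr_modulus; exact: sqr_sum_continuous.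
  have c1 : q.1 / modulus q ^+ 2 @[q --> p] --> p.1 / modulus p ^+ 2.
    by apply: cvgM cV; exact: cvg_fst.
  have c2 : - q.2 / modulus q ^+ 2 @[q --> p] --> - p.2 / modulus p ^+ 2.
    by apply: cvgM cV; apply: cvgN; exact: cvg_snd.
  exact: cvg_pair c1 c2.
rewrite /continuous_at -(nbhs_singleton nE).
exact: cvg_trans (near_eq_cvg nE) cp.
Qed.

End sphere_topology.

Section cdomain.
Context {R : realType} (e : set R).
Hypothesis e_compact : compact e.
Implicit Types (p q : R * R) (z : sphere R).

Definition slit : set (R * R) := [set p | exists2 t, e t & p = (t, 0)].

Lemma cdomain_finite p : cdomain e (finite_pt p) <-> ~ slit p.
Proof.
split=> [h [t et pE]|h [t et [pE]]]; last by apply: h; exists t.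
by apply: h; exists t => //; rewrite pE.
Qed.

Lemma cdomain_infty : cdomain e infty_pt.
Proof. by move=> [t et]. Qed.

Lemma compact_slit : compact slit.
Proof.
have -> : slit = (fun t : R => (t, 0 : R)) @` e.
  by apply/seteqP; split => [p [t et ->]|p [t et <-]]; exists t.
apply: continuous_compact => //; apply: continuous_subspaceT => t.
exact: cvg_pair (@cvg_id _ (nbhs t)) (cvg_cst (0 : R)).
Qed.

Lemma closed_slit : closed slit.
Proof. by apply: compact_closed compact_slit; exact: norm_hausdorff. Qed.

Lemma bounded_slit : exists M, forall t, e t -> `|t| <= M.
Proof.
have [M HM] := bounded_modulus compact_slit; exists M => t et.
by apply: le_trans (HM (t, 0) _); [exact: (modulus_ge1 (t, 0))|exists t].
Qed.

Lemma open_cdomain : open (cdomain e).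
Proof.
rewrite openE => -[p pD|_].
  have oS : open (~` slit) by apply: closed_openC; exact: closed_slit.
  have : \forall q \near p, (~` slit) q by apply: open_nbhs_nbhs; split=> //; exact/cdomain_finite.
  by move=> h; apply: filterS h => q /cdomain_finite.
have [M HM] := bounded_modulus compact_slit.
apply: (infty_near (M := M)) => [|q Mq]; first exact: cdomain_infty.
by apply/cdomain_finite => /HM; rewrite leNgt Mq.
Qed.

Lemma slit_dist p : ~ slit p -> exists2 d : R, 0 < d &
  forall t, e t -> d <= modulus (p - (t, 0)).
Proof.
move=> Sp; have oS : open (~` slit) by apply: closed_openC; exact: closed_slit.
have [d d0 hd] := open_box oS Sp; exists d => // t et.
rewrite leNgt; apply/negP => h; apply: (hd (t, 0)); last by exists t.
  by rewrite distrC; apply: le_lt_trans h; exact: (modulus_ge1 (p - (t, 0))).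
by rewrite distrC; apply: le_lt_trans h; exact: (modulus_ge2 (p - (t, 0))).
Qed.

End cdomain.

(** * Estimates for logarithms of distances *)

Section logdist.
Context {R : realType}.
Implicit Types (p q y z : R * R) (u : R * R -> R).

Lemma modulusD p q : modulus (p + q) <= modulus p + modulus q.
Proof.
rewrite -(@ler_pXn2r _ 2) ?nnegrE ?modulus_ge0 ?addr_ge0 ?modulus_ge0 //.
rewrite sqrrD !sqr_modulus /=.
have h : p.1 * q.1 + p.2 * q.2 <= modulus p * modulus q.
  rewrite (le_trans (ler_norm _)) // -(@ler_pXn2r _ 2) ?nnegrE ?mulr_ge0 ?modulus_ge0 //.
  rewrite real_normK ?num_real // exprMn !sqr_modulus -subr_ge0.
  have -> : (p.1 ^+ 2 + p.2 ^+ 2) * (q.1 ^+ 2 + q.2 ^+ 2) -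
    (p.1 * q.1 + p.2 * q.2) ^+ 2 = (p.1 * q.2 - p.2 * q.1) ^+ 2 by ring.
  exact: sqr_ge0.
rewrite -mulr_natl; move: h; set m := modulus p * modulus q; clear; lra.
Qed.

Lemma modulusN p : modulus (- p) = modulus p.
Proof. by rewrite /modulus /= !sqrrN. Qed.

Lemma modulus_dist p q : `|modulus p - modulus q| <= modulus (p - q).
Proof.
rewrite ler_norml; apply/andP; split.
  rewrite lerNl opprB lerBlDr -[X in X <= _](congr1 modulus (subrK p q)).
  by rewrite -[modulus (p - q)]modulusN opprB modulusD.
by rewrite lerBlDr -[X in X <= _](congr1 modulus (subrK q p)) modulusD.
Qed.

Lemma modulus_sub_gt0 p q : p != q -> 0 < modulus (p - q).
Proof. by rewrite -subr_eq0 => pq; exact: modulus_gt0. Qed.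

Lemma modulusBC p q : modulus (p - q) = modulus (q - p).
Proof. by rewrite -modulusN opprB. Qed.

Lemma lndC p q : lnd p q = lnd q p.
Proof. by rewrite /lnd modulusBC. Qed.

Lemma ln_dist (a b m : R) : 0 < m -> m <= a -> m <= b -> `|ln a - ln b| <= `|a - b| / m.
Proof.
move=> m0.
have H (x y : R) : m <= x -> m <= y -> ln x - ln y <= `|x - y| / m.
  move=> mx my; have x0 := lt_le_trans m0 mx; have y0 := lt_le_trans m0 my.
  rewrite -ln_div ?posrE //.
  have -> : x / y = 1 + (x / y - 1) by ring.
  apply: (le_trans (le_ln1Dx _)); first by rewrite ltrBDr addrC subrr divr_gt0.
  have -> : x / y - 1 = (x - y) / y by field; rewrite gt_eqF.
  rewrite (@le_trans _ _ (`|x - y| / y)) //.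
    by rewrite ler_wpM2r ?invr_ge0 ?(ltW y0) // ler_norm.
  by rewrite ler_wpM2l // lef_pV2 ?posrE.
move=> ma mb; rewrite ler_norml H // andbT lerNl opprB distrC; exact: H.
Qed.

Lemma lnd_dist y z p (d : R) : 0 < d -> d <= modulus (p - y) -> d <= modulus (p - z) ->
  `|lnd y p - lnd z p| <= modulus (y - z) / d.
Proof.
move=> d0 h1 h2; apply: (le_trans (ln_dist d0 h1 h2)).
rewrite ler_wpM2r ?invr_ge0 ?(ltW d0) // (le_trans (modulus_dist _ _)) //.
by rewrite opprB [p - y + _]addrC addrA subrK modulusBC.
Qed.

Lemma lnd_infty (C eps : R) : 0 < eps -> exists2 M, 0 < M &
  forall p q, M < modulus p -> modulus q <= C -> `|lnd q p - ln (modulus p)| <= eps.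
Proof.
move=> eps0; exists (`|C| / eps + `|C| + 1).
  by rewrite ltr_wpDl // addr_ge0 // divr_ge0 // ltW.
move=> p q pM qC.
have qC' : modulus q <= `|C| by rewrite (le_trans qC) // ler_norm.
set m := `|C| / eps + 1.
have m0 : 0 < m by rewrite ltr_wpDl // divr_ge0 // ltW.
have h1 : m <= modulus p.
  by rewrite ltW // (le_lt_trans _ pM) // /m lerD2r lerDl.
have h2 : m <= modulus (p - q).
  have E : p - (p - q) = q by rewrite opprB addrCA subrr addr0.
  have := modulus_dist p (p - q); rewrite E => h.
  have := le_trans (ler_norm _) h; move: pM qC'; rewrite /m; clear; lra.
apply: (le_trans (ln_dist m0 h2 h1)).
rewrite ler_pdivrMr // (le_trans (modulus_dist _ _)) //.
rewrite addrAC subrr add0r modulusN (le_trans qC') //.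
by rewrite /m mulrDr mulr1 mulrC divfK ?gt_eqF // lerDl ltW.
Qed.

(** The point p is left out: a sum such as [gp (finite_pt y) \+ lnd y] has cancelling poles at y but
    a meaningless value there. *)
Definition bd_at u p := exists M, \forall q \near p, q != p -> `|u q| <= M.
Definition bd_inf u := exists M K, forall q, K < modulus q -> `|u q| <= M.

Lemma bd_atD u v p : bd_at u p -> bd_at v p -> bd_at (u \+ v) p.
Proof.
move=> [M HM] [N HN]; exists (M + N); apply: filterS2 HM HN => q h1 h2 qp.
by rewrite (le_trans (ler_normD _ _)) // lerD ?h1 ?h2.
Qed.

Lemma bd_atZ u p (c : R) : bd_at u p -> bd_at (fun q => c * u q) p.
Proof.
move=> [M HM]; exists (`|c| * M); apply: filterS HM => q h qp.
by rewrite normrM ler_wpM2l // h.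
Qed.

Lemma bd_at_continuous u p : {for p, continuous u} -> bd_at u p.
Proof.
move=> /locally_bounded[d d0 h]; exists (`|u p| + 1).
apply/nbhs_ballP; exists d => //= q [h1 h2] _.
by apply: h; rewrite distrC.
Qed.

Lemma bd_infD u v : bd_inf u -> bd_inf v -> bd_inf (u \+ v).
Proof.
move=> [M [K HM]] [N [L HN]]; exists (M + N), (Num.max K L) => q.
rewrite gt_max => /andP[h1 h2].
by rewrite (le_trans (ler_normD _ _)) // lerD ?HM ?HN.
Qed.

Lemma bd_infZ u (c : R) : bd_inf u -> bd_inf (fun q => c * u q).
Proof.
move=> [M [K HM]]; exists (`|c| * M), K => q h.
by rewrite normrM ler_wpM2l // HM.
Qed.

Lemma asymD u v p : asym_harmonic u p -> asym_harmonic v p -> asym_harmonic (u \+ v) p.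
Proof.
move=> hu hv eps eps0; have e2 : 0 < eps / 2 by rewrite divr_gt0.
have [d d0 h1] := hu _ e2; have [d' d'0 h2] := hv _ e2.
exists (Num.min d d'); first by rewrite lt_min d0.
move=> r r0; rewrite lt_min => /andP[rd rd'].
have -> : four_point (u \+ v) p r = four_point u p r + four_point v p r.
  by rewrite /four_point /=; ring.
rewrite (le_trans (ler_normD _ _)) // (le_trans (lerD (h1 r r0 rd) (h2 r r0 rd'))) //.
by rewrite le_eqVlt; apply/orP; left; apply/eqP; field.
Qed.

Lemma asymZ u p (c : R) : asym_harmonic u p -> asym_harmonic (fun q => c * u q) p.
Proof.
move=> hu eps eps0; have c1 : 0 < `|c| + 1 by rewrite ltr_wpDl.
have e2 : 0 < eps / (`|c| + 1) by rewrite divr_gt0.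
have [d d0 h1] := hu _ e2; exists d => // r r0 rd.
have -> : four_point (fun q => c * u q) p r = c * four_point u p r.
  by rewrite /four_point /=; ring.
rewrite normrM (le_trans (ler_wpM2l (normr_ge0 c) (h1 r r0 rd))) //.
have -> : `|c| * (eps / (`|c| + 1) * r ^+ 2) = (`|c| / (`|c| + 1)) * (eps * r ^+ 2) by ring.
rewrite ler_piMl //; first by rewrite mulr_ge0 ?sqr_ge0 // ltW.
by rewrite ler_pdivrMr // mul1r lerDl.
Qed.

Lemma asym_cst (c : R) p : asym_harmonic (cst c) p.
Proof.
move=> eps eps0; exists 1 => // r r0 _.
have -> : four_point (cst c) p r = 0 by rewrite /four_point /cst; ring.
by rewrite normr0 mulr_ge0 ?sqr_ge0 // ltW.
Qed.

Lemma continuous_lnd y p : p != y -> {for p, continuous (lnd y)}.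
Proof.
move=> /eqP py; have [h _] := plane_harmonic_lnd y.
exact: (C2_continuous (@open_punctured R y) h py).
Qed.

Lemma asym_lnd y p : p != y -> asym_harmonic (lnd y) p.
Proof.
move=> /eqP py.
exact: (harmonic_asym (@open_punctured R y) (plane_harmonic_lnd y) py).
Qed.

Lemma near_neq p q : p != q -> \forall z \near p, z != q.
Proof.
move=> pq; have : \forall z \near p, (~` [set q] : set (R * R)) z.
  by apply: open_nbhs_nbhs; split; [exact: open_punctured|exact/eqP].
by apply: filterS => z /eqP.
Qed.

Lemma lnd_small y (C : R) : \forall p \near y, p != y -> lnd y p < C.
Proof.
have h := @modulus_continuous R 0.
have cy : {for y, continuous (fun p => modulus (p - y))}.
  apply: (@continuous_comp _ _ _ (fun p => p - y) modulus).
    by apply: cvgB; [exact: cvg_id|exact: cvg_cst].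
  exact: modulus_continuous.
have : \forall p \near y, modulus (p - y) < expR C.
  apply: cvgr_lt cy _ _; rewrite subrr /modulus /= expr0n addr0 sqrtr0.
  exact: expR_gt0.
apply: filterS => p pC py.
by rewrite -[C]expRK /lnd ltr_ln ?posrE ?modulus_sub_gt0 ?expR_gt0.
Qed.

End logdist.

(** * The Green function *)

Section green.
Context {R : realType} (e : set R) (g : sphere R -> sphere R -> R).
Hypotheses (e_compact : compact e) (e_regular : regular e) (g_green : is_green e g).
Implicit Types (p q y z : R * R) (a : sphere R).
Local Notation slit := (slit e).

Definition gp a p := g (finite_pt p) a.

Lemma open_setD1 (V : set (sphere R)) a : open V -> open (V `\ a).
Proof.
move=> oV; have -> : V `\ a = V `&` ~` [set a] by [].
apply: openI => //; apply: closed_openC.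
case: a => [p|].
  rewrite -[[set _]]setCK; apply: open_closedC; rewrite openE => -[q qp|_].
    have pq : q <> p by move=> pq; apply: qp; rewrite pq.
    have : \forall z \near q, z != p by apply: near_neq; exact/eqP.
    by move=> h; apply: filterS h => z /eqP zp [].
  apply: (infty_near (M := modulus p)) => // q Mq [qp].
  by move: Mq; rewrite qp ltxx.
rewrite -[[set _]]setCK; apply: open_closedC; rewrite openE => -[q _|h]; last by case: h.
by apply: filterS (@filterT _ (nbhs q) _) => z _.
Qed.

Lemma open_finite (V : set (sphere R)) : open V -> open (@finite_pt R @^-1` V).
Proof.
move=> oV; apply: open_comp oV => p _.
exact: one_point_compactification_some_continuous.
Qed.

Lemma open_chart (V : set (sphere R)) : open V -> open (@chart_infty R @^-1` V).
Proof. by move=> oV; apply: open_comp oV => p _; exact: chart_infty_continuous. Qed.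

Lemma gp_harmonic a : cdomain e a ->
  plane_harmonic (@finite_pt R @^-1` (cdomain e `\ a)) (gp a).
Proof. by move=> /g_green[[h _] _ _ _]. Qed.

Let oD a : open (@finite_pt R @^-1` (cdomain e `\ a)).
Proof. by apply/open_finite/open_setD1/open_cdomain. Qed.

Let inD a p : ~ slit p -> finite_pt p <> a ->
  (@finite_pt R @^-1` (cdomain e `\ a)) p.
Proof. by move=> sp pz; split => //; exact/cdomain_finite. Qed.

Lemma gp_continuous a p : cdomain e a -> ~ slit p -> finite_pt p <> a ->
  {for p, continuous (gp a)}.
Proof.
move=> aD sp pz; have [h _] := gp_harmonic aD.
exact: (C2_continuous (@oD a) h (inD sp pz)).
Qed.

Lemma gp_asym a p : cdomain e a -> ~ slit p -> finite_pt p <> a ->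
  asym_harmonic (gp a) p.
Proof.
move=> aD sp pz.
exact: (harmonic_asym (@oD a) (gp_harmonic aD) (inD sp pz)).
Qed.

Lemma near_within (t : R) (P : set (sphere R)) :
  (\forall z \near within (cdomain e) (nbhs (real_pt t)), P z) ->
  \forall q \near ((t, 0) : R * R), ~ slit q -> P (finite_pt q).
Proof.
move=> h.
have h' : \forall q \near ((t, 0) : R * R), cdomain e (finite_pt q) -> P (finite_pt q).
  exact: h.
by apply: filterS h' => q hq sq; apply: hq; exact/cdomain_finite.
Qed.

Lemma gp_slit a t : cdomain e a -> e t -> forall eps : R, 0 < eps ->
  \forall q \near ((t, 0) : R * R), ~ slit q -> `|gp a q| < eps.
Proof.
move=> /g_green[_ _ _ h] et eps eps0.
have H : \forall z \near within (cdomain e) (nbhs (real_pt t)), `|0 - g z a| < eps.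
  exact: cvgr_dist_lt (h t et (e_regular et)) _ eps0.
by apply: filterS (near_within H) => q hq sq; rewrite -normrN -sub0r; exact: hq.
Qed.

Lemma gp_pole y : ~ slit y -> bd_at (gp (finite_pt y) \+ lnd y) y.
Proof.
move=> sy; have [_ _ [M HM] _] := g_green (iffRL (cdomain_finite e y) sy).
have HM' : \forall q \near y, finite_pt q != finite_pt y ->
    `|g (finite_pt q) (finite_pt y) - log_pole (finite_pt y) (finite_pt q)| <= M.
  exact: HM.
exists M; apply: filterS HM' => q h qy.
have := h (contra_neq _ qy); rewrite /log_pole opprK; apply.
by case.
Qed.

Lemma gp_pole_infty : bd_inf (fun p => gp infty_pt p - ln (modulus p)).
Proof.
have [_ _ [M HM] _] := g_green (@cdomain_infty R e).
have [K HK] := @near_inftyP _ (fun z : sphere R => z != infty_pt -> `|g z infty_pt - log_pole infty_pt z| <= M) HM.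
by exists M, K => q /HK; apply.
Qed.

(** Harmonicity at infinity is read in the chart 1 / z, so continuity there is continuity at the
    origin of the chart. *)
Lemma g_infty_continuous y : ~ slit y -> forall eps : R, 0 < eps ->
  exists M, forall q, M < modulus q ->
    `|gp (finite_pt y) q - g infty_pt (finite_pt y)| < eps.
Proof.
move=> sy eps eps0; have yD := iffRL (cdomain_finite e y) sy.
have [[_ [C2 _]] _ _ _] := g_green yD.
have o : open (@chart_infty R @^-1` (cdomain e `\ finite_pt y)).
  by apply/open_chart/open_setD1/open_cdomain.
have D0 : (@chart_infty R @^-1` (cdomain e `\ finite_pt y)) (0, 0).
  rewrite /= /chart_infty eqxx; split=> //; exact: cdomain_infty.
have c := C2_continuous o C2 D0.
pose f := g^~ (finite_pt y) \o chart_infty.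
have H : \forall q \near ((0, 0) : R * R), `|f (0, 0) - f q| < eps.
  exact: cvgr_dist_lt c _ eps0.
have [d d0 hd] := near_plane H.
exists (`|d|^-1) => q Mq.
have m0 : 0 < modulus q by apply: le_lt_trans Mq; rewrite invr_ge0.
have q0 : q != (0, 0).
  by apply: contraTneq m0 => ->; rewrite /modulus /= expr0n addr0 sqrtr0 ltxx.
have mi : modulus (inv_pt q) < d.
  rewrite modulus_inv // -[ltRHS]invrK ltf_pV2 ?posrE ?invr_gt0 //.
  by rewrite -[d]gtr0_norm.
have := hd (inv_pt q); rewrite /f /= !subr0 /chart_infty eqxx.
rewrite (negbTE (inv_pt_neq0 q0)) -/(inv_pt (inv_pt q)) inv_ptK // distrC; apply.
  exact: le_lt_trans (modulus_ge1 _) mi.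
exact: le_lt_trans (modulus_ge2 _) mi.
Qed.

Lemma gp_bd_inf y : ~ slit y -> bd_inf (gp (finite_pt y)).
Proof.
move=> /g_infty_continuous/(_ 1 ltr01)[M HM].
exists (`|g infty_pt (finite_pt y)| + 1), M => q /HM h.
rewrite -lerBlDl (le_trans _ (ltW h)) //; exact: lerB_dist.
Qed.

End green.

(** * The minimum principle off the slit and the extension of log distances *)

Section comparison.
Context {R : realType} (e : set R) (g : sphere R -> sphere R -> R).
Hypotheses (e_compact : compact e) (e_regular : regular e) (g_green : is_green e g).
Implicit Types (p q y z : R * R) (u k : R * R -> R).
Local Notation slit := (slit e).
Local Notation gp := (gp g).

Lemma pole_pos u y (eps : R) : 0 < eps -> bd_at u y ->
  \forall q \near y, q != y -> 0 < u q - eps * lnd y q.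
Proof.
move=> eps0 [M HM]; apply: filterS2 HM (lnd_small y (- `|M| / eps)) => q h1 h2 qy.
have := h1 qy; have := h2 qy; rewrite ltr_pdivlMr // mulrC => h3 h4.
have := ler_norm (- u q); rewrite normrN; have := ler_norm M.
by move: h3 h4; clear; lra.
Qed.

Lemma infty_pos u (eps : R) : 0 < eps -> bd_inf u ->
  exists K, forall q, K < modulus q -> 0 < u q + eps * ln (modulus q).
Proof.
move=> eps0 [M [K HM]]; exists (Num.max K (expR (`|M| / eps))) => q.
rewrite gt_max => /andP[h1 h2].
have := HM q h1; have := ler_norm (- u q); rewrite normrN; have := ler_norm M.
have : `|M| < eps * ln (modulus q).
  rewrite -ltr_pdivrMl // mulrC -[ltLHS]expRK ltr_ln ?posrE ?expR_gt0 //.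
  exact: lt_trans (expR_gt0 _) h2.
by clear; lra.
Qed.

Lemma near_mem (l : seq (R * R)) z : \forall q \near z, q \in l -> q = z.
Proof.
elim: l => [|a l IH]; first by apply: filterS (@filterT _ (nbhs z) _) => q _.
have [->|az] := eqVneq a z.
  by apply: filterS IH => q h; rewrite inE => /predU1P[|/h].
have za : \forall q \near z, q != a by apply: near_neq; rewrite eq_sym.
by apply: filterS2 IH za => q h qa; rewrite inE (negbTE qa).
Qed.

Lemma eps_limit (a b : R) : (forall eps, 0 < eps -> 0 <= a + eps * b) -> 0 <= a.
Proof.
move=> h; apply/ler_addgt0Pr => x x0.
have b1 : 0 < `|b| + 1 by rewrite ltr_wpDl.
have := h _ (divr_gt0 x0 b1); move=> /le_trans; apply; rewrite lerD2l.
rewrite mulrAC -mulrA ler_piMr ?(ltW x0) // ler_pdivrMr // mul1r.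
by rewrite (le_trans (ler_norm _)) // lerDl.
Qed.

Lemma slit_min_principle (Z : seq (R * R)) k :
  (forall p, ~ slit p -> p \notin Z -> {for p, continuous k} /\ asym_harmonic k p) ->
  (forall t, e t -> forall eps : R, 0 < eps ->
     \forall q \near ((t, 0) : R * R), ~ slit q -> - eps < k q) ->
  (forall z, z \in Z -> ~ slit z -> \forall q \near z, q != z -> 0 < k q) ->
  (exists K, forall q, K < modulus q -> 0 < k q) ->
  forall p, ~ slit p -> p \notin Z -> 0 <= k p.
Proof.
move=> kD kslit kZ [K kinf] p0 sp0 pZ0.
have cB : closed (slit `|` [set` Z]).
  apply: closedU; first exact: closed_slit.
  apply: compact_closed; first exact: norm_hausdorff.
  by apply: finite_compact; exact: finite_seq.
apply: (@min_principle _ (slit `|` [set` Z])) => //.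
- move=> p /not_orP[sp /= pZ]; apply: kD => //; exact/negP.
- move=> p [[t et ->]|pZ] eps eps0.
    by apply: filterS (kslit t et eps eps0) => q h /not_orP[]/h.
  have [[t et ->]|sp] := pselect (slit p).
    by apply: filterS (kslit t et eps eps0) => q h /not_orP[]/h.
  apply: filterS (kZ p pZ sp) => q h /not_orP[_ /= /negP qZ].
  rewrite (@lt_trans _ _ 0) ?oppr_lt0 // h //.
  by apply: contraNneq qZ => ->.
- move=> eps eps0; exists K => q /kinf h _.
  by rewrite (@lt_trans _ _ 0) ?oppr_lt0.
- by move=> [//|/=]; apply/negP.
Qed.

Let inftyD : cdomain e infty_pt := @cdomain_infty R e.
Let finD y : ~ slit y -> cdomain e (finite_pt y) := iffRL (cdomain_finite e y).

Let gpinf_cont p : ~ slit p -> {for p, continuous (gp infty_pt)}.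
Proof. by move=> sp; apply: (gp_continuous e_compact g_green inftyD sp). Qed.

Let gpinf_asym p : ~ slit p -> asym_harmonic (gp infty_pt) p.
Proof. by move=> sp; apply: (gp_asym e_compact g_green inftyD sp). Qed.

Let gp_cont y p : ~ slit y -> ~ slit p -> p != y -> {for p, continuous (gp (finite_pt y))}.
Proof.
move=> sy sp /eqP py; apply: (gp_continuous e_compact g_green (finD sy) sp).
by case.
Qed.

Let gp_asymf y p : ~ slit y -> ~ slit p -> p != y -> asym_harmonic (gp (finite_pt y)) p.
Proof.
move=> sy sp /eqP py; apply: (gp_asym e_compact g_green (finD sy) sp).
by case.
Qed.

Lemma gp_infty_ge0 p : ~ slit p -> 0 <= gp infty_pt p.
Proof.
move=> sp; apply: (@slit_min_principle [::]) => //.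
- by move=> q sq _; split; [exact: gpinf_cont|exact: gpinf_asym].
- move=> t et eps eps0.
  apply: filterS (gp_slit e_regular g_green inftyD et eps0) => q h /h.
  by rewrite ltr_norml => /andP[].
have [K HK] := infty_pos ltr01 (gp_pole_infty g_green).
by exists K => q /HK; rewrite mul1r subrK.
Qed.

Lemma gp_ge0 y p : ~ slit y -> ~ slit p -> p != y -> 0 <= gp (finite_pt y) p.
Proof.
(* Near infinity the Green function with a finite pole is only known to be bounded; adding eps times
   the one with pole at infinity makes the sum positive there. *)
move=> sy sp py; apply: (@eps_limit _ (gp infty_pt p)) => eps eps0.
apply: (@slit_min_principle [:: y]
  (gp (finite_pt y) \+ (fun q => eps * gp infty_pt q))) => //.
- move=> q sq; rewrite inE => qy; split.
    apply: cvgD; first exact: gp_cont.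
    by apply: cvgM; [exact: cvg_cst|exact: gpinf_cont].
  by apply: asymD; [exact: gp_asymf|apply: asymZ; exact: gpinf_asym].
- move=> t et d d0.
  have h1 := gp_slit e_regular g_green (finD sy) et d0.
  apply: filterS2 h1 (gp_slit e_regular g_green inftyD et d0) => q h1 _ sq.
  have := h1 sq; rewrite ltr_norml => /andP[h _] /=.
  by rewrite (lt_le_trans h) // lerDl mulr_ge0 ?(ltW eps0) // gp_infty_ge0.
- move=> z; rewrite inE => /eqP -> _.
  have b : bd_at ((gp (finite_pt y) \+ lnd y) \+ (fun q => eps * gp infty_pt q)) y.
    apply: bd_atD; first exact: (gp_pole g_green sy).
    by apply: bd_atZ; apply: bd_at_continuous; exact: gpinf_cont.
  apply: filterS (pole_pos ltr01 b) => q h /h /=.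
  by rewrite mul1r; congr (0 < _); ring.
- have b := bd_infD (gp_bd_inf e_compact g_green sy) (bd_infZ eps (gp_pole_infty g_green)).
  have [K HK] := infty_pos eps0 b.
  by exists K => q /HK /=; congr (0 < _); ring.
- by rewrite inE.
Qed.

(** The harmonic extension of t |-> log |t - z| from e to the domain: the logarithmic poles at z and
    at infinity cancel, and both Green functions vanish on e. Only the value at p = z is
    meaningless, hence the conditions p != z below. *)
Definition green_kern z p : R := lnd z p - gp infty_pt p + gp (finite_pt z) p.

Local Notation kern := green_kern.

Lemma kern_reg z p : ~ slit z -> ~ slit p -> p != z ->
  {for p, continuous (kern z)} /\ asym_harmonic (kern z) p.
Proof.
move=> sz sp pz; split.
  apply: cvgD; last exact: gp_cont.
  by apply: cvgB; [exact: continuous_lnd|exact: gpinf_cont].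
have -> : kern z = (lnd z \+ (fun q => (-1) * gp infty_pt q)) \+ gp (finite_pt z).
  by apply/funext => q; rewrite /kern /= mulN1r.
apply: asymD; last exact: gp_asymf.
by apply: asymD; [exact: asym_lnd|apply: asymZ; exact: gpinf_asym].
Qed.

Lemma kern_slit z t : ~ slit z -> e t -> forall eps : R, 0 < eps ->
  \forall q \near ((t, 0) : R * R), ~ slit q -> `|kern z q - lnd z (t, 0)| < eps.
Proof.
move=> sz et eps eps0; have e3 : 0 < eps / 3 by rewrite divr_gt0.
have tz : (t, 0) != z by apply/eqP => tz; apply: sz; exists t.
have h1 := gp_slit e_regular g_green (finD sz) et e3.
have h2 := gp_slit e_regular g_green inftyD et e3.
have h3 : \forall q \near ((t, 0) : R * R), `|lnd z (t, 0) - lnd z q| < eps / 3.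
  exact: cvgr_dist_lt (continuous_lnd tz) _ e3.
apply: filterS3 h1 h2 h3 => q k1 k2 k3 sq.
have {}k1 := k1 sq; have {}k2 := k2 sq; rewrite distrC in k3.
have -> : kern z q - lnd z (t, 0) =
  (lnd z q - lnd z (t, 0)) - gp infty_pt q + gp (finite_pt z) q by rewrite /kern; ring.
rewrite (le_lt_trans (ler_normD _ _)) //.
have -> : eps = eps / 3 + eps / 3 + eps / 3 by field.
by rewrite ltrD // (le_lt_trans (ler_normB _ _)) // ltrD.
Qed.

Lemma kern_bd_at z p : ~ slit z -> ~ slit p -> bd_at (kern z) p.
Proof.
move=> sz sp; have [->|pz] := eqVneq p z.
  have -> : kern z = (gp (finite_pt z) \+ lnd z) \+ (fun q => (-1) * gp infty_pt q).
    by apply/funext => q; rewrite /kern /=; ring.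
  apply: bd_atD; first exact: (gp_pole g_green sz).
  by apply: bd_atZ; apply: bd_at_continuous; exact: gpinf_cont.
by apply: bd_at_continuous; have [] := kern_reg sz sp pz.
Qed.

Lemma kern_bd_inf z : ~ slit z -> bd_inf (kern z).
Proof.
move=> sz; have b1 : bd_inf (fun p => lnd z p - ln (modulus p)).
  have [M _ HM] := lnd_infty (modulus z) (@ltr01 R).
  by exists 1, M => q /HM; apply.
have := bd_infD (bd_infD b1 (bd_infZ (-1) (gp_pole_infty g_green)))
  (gp_bd_inf e_compact g_green sz).
congr (bd_inf _); apply/funext => q; rewrite /kern /=; ring.
Qed.

(* The maximum principle makes evaluation at b of the harmonic extensions
   [kern z] of the boundary functions [lnd z] a positive linear functional. *)
Lemma kern_positive (l : seq (R * (R * R))) (c : R) b :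
  (forall i, i \in l -> ~ slit i.2) ->
  (forall t, e t -> 0 <= \sum_(i <- l) i.1 * lnd i.2 (t, 0) + c) ->
  ~ slit b -> b \notin map snd l ->
  0 <= \sum_(i <- l) i.1 * kern i.2 b + c.
Proof.
move=> ls lpos sb bl.
pose S l p : R := \sum_(i <- l) i.1 * kern i.2 p + c.
(* A barrier: [W] is nonnegative and tends to + oo at each pole and at infinity, where [S] is merely
   bounded. The minimum principle applies to S + eps W, and eps then tends to 0. *)
pose W l p : R := gp infty_pt p + \sum_(i <- l : seq (R * (R * R))) gp (finite_pt i.2) p.
have Ss (i : R * (R * R)) l' p : S (i :: l') p = i.1 * kern i.2 p + S l' p.
  by rewrite /S big_cons addrA.
have Ws (i : R * (R * R)) l' p : W (i :: l') p = gp (finite_pt i.2) p + W l' p.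
  by rewrite /W big_cons addrCA.
have SsE (i : R * (R * R)) l' : S (i :: l') = (fun q => i.1 * kern i.2 q) \+ S l'.
  by apply/funext => q; rewrite Ss.
have WsE (i : R * (R * R)) l' : W (i :: l') = gp (finite_pt i.2) \+ W l'.
  by apply/funext => q; rewrite Ws.
have S0 : S [::] = cst c by apply/funext => q; rewrite /S big_nil add0r.
have W0 : W [::] = gp infty_pt by apply/funext => q; rewrite /W big_nil addr0.
have reg l' p : (forall i, i \in l' -> ~ slit i.2) -> ~ slit p -> p \notin map snd l' ->
    [/\ {for p, continuous (S l')}, asym_harmonic (S l') p,
      {for p, continuous (W l')} & asym_harmonic (W l') p].
  elim: l' => [|i l' IH] ls' sp pl.
    rewrite S0 W0; split; [exact: cvg_cst|exact: asym_cst|exact: gpinf_cont|exact: gpinf_asym].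
  move: pl; rewrite /= inE negb_or => /andP[pi pl].
  have si : ~ slit i.2 by apply: ls'; rewrite mem_head.
  have [||//|c1 a1 c2 a2] := IH.
  - by move=> j jl; apply: ls'; rewrite inE jl orbT.
  - by [].
  have [ck ak] := kern_reg si sp pi.
  rewrite SsE WsE; split.
  - by apply: cvgD => //; apply: cvgM; [exact: cvg_cst|exact: ck].
  - by apply: asymD => //; exact: asymZ.
  - by apply: cvgD => //; exact: gp_cont.
  - by apply: asymD => //; exact: gp_asymf.
have bd l' p : (forall i, i \in l' -> ~ slit i.2) -> ~ slit p -> bd_at (S l') p.
  elim: l' => [|i l' IH] ls' sp.
    by rewrite S0; apply: bd_at_continuous; exact: cvg_cst.
  rewrite SsE; apply: bd_atD.
    by apply: bd_atZ; apply: kern_bd_at => //; apply: ls'; rewrite mem_head.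
  by apply: IH => // j jl; apply: ls'; rewrite inE jl orbT.
have bdi l' : (forall i, i \in l' -> ~ slit i.2) -> bd_inf (S l').
  elim: l' => [|i l' IH] ls'.
    by rewrite S0; exists `|c|, 0 => q _.
  rewrite SsE; apply: bd_infD.
    by apply: bd_infZ; apply: kern_bd_inf; apply: ls'; rewrite mem_head.
  by apply: IH => j jl; apply: ls'; rewrite inE jl orbT.
have sl l' t : (forall i, i \in l' -> ~ slit i.2) -> e t -> forall d : R, 0 < d ->
    \forall q \near ((t, 0) : R * R), ~ slit q ->
      `|S l' q - (\sum_(i <- l') i.1 * lnd i.2 (t, 0) + c)| < d.
  move=> + et; elim: l' => [|i l' IH] ls' d d0.
    apply: filterS (@filterT _ (nbhs ((t, 0) : R * R)) _) => q _ _.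
    by rewrite S0 big_nil add0r subrr normr0.
  have si : ~ slit i.2 by apply: ls'; rewrite mem_head.
  have d2 : 0 < d / 2 by rewrite divr_gt0.
  have i1 : 0 < `|i.1| + 1 by rewrite ltr_wpDl.
  have h1 := kern_slit si et (divr_gt0 d2 i1).
  have ls1 j : j \in l' -> ~ slit j.2 by move=> jl; apply: ls'; rewrite inE jl orbT.
  have h2 := IH ls1 _ d2.
  apply: filterS2 h1 h2 => q k1 k2 sq.
  have {}k1 := k1 sq; have {}k2 := k2 sq.
  have -> : S (i :: l') q - (\sum_(i <- i :: l') i.1 * lnd i.2 (t, 0) + c) =
     i.1 * (kern i.2 q - lnd i.2 (t, 0)) + (S l' q - (\sum_(i <- l') i.1 * lnd i.2 (t, 0) + c)).
    by rewrite Ss big_cons; ring.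
  rewrite (le_lt_trans (ler_normD _ _)) //.
  have -> : d = d / 2 + d / 2 by field.
  rewrite ler_ltD // normrM (le_trans (ler_wpM2l (normr_ge0 _) (ltW k1))) //.
  by rewrite mulrCA ler_piMr ?(ltW d2) // ler_pdivrMr // mul1r lerDl.
have Wge l' z q : (forall i, i \in l' -> ~ slit i.2) -> ~ slit q -> q \notin map snd l' ->
    gp infty_pt q <= W l' q /\ (z \in map snd l' -> gp (finite_pt z) q <= W l' q).
  elim: l' => [|i l' IH] ls' sq ql.
    by rewrite W0; split.
  move: ql; rewrite /= inE negb_or => /andP[qi ql].
  have si : ~ slit i.2 by apply: ls'; rewrite mem_head.
  have ls1 j : j \in l' -> ~ slit j.2 by move=> jl; apply: ls'; rewrite inE jl orbT.
  have [I1 I2] := IH ls1 sq ql.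
  have gi : 0 <= gp (finite_pt i.2) q by exact: gp_ge0.
  rewrite Ws; split; first by rewrite (le_trans I1) // lerDr.
  rewrite inE => /predU1P[->|/I2 h]; last by rewrite (le_trans h) // lerDr.
  by rewrite lerDl (le_trans _ I1) // gp_infty_ge0.
apply: (@eps_limit _ (W l b)) => eps eps0.
apply: (@slit_min_principle (map snd l) (S l \+ (fun q => eps * W l q))) => //.
- move=> p sp pl; have [c1 a1 c2 a2] := reg l p ls sp pl; split.
    by apply: cvgD => //; apply: cvgM; [exact: cvg_cst|exact: c2].
  by apply: asymD => //; exact: asymZ.
- move=> t et d d0.
  have tl : (t, 0) \notin map snd l.
    by apply/negP => /mapP[i il ti]; apply: (ls i il); exists t.
  have nl : \forall q \near ((t, 0) : R * R), q \notin map snd l.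
    apply: filterS (near_mem (map snd l) (t, 0)) => q h.
    by apply/negP => ql; move: tl; rewrite -(h ql) ql.
  apply: filterS2 nl (sl l t ls et d d0) => q ql h sq.
  have {}h := h sq; have [w _] := Wge l b q ls sq ql.
  have w0 : 0 <= eps * W l q.
    by rewrite mulr_ge0 ?(ltW eps0) // (le_trans _ w) // gp_infty_ge0.
  have := lpos t et; move: h; rewrite ltr_norml => /andP[h _].
  by move: h w0; rewrite /=; set s := \sum_(i <- l) _; clear; lra.
- move=> z zl sz.
  have b1 : bd_at (S l \+ (fun q => eps * (gp (finite_pt z) \+ lnd z) q)) z.
    apply: bd_atD; first exact: bd.
    by apply: bd_atZ; exact: (gp_pole g_green sz).
  have ns : \forall q \near z, ~ slit q.
    by apply: open_nbhs_nbhs; split=> //; apply: closed_openC; exact: closed_slit.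
  have nl : \forall q \near z, q != z -> q \notin map snd l.
    apply: filterS (near_mem (map snd l) z) => q h qz.
    by apply: contra_neqN qz; exact: h.
  apply: filterS3 (pole_pos eps0 b1) ns nl => q h1 h2 h3 qz.
  have := h1 qz => /=; have [_ w] := Wge l z q ls h2 (h3 qz).
  have {}w := w zl; rewrite mulrDr addrA addrK => h.
  by apply: (lt_le_trans h); rewrite lerD2l ler_pM2l.
- have [K HK] := infty_pos eps0 (bd_infD (bdi l ls) (bd_infZ eps (gp_pole_infty g_green))).
  have [M HM] := bounded_modulus (compact_slit e_compact).
  have [M2 HM2] : exists M2, forall z, z \in map snd l -> modulus z <= M2.
    have : compact [set` map snd l] by apply: finite_compact; exact: finite_seq.
    by move=> /bounded_modulus.
  exists (Num.max K (Num.max M M2)) => q; rewrite !gt_max => /and3P[q1 q2 q3].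
  have sq : ~ slit q by move=> /HM; rewrite leNgt q2.
  have ql : q \notin map snd l by apply/negP => /HM2; rewrite leNgt q3.
  have [w _] := Wge l b q ls sq ql.
  have /= := HK q q1; rewrite mulrBr addrA subrK => h.
  by apply: (lt_le_trans h); rewrite lerD2l ler_pM2l.
Qed.

End comparison.

(** * Symmetry of the Green function *)

Section four_point_log.
Context {R : realType}.
Implicit Types (p q y z : R * R).

(* The product of the squared distances is |w^4 - r^4|^2 with w = z - q. *)
Lemma four_point_lnd z q (d r : R) : 0 < d -> d <= modulus (z - q) ->
  0 < r -> r <= d / 4 ->
  `|four_point (fun y => lnd y q) z r| <= 3 * r ^+ 4 / d ^+ 4.
Proof.
move=> d0 dz r0 rd.
set a := z.1 - q.1; set b := z.2 - q.2; set N := a ^+ 2 + b ^+ 2.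
have Nd : d ^+ 2 <= N.
  have -> : N = modulus (z - q) ^+ 2 by rewrite sqr_modulus.
  by rewrite ler_pXn2r ?nnegrE ?modulus_ge0 // ltW.
have N0 : 0 < N by apply: lt_le_trans Nd; rewrite exprn_gt0.
have rN : 16 * r ^+ 2 <= N.
  apply: le_trans Nd; have : r ^+ 2 <= (d / 4) ^+ 2.
    by rewrite ler_pXn2r ?nnegrE ?divr_ge0 // ltW.
  by rewrite expr_div_n; set x := r ^+ 2; set y := d ^+ 2; clear; lra.
have r20 : 0 < r ^+ 2 by rewrite exprn_gt0.
have lnh (x y : R) : (x, y) != q -> lnd (x, y) q = ln ((x - q.1) ^+ 2 + (y - q.2) ^+ 2) / 2.
  by move=> h; rewrite lndC lndE.
have pos (x y : R) : 0 < (x - q.1) ^+ 2 + (y - q.2) ^+ 2 -> (x, y) != q.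
  by apply: contraTneq => <- /=; rewrite !subrr expr0n addr0 ltxx.
have h1 : 0 < (z.1 + r - q.1) ^+ 2 + (z.2 - q.2) ^+ 2.
  have -> : (z.1 + r - q.1) ^+ 2 + (z.2 - q.2) ^+ 2 = (a / 2 + 2 * r) ^+ 2 + 3 / 4 * a ^+ 2
     + b ^+ 2 - 3 * r ^+ 2 by rewrite /a /b; field.
  have := sqr_ge0 (a / 2 + 2 * r); have := sqr_ge0 b; move: rN r20; rewrite /N; clear; lra.
have h2 : 0 < (z.1 - r - q.1) ^+ 2 + (z.2 - q.2) ^+ 2.
  have -> : (z.1 - r - q.1) ^+ 2 + (z.2 - q.2) ^+ 2 = (a / 2 - 2 * r) ^+ 2 + 3 / 4 * a ^+ 2
     + b ^+ 2 - 3 * r ^+ 2 by rewrite /a /b; field.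
  have := sqr_ge0 (a / 2 - 2 * r); have := sqr_ge0 b; move: rN r20; rewrite /N; clear; lra.
have h3 : 0 < (z.1 - q.1) ^+ 2 + (z.2 + r - q.2) ^+ 2.
  have -> : (z.1 - q.1) ^+ 2 + (z.2 + r - q.2) ^+ 2 = (b / 2 + 2 * r) ^+ 2 + 3 / 4 * b ^+ 2
     + a ^+ 2 - 3 * r ^+ 2 by rewrite /a /b; field.
  have := sqr_ge0 (b / 2 + 2 * r); have := sqr_ge0 a; move: rN r20; rewrite /N; clear; lra.
have h4 : 0 < (z.1 - q.1) ^+ 2 + (z.2 - r - q.2) ^+ 2.
  have -> : (z.1 - q.1) ^+ 2 + (z.2 - r - q.2) ^+ 2 = (b / 2 - 2 * r) ^+ 2 + 3 / 4 * b ^+ 2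
     + a ^+ 2 - 3 * r ^+ 2 by rewrite /a /b; field.
  have := sqr_ge0 (b / 2 - 2 * r); have := sqr_ge0 a; move: rN r20; rewrite /N; clear; lra.
set P := ((z.1 + r - q.1) ^+ 2 + (z.2 - q.2) ^+ 2) *
         ((z.1 - r - q.1) ^+ 2 + (z.2 - q.2) ^+ 2) *
         ((z.1 - q.1) ^+ 2 + (z.2 + r - q.2) ^+ 2) *
         ((z.1 - q.1) ^+ 2 + (z.2 - r - q.2) ^+ 2).
have P0 : 0 < P by rewrite !mulr_gt0.
have -> : four_point (fun y => lnd y q) z r = (ln P - ln (N ^+ 4)) / 2.
  have -> : ln (N ^+ 4) = 4 * ln N by rewrite lnXn // mulr_natl.
  rewrite /four_point /P !lnM ?posrE ?mulr_gt0 //.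
  rewrite (lnh _ _ (pos _ _ h1)) (lnh _ _ (pos _ _ h2)) (lnh _ _ (pos _ _ h3)) (lnh _ _ (pos _ _ h4)).
  have -> : lnd z q = ln N / 2.
    by rewrite [z]surjective_pairing lnh //; apply: pos; exact: N0.
  by field.
(* With w = a + i b, P = |w^4 - r^4|^2 and N^4 = |w|^8, and the last factor is r^4 - 2 Re w^4; as
   |Re w^4| <= N^2, the difference is of order r^4 N^2. *)
have PE : P - N ^+ 4 = r ^+ 4 * (r ^+ 4 - 2 * (a ^+ 4 - 6 * a ^+ 2 * b ^+ 2 + b ^+ 4)).
  by rewrite /P /N /a /b; ring.
have r4N : r ^+ 4 <= N ^+ 2 / 16.
  have : (16 * r ^+ 2) ^+ 2 <= N ^+ 2 by rewrite ler_pXn2r ?nnegrE ?(ltW N0) // mulr_ge0 // ltW.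
  have -> : (16 * r ^+ 2) ^+ 2 = 256 * r ^+ 4 by ring.
  by have := sqr_ge0 N; set x := r ^+ 4; set y := N ^+ 2; clear; lra.
have r40 : 0 <= r ^+ 4 by rewrite exprn_ge0 // ltW.
have hab : `|a ^+ 4 - 6 * a ^+ 2 * b ^+ 2 + b ^+ 4| <= N ^+ 2.
  have e1 : N ^+ 2 - (a ^+ 4 - 6 * a ^+ 2 * b ^+ 2 + b ^+ 4) = 8 * (a * b) ^+ 2 by rewrite /N; ring.
  have e2 : N ^+ 2 + (a ^+ 4 - 6 * a ^+ 2 * b ^+ 2 + b ^+ 4) = 2 * (a ^+ 2 - b ^+ 2) ^+ 2 by rewrite /N; ring.
  have := sqr_ge0 (a * b); have := sqr_ge0 (a ^+ 2 - b ^+ 2).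
  rewrite ler_norml; move: e1 e2; set x := (a * b) ^+ 2; set y := (_ - _) ^+ 2.
  set w := _ + b ^+ 4; set v := N ^+ 2.
  by move=> e1 e2 x0 y0; apply/andP; split; move: e1 e2 x0 y0; clear; lra.
have PN : `|P - N ^+ 4| <= r ^+ 4 * (3 * N ^+ 2).
  rewrite PE [`|_ * _|]normrM (ger0_norm r40) ler_wpM2l //.
  rewrite (le_trans (ler_normB _ _)) // [`|2 * _|]normrM (ger0_norm r40) (@ger0_norm _ 2) //.
  have N2 : 0 <= N ^+ 2 by rewrite sqr_ge0.
  by move: r4N hab N2; set x := r ^+ 4; set y := N ^+ 2; set w := `|_|; clear; lra.
have N40 : 0 < N ^+ 4 / 2 by rewrite divr_gt0 // exprn_gt0.
have m1 : N ^+ 4 / 2 <= N ^+ 4 by move: N40; set x := N ^+ 4; clear; lra.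
have m2 : N ^+ 4 / 2 <= P.
  have h5 : r ^+ 4 * (3 * N ^+ 2) <= N ^+ 2 / 16 * (3 * N ^+ 2).
    by rewrite ler_wpM2r // mulr_ge0 // sqr_ge0.
  have h6 : N ^+ 2 / 16 * (3 * N ^+ 2) = 3 / 16 * N ^+ 4 by field.
  have := ler_norm (- (P - N ^+ 4)); rewrite normrN => h7.
  have := le_trans h7 (le_trans PN h5); rewrite h6.
  by move: N40; set x := N ^+ 4; clear; lra.
rewrite normrM (@ger0_norm _ 2^-1) // ler_pdivrMr //.
apply: (le_trans (ln_dist N40 m2 m1)).
rewrite ler_pdivrMr //; apply: (le_trans PN).
have -> : 3 * r ^+ 4 / d ^+ 4 * 2 * (N ^+ 4 / 2) = r ^+ 4 * (3 * N ^+ 2) * (N ^+ 2 / d ^+ 4).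
  by field; rewrite gt_eqF.
rewrite ler_peMr //; first by rewrite mulr_ge0 // mulr_ge0 // sqr_ge0.
rewrite ler_pdivlMr ?exprn_gt0 // mul1r -[4%N]/((2 * 2)%N) exprM.
by rewrite ler_pXn2r // nnegrE ?sqr_ge0 // ltW.
Qed.

End four_point_log.

Section symmetry.
Context {R : realType} (e : set R) (g : sphere R -> sphere R -> R).
Hypotheses (e_compact : compact e) (e_regular : regular e) (g_green : is_green e g).
Implicit Types (p q y z b : R * R).
Local Notation slit := (slit e).
Local Notation gp := (gp g).
Local Notation kern := (green_kern g).

(** Positivity applied to l and to its negative. Any uniform estimate on e for a combination of
    logarithms passes to the same combination of kernels at b. *)
Lemma kern_bound (l : seq (R * (R * R))) (c m : R) b :
  (forall i, i \in l -> ~ slit i.2) ->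
  (forall t, e t -> `|\sum_(i <- l) i.1 * lnd i.2 (t, 0) + c| <= m) ->
  ~ slit b -> b \notin map snd l ->
  `|\sum_(i <- l) i.1 * kern i.2 b + c| <= m.
Proof.
move=> ls lm sb bl; rewrite ler_norml; apply/andP; split.
  have := @kern_positive _ e g e_compact e_regular g_green l (c + m) b ls _ sb bl.
  rewrite -(subr_ge0 (- m)) opprK -addrA; apply => t /lm.
  by rewrite ler_norml -[- m <= _]subr_ge0 opprK -addrA => /andP[].
pose l' := [seq (- i.1, i.2) | i <- l].
have sl' (f : R * R -> R) : \sum_(i <- l') i.1 * f i.2 = - \sum_(i <- l) i.1 * f i.2.
  by rewrite big_map -sumrN; apply: eq_bigr => i _; rewrite mulNr.
have := @kern_positive _ e g e_compact e_regular g_green l' (m - c) b.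
have -> : \sum_(i <- l') i.1 * kern i.2 b = - \sum_(i <- l) i.1 * kern i.2 b.
  exact: (sl' (fun z => kern z b)).
rewrite addrCA -opprD subr_ge0; apply.
- by move=> i /mapP[j jl ->] /=; exact: ls.
- move=> t /lm; rewrite (sl' (fun z => lnd z (t, 0))).
  by rewrite addrCA -opprD subr_ge0 ler_norml => /andP[].
- by [].
- rewrite -map_comp; move: bl; apply: contra => /mapP[i il ->].
  by apply/mapP; exists i.
Qed.

Lemma kern1 z (c m : R) b : ~ slit z -> ~ slit b -> b != z ->
  (forall t, e t -> `|lnd z (t, 0) - c| <= m) -> `|kern z b - c| <= m.
Proof.
move=> sz sb bz lm.
have := @kern_bound [:: (1, z)] (- c) m b; rewrite !big_seq1 /= mul1r; apply => //.
- by move=> i; rewrite inE => /eqP ->.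
- by move=> t /lm; rewrite big_seq1 /= mul1r.
- by rewrite inE.
Qed.

Lemma kern2 z z' (m : R) b : ~ slit z -> ~ slit z' -> ~ slit b -> b != z -> b != z' ->
  (forall t, e t -> `|lnd z (t, 0) - lnd z' (t, 0)| <= m) -> `|kern z b - kern z' b| <= m.
Proof.
move=> sz sz' sb bz bz' lm.
have := @kern_bound [:: (1, z); (- 1, z')] 0 m b.
rewrite !big_cons !big_nil /= mul1r mulN1r !addr0; apply => //.
- by move=> i; rewrite !inE => /orP[]/eqP ->.
- by move=> t /lm; rewrite !big_cons !big_nil /= mul1r mulN1r !addr0.
- by rewrite !inE negb_or bz.
Qed.

Lemma near_off z b : ~ slit z -> z != b -> \forall q \near z, ~ slit q /\ q != b.
Proof.
move=> sz zb; have n1 := near_neq zb.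
have n2 : \forall q \near z, (~` slit) q.
  by apply: open_nbhs_nbhs; split=> //; apply: closed_openC; exact: closed_slit.
by apply: filterS2 n1 n2.
Qed.

Lemma kern_continuous_param z b : ~ slit z -> ~ slit b -> z != b ->
  {for z, continuous (fun z => kern z b)}.
Proof.
move=> sz sb zb; have [d d0 hd] := slit_dist e_compact sz.
have d20 : 0 < d / 2 by rewrite divr_gt0.
apply/cvgrPdist_le => /= eps eps0.
have cz : {for z, continuous (fun p => modulus (z - p))}.
  apply: (@continuous_comp _ _ _ (fun p => z - p) modulus).
    by apply: cvgB; [exact: cvg_cst|exact: cvg_id].
  exact: modulus_continuous.
have small (x : R) : 0 < x -> \forall q \near z, modulus (z - q) < x.
  move=> x0; apply: cvgr_lt cz _ _.
  by rewrite subrr /modulus /= expr0n addr0 sqrtr0.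
have e1 : 0 < eps * (d / 2) by rewrite mulr_gt0.
apply: filterS3 (small _ d20) (small _ e1) (near_off sz zb) => q q1 q2 [sq qb].
apply: kern2 => //; [by rewrite eq_sym|by rewrite eq_sym|].
move=> t et.
have h1 : d <= modulus ((t, 0) - z) by rewrite modulusBC; exact: hd.
have h2 : d / 2 <= modulus ((t, 0) - q).
  have h := modulusD ((t, 0) - q) (q - z); rewrite addrA subrK in h.
  move: (le_trans h1 h) q1; rewrite [modulus (q - z)]modulusBC; clear; lra.
apply: (le_trans (lnd_dist d20 _ h2)).
  by rewrite (le_trans _ h1) // ler_pdivrMr // ler_peMr ?(ltW d0) // ler1n.
by rewrite ler_pdivrMr // ltW.
Qed.

(** Nothing is known about derivatives of the kernel in z. But the four-point differences of the
    boundary functions z |-> log |t - z| are of order r^4 uniformly on e, and [kern_bound] transfers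
    this to b; the five entries of the list are the points of the difference. *)
Lemma kern_asym_param z b : ~ slit z -> ~ slit b -> z != b ->
  asym_harmonic (fun z => kern z b) z.
Proof.
move=> sz sb zb eps eps0; have [d d0 hd] := slit_dist e_compact sz.
have [d1 d10 h1] := near_plane (near_off sz zb).
exists (Num.min (Num.min d1 (d / 4)) (Num.min 1 (eps * d ^+ 4 / 3))).
  by rewrite !lt_min d10 ltr01 !divr_gt0 // mulr_gt0 // exprn_gt0.
move=> r r0; rewrite !lt_min => /andP[/andP[r1 r2] /andP[r3 r4]].
have off q : `|q.1 - z.1| < d1 -> `|q.2 - z.2| < d1 -> ~ slit q /\ q != b by exact: h1.
have [|/=|sA bA] := off (z.1 + r, z.2).
- by rewrite /= addrAC subrr add0r gtr0_norm.
- by rewrite subrr normr0.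
have [|/=|sB bB] := off (z.1 - r, z.2).
- by rewrite /= addrAC subrr add0r normrN gtr0_norm.
- by rewrite subrr normr0.
have [/=||sC bC] := off (z.1, z.2 + r).
- by rewrite subrr normr0.
- by rewrite /= addrAC subrr add0r gtr0_norm.
have [/=||sD bD] := off (z.1, z.2 - r).
- by rewrite subrr normr0.
- by rewrite /= addrAC subrr add0r normrN gtr0_norm.
have E (x1 x2 x3 x4 x5 : R) :
    x1 + (x2 + (x3 + (x4 + x5))) = x1 + x2 + x3 + x4 + x5 by rewrite !addrA.
have := @kern_bound [:: (1, (z.1 + r, z.2)); (1, (z.1 - r, z.2)); (1, (z.1, z.2 + r));
   (1, (z.1, z.2 - r)); (- 4, z)] 0 (eps * r ^+ 2) b.
rewrite !big_cons !big_nil /= !mul1r !addr0 E mulNr /four_point /=; apply.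
- by move=> i; rewrite !inE => /orP[|/orP[|/orP[|/orP[]]]]/eqP ->.
- move=> t et; have dz := hd t et.
  rewrite !big_cons !big_nil /= !mul1r !addr0 E mulNr.
  apply: (le_trans (four_point_lnd d0 dz r0 (ltW r2))).
  have -> : 3 * r ^+ 4 / d ^+ 4 = (r ^+ 2 * 3 / d ^+ 4) * r ^+ 2.
    by field; rewrite gt_eqF.
  rewrite ler_pM2r ?exprn_gt0 // ler_pdivrMr ?exprn_gt0 // -ler_pdivlMr //.
  by rewrite (le_trans _ (ltW r4)) // expr2 ler_piMl ?ltW.
- by [].
- by rewrite !inE !negb_or ![b == _]eq_sym bA bB bC bD zb.
Qed.

(** As a function of the pole z, h z = g(b, z) is harmonic off b, nonnegative, and has the
    singularity - log |z - b| at b up to a bounded term. The minimum principle is applied to h -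
    g(., b), to which eps h is added for the pole b and eps g(., oo) for infinity. *)
Lemma green_sym_le b z : ~ slit b -> ~ slit z -> z != b ->
  gp (finite_pt b) z <= gp (finite_pt z) b.
Proof.
move=> sb; pose h z := kern z b - lnd z b + gp infty_pt b.
have hE z' : h z' = gp (finite_pt z') b by rewrite /h /green_kern; ring.
have h0 z' : ~ slit z' -> z' != b -> 0 <= h z'.
  by move=> sz' z'b; rewrite hE; apply: (gp_ge0 e_compact e_regular g_green) => //; rewrite eq_sym.
have bD : cdomain e (finite_pt b) by exact/cdomain_finite.
have iD : cdomain e infty_pt := @cdomain_infty R e.
have nb z' : z' != b -> finite_pt z' <> finite_pt b by move=> /eqP h' []; exact: h'.
move=> sz zb; rewrite -hE -subr_ge0.
apply: (@eps_limit _ _ (h z + gp infty_pt z)) => eps eps0.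
have -> : h z - gp (finite_pt b) z + eps * (h z + gp infty_pt z) =
  ((fun z => (1 + eps) * h z) \+ ((fun z => (-1) * gp (finite_pt b) z) \+ (fun z => eps * gp infty_pt z))) z.
  by rewrite /=; ring.
apply: (@slit_min_principle _ e e_compact [:: b]) => //; last by rewrite inE.
- move=> p sp; rewrite inE => pb.
  have ck := kern_continuous_param sp sb pb.
  have ak := kern_asym_param sp sb pb.
  have lndE' : (fun z => lnd z b) = lnd b by apply/funext => q; rewrite lndC.
  have cl : {for p, continuous (fun z => lnd z b)}.
    by rewrite lndE'; exact: continuous_lnd.
  have al : asym_harmonic (fun z => lnd z b) p.
    by rewrite lndE'; exact: asym_lnd.
  have ch : {for p, continuous h}.
    by apply: cvgD; [apply: cvgB; [exact: ck|exact: cl]|exact: cvg_cst].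
  have ah : asym_harmonic h p.
    have -> : h = ((fun z => kern z b) \+ (fun z => (-1) * lnd z b)) \+ cst (gp infty_pt b).
      by apply/funext => q; rewrite /h /= mulN1r.
    by apply: asymD; [apply: asymD; [exact: ak|exact: asymZ]|exact: asym_cst].
  have c1 := gp_continuous e_compact g_green bD sp (nb _ pb).
  have c2 := gp_continuous e_compact g_green iD sp (fun H : finite_pt p = infty_pt => ltac:(by [])).
  have a1 := gp_asym e_compact g_green bD sp (nb _ pb).
  have a2 := gp_asym e_compact g_green iD sp (fun H : finite_pt p = infty_pt => ltac:(by [])).
  split; last by apply: asymD; [exact: asymZ|apply: asymD; exact: asymZ].
  apply: cvgD; first by apply: cvgM; [exact: cvg_cst|exact: ch].
  by apply: cvgD; apply: cvgM; [exact: cvg_cst|exact: c1|exact: cvg_cst|exact: c2].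
- move=> t et d d0.
  have tb : (t, 0) != b by apply/eqP => tb; apply: sb; rewrite -tb; exists t.
  apply: filterS2 (gp_slit e_regular g_green bD et d0) (near_neq tb) => q hq qb sq.
  have := hq sq; rewrite ltr_norml => /andP[_ h2] /=.
  have g0 := gp_infty_ge0 e_compact e_regular g_green sq.
  have := h0 q sq qb; move: (h q) => x x0.
  have y0 : 0 <= (1 + eps) * x by rewrite mulr_ge0 // addr_ge0 // ltW.
  have y1 : 0 <= eps * gp infty_pt q by rewrite mulr_ge0 // ltW.
  rewrite mulN1r (@lt_le_trans _ _ (- gp (finite_pt b) q)) ?ltrN2 //.
  by rewrite addrCA lerDl addr_ge0.
- move=> z'; rewrite inE => /eqP -> _.
  have [d d0 hd] := slit_dist e_compact sb.
  (* b has positive distance from e, so for z near b the functions log |t - z| are uniformly bounded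
     on e, and [kern1] bounds their extensions. *)
  have bk : bd_at (fun z => kern z b) b.
    have [M HM] := bounded_modulus (compact_slit e_compact); have d20 : 0 < d / 2 by rewrite divr_gt0.
    have cb : {for b, continuous (fun p => modulus (b - p))}.
      apply: (@continuous_comp _ _ _ (fun p => b - p) modulus).
        by apply: cvgB; [exact: cvg_cst|exact: cvg_id].
      exact: modulus_continuous.
    have small : \forall q \near b, modulus (b - q) < d / 2.
      by apply: cvgr_lt cb _ _; rewrite subrr /modulus /= expr0n addr0 sqrtr0.
    have ns : \forall q \near b, (~` slit) q.
      by apply: open_nbhs_nbhs; split=> //; apply: closed_openC; exact: closed_slit.
    exists ((M + modulus b + d) / (d / 2) + `|ln (d / 2)|).
    apply: filterS2 small ns => q q1 sq qb.
    have bq : b != q by rewrite eq_sym.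
    rewrite -lerBlDr (le_trans (lerB_dist _ _)) //.
    apply: kern1 => // t et.
    have h1 : d <= modulus ((t, 0) - b) by rewrite modulusBC; exact: hd.
    have h2 : d / 2 <= modulus ((t, 0) - q).
      have h' := modulusD ((t, 0) - q) (q - b); rewrite addrA subrK in h'.
      by move: (le_trans h1 h') q1; rewrite [modulus (q - b)]modulusBC; clear; lra.
    apply: (le_trans (ln_dist d20 h2 (lexx _))).
    rewrite ler_wpM2r ?invr_ge0 ?(ltW d20) // (le_trans (ler_normB _ _)) //.
    rewrite (ger0_norm (modulus_ge0 _)) (gtr0_norm d20).
    have t0 : modulus ((t, 0) : R * R) <= M by apply: HM; exists t.
    have := modulusD ((t, 0) : R * R) (- q); rewrite modulusN => h3.
    have h4 := modulusD (q - b) b; rewrite subrK modulusBC in h4.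
    by move: h3 h4 q1 t0; clear; lra.
  have bu : bd_at ((fun z => (1 + eps) * (kern z b + gp infty_pt b)) \+
     ((fun z => (-1) * (gp (finite_pt b) \+ lnd b) z) \+ (fun z => eps * gp infty_pt z))) b.
    apply: bd_atD.
      apply: bd_atZ; apply: bd_atD; first exact: bk.
      by apply: bd_at_continuous; exact: cvg_cst.
    apply: bd_atD; first by apply: bd_atZ; exact: (gp_pole g_green sb).
    apply: bd_atZ; apply: bd_at_continuous.
    exact: (gp_continuous e_compact g_green iD sb (fun H : finite_pt b = infty_pt => ltac:(by []))).
  apply: filterS (pole_pos eps0 bu) => q hq /hq /=.
  by rewrite /h [lnd q b]lndC; congr (0 < _); ring.
have bi := bd_infD (bd_infZ (-1) (gp_bd_inf e_compact g_green sb)) (bd_infZ eps (gp_pole_infty g_green)).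
have [K HK] := infty_pos eps0 bi.
have [M HM] := bounded_modulus (compact_slit e_compact).
exists (Num.max K (Num.max M (modulus b))) => q; rewrite !gt_max => /and3P[q1 q2 q3].
have sq : ~ slit q by move=> /HM; rewrite leNgt q2.
have qb : q != b by apply: contraTneq q3 => ->; rewrite ltxx.
apply: (lt_le_trans (HK q q1)) => /=.
have -> : -1 * gp (finite_pt b) q + eps * (gp infty_pt q - ln (modulus q)) + eps * ln (modulus q)
  = -1 * gp (finite_pt b) q + eps * gp infty_pt q by ring.
by rewrite lerDr mulr_ge0 ?h0 // addr_ge0 // ltW.
Qed.

(** log |t - z| - log |z| tends to 0 uniformly for t in e as z tends to infinity, hence so does its
    extension kern z b - log |z|, and likewise log |b - z| - log |z|. *)
Lemma green_at_infty b : ~ slit b -> forall eps : R, 0 < eps -> exists K,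
  forall z, K < modulus z -> `|gp (finite_pt z) b - gp infty_pt b| <= eps.
Proof.
move=> sb eps eps0; have [M HM] := bounded_modulus (compact_slit e_compact).
have e2 : 0 < eps / 2 by rewrite divr_gt0.
have [K K0 HK] := lnd_infty (Num.max M (modulus b)) e2.
exists (Num.max K (Num.max M (modulus b))) => z; rewrite !gt_max => /and3P[z1 z2 z3].
have sz : ~ slit z by move=> /HM; rewrite leNgt z2.
have bz : b != z by apply: contraTneq z3 => ->; rewrite ltxx.
have h1 : `|kern z b - ln (modulus z)| <= eps / 2.
  apply: kern1 => // t et; rewrite lndC; apply: HK => //.
  by rewrite le_max HM //; exists t.
have h2 : `|lnd z b - ln (modulus z)| <= eps / 2.
  by rewrite lndC; apply: HK => //; rewrite le_max lexx orbT.
have -> : gp (finite_pt z) b - gp infty_pt b =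
  (kern z b - ln (modulus z)) - (lnd z b - ln (modulus z)) by rewrite /green_kern; ring.
rewrite (le_trans (ler_normB _ _)) // (le_trans (lerD h1 h2)) //.
by rewrite le_eqVlt; apply/orP; left; apply/eqP; field.
Qed.

Lemma exists_modulus (K : R) : exists z, K < modulus z.
Proof.
set r := `|K| + 1; have r0 : 0 <= r by rewrite addr_ge0.
exists (r, 0); apply: (@lt_le_trans _ _ `|r|); last exact: (modulus_ge1 (r, 0)).
by rewrite ger0_norm // (le_lt_trans (ler_norm _)) // ltrDl.
Qed.

(** The limit of [green_sym_le] as z tends to infinity, by [green_at_infty] on the right and
    continuity at infinity on the left. *)
Lemma green_sym_infty b : ~ slit b -> g infty_pt (finite_pt b) <= gp infty_pt b.
Proof.
move=> sb; apply/ler_addgt0Pr => eps eps0.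
have e2 : 0 < eps / 2 by rewrite divr_gt0.
have [K1 H1] := green_at_infty sb e2.
have [K2 H2] := g_infty_continuous e_compact g_green sb e2.
have [M HM] := bounded_modulus (compact_slit e_compact).
have [z] := exists_modulus (Num.max (Num.max K1 K2) (Num.max M (modulus b))).
rewrite !gt_max => /andP[/andP[z1 z2] /andP[z3 z4]].
have sz : ~ slit z by move=> /HM; rewrite leNgt z3.
have zb : z != b by apply: contraTneq z4 => ->; rewrite ltxx.
have h := green_sym_le sb sz zb.
have h1 := H1 z z1; have h2 := ltW (H2 z z2).
rewrite ler_norml in h1; rewrite ler_norml in h2.
case/andP : h1 => _ h1; case/andP : h2 => h2 _.
rewrite lerBlDr in h1; rewrite lerNl opprB lerBlDr in h2.
apply: (le_trans h2); apply: (le_trans (lerD (lexx (eps / 2)) (le_trans h h1))).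
by rewrite addrA -splitr addrC.
Qed.

End symmetry.

(** * Perron solutions *)

Section sphere_harmonic.
Context {R : realType}.
Implicit Types (p q y : R * R) (U V : set (sphere R)) (u v : sphere R -> R).

Lemma harmonic_onS U V u : V `<=` U -> harmonic_on U u -> harmonic_on V u.
Proof.
by move=> VU [h1 h2]; split; [apply: plane_harmonicS h1|apply: plane_harmonicS h2] => p /VU.
Qed.

Lemma harmonic_onD U u v : open U -> harmonic_on U u -> harmonic_on U v ->
  harmonic_on U (u \+ v).
Proof.
move=> oU [u1 u2] [v1 v2]; split.
  exact: (plane_harmonicD (open_finite oU) u1 v1).
exact: (plane_harmonicD (open_chart oU) u2 v2).
Qed.

Lemma harmonic_onZ U u (c : R) : open U -> harmonic_on U u ->
  harmonic_on U (fun z => c * u z).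
Proof.
move=> oU [u1 u2]; split.
  exact: (plane_harmonicZ c (open_finite oU) u1).
exact: (plane_harmonicZ c (open_chart oU) u2).
Qed.

(** The value at infinity is arbitrary, since the function is used only on sets that omit
    infinity. *)
Definition slnd y (z : sphere R) : R := if z is Some p then lnd y p else 0.

Lemma modulus_inv_sub p y : p != (0, 0) -> y != (0, 0) ->
  modulus (inv_pt p - y) = modulus y * modulus (p - inv_pt y) / modulus p.
Proof.
move=> p0 y0; have mp := modulus_gt0 p0; have my := modulus_gt0 y0.
have h0 : 0 <= modulus y * modulus (p - inv_pt y) / modulus p.
  by rewrite divr_ge0 ?mulr_ge0 ?modulus_ge0.
apply/eqP; rewrite -(@eqrXn2 _ 2) ?modulus_ge0 //; apply/eqP.
rewrite expr_div_n exprMn !sqr_modulus /inv_pt /= !sqr_modulus.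
have := sqdist_gt0 p0; have := sqdist_gt0 y0; rewrite /= !subr0 => y1 p1.
by field; rewrite !gt_eqF.
Qed.

(** In the chart at infinity log |1/p - y| = log |y| + log |p - 1/y| - log |p|, where y != 0 makes
    1/y a finite point. *)
Lemma harmonic_on_slnd U y : open U -> ~ U infty_pt -> ~ U (finite_pt y) -> y != (0, 0) ->
  harmonic_on U (slnd y).
Proof.
move=> oU Ui Uy y0; split.
  apply: (@plane_harmonicS _ (~` [set y])); last exact: plane_harmonic_lnd.
  by move=> p Up py; apply: Uy; rewrite -py.
have oW := open_chart oU.
have W0 p : (@chart_infty R @^-1` U) p -> p != (0, 0).
  by move=> Wp; apply/eqP => p0; apply: Ui; move: Wp; rewrite /= p0 /chart_infty eqxx.
have Wy p : (@chart_infty R @^-1` U) p -> p != inv_pt y.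
  move=> Wp; apply/eqP => py; apply: Uy; move: (Wp).
  by rewrite /= chart_inftyE ?W0 // py -/(inv_pt _) inv_ptK.
pose f := (cst (ln (modulus y)) \+ lnd (inv_pt y)) \+ (fun p => (-1) * lnd (0, 0) p).
apply: (@eq_plane_harmonic _ _ f) => //.
  move=> p Wp; have p0 := W0 p Wp.
  have -> : (slnd y \o @chart_infty R) p = ln (modulus (inv_pt p - y)).
    by rewrite /= chart_inftyE.
  rewrite /f /lnd /=.
  have mp := modulus_gt0 p0; have my := modulus_gt0 y0.
  have m1 : 0 < modulus (p - inv_pt y) by apply: modulus_sub_gt0; exact: Wy.
  rewrite modulus_inv_sub // ln_div ?posrE ?mulr_gt0 // lnM ?posrE //.
  by rewrite subr0 mulN1r.
have h1 : plane_harmonic (@chart_infty R @^-1` U) (lnd (inv_pt y)).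
  apply: (@plane_harmonicS _ (~` [set inv_pt y])); last exact: plane_harmonic_lnd.
  by move=> p /Wy/eqP.
have h2 : plane_harmonic (@chart_infty R @^-1` U) (lnd (0, 0)).
  apply: (@plane_harmonicS _ (~` [set (0, 0)])); last exact: plane_harmonic_lnd.
  by move=> p /W0/eqP.
have h3 := plane_harmonicD oW (plane_harmonic_cst (ln (modulus y)) oW) h1.
exact: (plane_harmonicD oW h3 (plane_harmonicZ (-1) oW h2)).
Qed.

Lemma connected_box p (d : R) : connected (ball p d).
Proof.
have [d0|d0] := leP d 0.
  have -> : ball p d = set0; last exact: connected0.
  by rewrite predeqE => q; split => // -[]; rewrite /ball /= => /lt_le_trans/(_ d0); rewrite normr_lt0.
pose seg q := (fun s : R => p + s *: (q - p)) @` `[0, 1]%classic.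
have -> : ball p d = \bigcup_(q in ball p d) seg q.
  rewrite predeqE => q; split=> [bq|[q' [h1 h2] [s /=]]].
    exists q => //; exists 1; first by rewrite /= in_itv /= ler01 lexx.
    by rewrite scale1r addrC subrK.
  rewrite in_itv /= => /andP[s0 s1] <-.
  have aux (a b : R) : `|a - b| < d -> `|a - (a + s * (b - a))| < d.
    move=> ab; rewrite opprD addrA subrr add0r normrN normrM (ger0_norm s0) distrC.
    by apply: le_lt_trans ab; rewrite ler_piMl.
  by split; apply: aux.
apply: bigcup_connected.
  exists p => q _; exists 0; first by rewrite /= in_itv /= lexx ler01.
  by rewrite scale0r addr0.
move=> q _; apply: connected_continuous_connected.
  exact: segment_connected.
apply: continuous_subspaceT => s; apply: cvgD; first exact: cvg_cst.
by apply: cvgZr_tmp; exact: cvg_id.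
Qed.

End sphere_harmonic.

Section perron_comparison.
Context {R : realType} (e : set R).
Hypothesis e_compact : compact e.
Implicit Types (p q y : R * R) (u v : sphere R -> R).
Local Notation slit := (slit e).

Definition domain y : set (sphere R) := (cdomain e `\ infty_pt) `\ finite_pt y.

Lemma open_domain y : open (domain y).
Proof. by apply/open_setD1/open_setD1/open_cdomain. Qed.

Lemma domain_finite y p : domain y (finite_pt p) <-> ~ slit p /\ p != y.
Proof.
split=> [[[/cdomain_finite sp _] py]|[sp /eqP py]].
  by split=> //; apply/eqP => pE; apply: py; rewrite pE.
by split; [split=> //; exact/cdomain_finite|case].
Qed.

(** A positive value of v - u would give a positive maximum, attained on a compact set because u
    dominates v near e, near y and at infinity. Around a maximum point the maximum principle in the
    definition of subharmonicity makes v - u constant. *)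
Lemma perron_comparison (phi : R -> R) v u y : ~ slit y ->
  perron_class e phi v -> harmonic_on (domain y) u ->
  (forall t, e t -> forall eps : R, 0 < eps ->
    \forall q \near ((t, 0) : R * R), ~ slit q -> phi t - eps < u (finite_pt q)) ->
  (forall C : R, \forall q \near y, q != y -> C < u (finite_pt q)) ->
  (forall C : R, exists K, forall q, K < modulus q -> C < u (finite_pt q)) ->
  forall p, ~ slit p -> p != y -> v (finite_pt p) <= u (finite_pt p).
Proof.
move=> sy [[vc vsub] vslit] uh uslit uy uinf p0 sp0 py0.
rewrite leNgt -subr_gt0; apply/negP => f0.
pose f q := v (finite_pt q) - u (finite_pt q).
set eps := f p0 in f0; have e2 : 0 < eps / 2 by rewrite divr_gt0.
pose S := [set q | [/\ ~ slit q, q != y & eps <= f q]].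
have cf q : ~ slit q -> q != y -> {for q, continuous f}.
  move=> sq qy; apply: cvgB.
    apply: (@continuous_comp _ _ _ (@finite_pt R) v).
      exact: one_point_compactification_some_continuous.
    by apply: vc; exact/cdomain_finite.
  have [[h _] _] := uh.
  exact: (C2_continuous (open_finite (@open_domain y)) h (iffRL (domain_finite y q) (conj sq qy))).
have vfc q : ~ slit q -> {for q, continuous (v \o @finite_pt R)}.
  move=> sq; apply: continuous_comp; first exact: one_point_compactification_some_continuous.
  by apply: vc; exact/cdomain_finite.
have cS : closed S.
  rewrite -[S]setCK; apply: open_closedC; rewrite openE => q Sq.
  have [[t et qE]|sq] := pselect (slit q).
    have h1 := uslit t et _ e2; have h2 := near_within (vslit t et _ e2).
    rewrite qE; apply: filterS2 h1 h2 => q' k1 k2 [sq' _]; apply/negP; rewrite -ltNge.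
    have := k1 sq'; have := k2 sq'; rewrite /f; move: (v _) (u _) (phi t) => a b c; clear; lra.
  have [qy|qy] := eqVneq q y.
    rewrite qy; have [d d0 hd] := locally_bounded (vfc y sy).
    have h1 := uy (`|(v \o @finite_pt R) y| + 1).
    have h2 : \forall q \near y, `|(v \o @finite_pt R) q| <= `|(v \o @finite_pt R) y| + 1.
      by apply/nbhs_ballP; exists d => //= q' [k1 k2]; apply: hd; rewrite distrC.
    apply: filterS2 h1 h2 => q' k1 k2 [sq' qy' k3].
    have := lt_le_trans f0 k3; rewrite /f subr_gt0 => k4.
    have := lt_trans (k1 qy') k4; rewrite ltNge => /negP; apply.
    exact: le_trans (ler_norm _) k2.
  have fq : f q < eps by rewrite ltNge; apply/negP => h; apply: Sq.
  have H : \forall q' \near q, f q' < eps by exact: cvgr_lt (cf q sq qy) _ fq.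
  by apply: filterS H => q' h [_ _]; rewrite leNgt h.
have [M SM] : exists M, forall q, S q -> modulus q <= M.
  have [M1 HM1] := continuous_infty (vc infty_pt (@cdomain_infty R e)) ltr01.
  have [M2 HM2] := uinf (`|v infty_pt| + 1).
  exists (Num.max M1 M2) => q [_ _ fq]; rewrite leNgt gt_max; apply/negP => /andP[k1 k2].
  have := lt_le_trans f0 fq; rewrite /f subr_gt0 => /(lt_trans (HM2 q k2)).
  have := HM1 q k1; have := ler_norm (v (finite_pt q) - v infty_pt); have := ler_norm (v infty_pt).
  move: (v _) (v _) => a b; set x := `|_|; set z := `|_|; clear; lra.
have Sc : compact S by exact: compact_plane SM.
have Sp0 : S p0 by split.
have fcS : {within S, continuous f}.
  by apply: continuous_in_subspaceT => q; rewrite inE => -[sq qy _]; exact: cf.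
have [z0 Sz0 z0max] := compact_EVT_max (ex_intro _ p0 Sp0) Sc fcS.
rewrite inE in Sz0.
pose T := [set q | S q /\ f z0 <= f q].
have cT : closed T.
  rewrite -[T]setCK; apply: open_closedC; rewrite openE => q Tq.
  have [Sq|Sq] := pselect (S q); last first.
    have := open_nbhs_nbhs (conj (closed_openC cS) Sq).
    by apply: filterS => q' Sq' [].
  have fq : f q < f z0 by rewrite ltNge; apply/negP => h; apply: Tq.
  have [sq qy _] := Sq.
  have H : \forall q' \near q, f q' < f z0 by exact: cvgr_lt (cf q sq qy) _ fq.
  by apply: filterS H => q' h [_]; rewrite leNgt h.
have Tc : compact T by apply: (compact_plane (M := M) cT) => q [/SM].
have cfst : {within T, continuous (fst : R * R -> R)}.
  by apply: continuous_subspaceT => q; exact: cvg_fst.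
(* Among the maximum points z1 has the largest abscissa. Constancy on a box around z1 yields one
   further to the right, so no connectedness of the whole domain is involved. *)
have [z1 Tz1 z1max] := compact_EVT_max (ex_intro _ z0 (conj Sz0 (lexx _)) : T !=set0) Tc cfst.
rewrite inE in Tz1; have [[sz1 z1y fz1] z1z0] := Tz1.
have fmax q : ~ slit q -> q != y -> f q <= f z1.
  move=> sq qy; have [h|h] := leP eps (f q).
    by apply: le_trans z1z0; apply: z0max; rewrite inE.
  exact: le_trans (ltW h) fz1.
have Dz1 : (@finite_pt R @^-1` domain y) z1 by exact/domain_finite.
have [d /= d0 hd] := iffLR (nbhs_ballP _ _) (open_nbhs_nbhs (conj (open_finite (@open_domain y)) Dz1)).
pose V := @finite_pt R @` ball z1 d.
have Vz1 : V (finite_pt z1) by exists z1 => //; exact: ballxx.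
have VD : V `<=` domain y by move=> _ [q /hd bq <-].
have rV : region V.
  split; first by exists (finite_pt z1).
    by apply: one_point_compactification_open_some; exact: ball_open.
  apply: connected_continuous_connected; first exact: connected_box.
  by apply: continuous_subspaceT; exact: one_point_compactification_some_continuous.
have VC : V `<=` cdomain e by move=> z /VD[[]].
have := vsub V u rV VC (harmonic_onS VD uh) (finite_pt z1) Vz1 _ (finite_pt (z1.1 + d / 2, z1.2)).
have d2 : 0 < d / 2 by rewrite divr_gt0.
have bz : ball z1 d (z1.1 + d / 2, z1.2).
  split; rewrite /ball /= ?subrr ?normr0 //.
  by rewrite opprD addrA subrr add0r normrN gtr0_norm // ltr_pdivrMr // ltr_pMr // ltr1n.
move=> H; have {}H : f (z1.1 + d / 2, z1.2) = f z1.
  apply: H; last by exists (z1.1 + d / 2, z1.2).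
  by move=> z' Vz'; have := VD z' Vz'; case: Vz' => q _ <- /domain_finite[]; exact: fmax.
have /domain_finite[sq qy] : domain y (finite_pt (z1.1 + d / 2, z1.2)) by exact: hd.
have : (z1.1 + d / 2, z1.2).1 <= z1.1.
  by apply: z1max; rewrite inE; split; rewrite ?H //; split; rewrite ?H.
by rewrite /= leNgt ltrDl d2.
Qed.

End perron_comparison.

Section perron_log.
Context {R : realType} (e : set R) (g : sphere R -> sphere R -> R).
Hypotheses (e_compact : compact e) (e_regular : regular e) (g_green : is_green e g).
Implicit Types (p q y z : R * R) (v : sphere R -> R).
Local Notation slit := (slit e).
Local Notation gp := (gp g).
Local Notation kern := (green_kern g).

Let inftyD : cdomain e infty_pt := @cdomain_infty R e.

Lemma harmonic_domain_infty y : harmonic_on (domain e y) (g^~ infty_pt).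
Proof.
have [h _ _ _] := g_green inftyD; apply: harmonic_onS h => z [[zD zi] _].
by split.
Qed.

Lemma harmonic_domain_finite y : ~ slit y -> harmonic_on (domain e y) (g^~ (finite_pt y)).
Proof.
move=> /cdomain_finite/g_green[h _ _ _]; apply: harmonic_onS h => z [[zD zi] zy].
by split.
Qed.

Let nslnd y : ~ domain e y infty_pt. Proof. by move=> [[_ h] _]; exact: h. Qed.
Let nslnd' y : ~ domain e y (finite_pt y). Proof. by move=> [_ h]; exact: h. Qed.

(** [kern y] has the boundary values log |t - y|; adding eps (g(., y) + g(., oo)) makes it tend to +
    oo at y and at infinity, as the comparison requires. *)
Lemma perron_le_kern y v p : ~ slit y -> y != (0, 0) ->
  perron_class e (fun t => lnd y (t, 0)) v -> ~ slit p -> p != y ->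
  v (finite_pt p) <= kern y p.
Proof.
move=> sy y0 vP sp py.
have py' : y != p by rewrite eq_sym.
rewrite -subr_ge0; apply: (@eps_limit _ _ (gp (finite_pt y) p + gp infty_pt p)) => eps eps0.
pose u := (slnd y \+ (fun z : sphere R => (eps - 1) * g z infty_pt)) \+
  (fun z : sphere R => (1 + eps) * g z (finite_pt y)).
have oD := @open_domain _ e e_compact y.
have uE q : u (finite_pt q) = kern y q + eps * (gp (finite_pt y) q + gp infty_pt q).
  by rewrite /u /green_kern /=; rewrite -/(gp infty_pt q) -/(gp (finite_pt y) q); ring.
have uh : harmonic_on (domain e y) u.
  apply: (harmonic_onD oD); last exact: (harmonic_onZ _ oD (harmonic_domain_finite sy)).
  apply: (harmonic_onD oD); last exact: (harmonic_onZ _ oD (@harmonic_domain_infty y)).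
  by apply: harmonic_on_slnd => //; (exact: nslnd || exact: nslnd').
suff : v (finite_pt p) <= u (finite_pt p).
  rewrite uE -subr_ge0 => /le_trans; apply.
  by rewrite le_eqVlt; apply/orP; left; apply/eqP; ring.
apply: (perron_comparison e_compact sy vP uh) => //.
- move=> t et d d0.
  have ty : (t, 0) != y by apply/eqP => ty; apply: sy; exists t.
  apply: filterS2 (kern_slit e_regular g_green sy et d0) (near_neq ty) => q h qy sq.
  have := h sq; rewrite ltr_norml uE => /andP[h1 _].
  have g1 := gp_ge0 e_compact e_regular g_green sy sq qy.
  have g2 := gp_infty_ge0 e_compact e_regular g_green sq.
  have g3 : 0 <= eps * (gp (finite_pt y) q + gp infty_pt q).
    by rewrite mulr_ge0 ?(ltW eps0) // addr_ge0.
  by rewrite ltrBlDr; move: h1; rewrite ltrBrDr => h1; lra.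
- move=> C.
  have b : bd_at ((kern y \+ (fun q => eps * gp infty_pt q)) \+
      ((fun q => eps * (gp (finite_pt y) \+ lnd y) q) \+ cst (- C))) y.
    apply: bd_atD; apply: bd_atD.
    - exact: (kern_bd_at e_compact g_green sy sy).
    - apply: bd_atZ; apply: bd_at_continuous.
      by apply: (gp_continuous e_compact g_green inftyD sy).
    - by apply: bd_atZ; exact: (gp_pole g_green sy).
    - by apply: bd_at_continuous; exact: cvg_cst.
  apply: filterS (pole_pos eps0 b) => q hq /hq h; rewrite uE -subr_gt0.
  by move: h => /=; congr (0 < _); ring.
- move=> C.
  have b : bd_inf ((kern y \+ (fun q => eps * (gp infty_pt q - ln (modulus q)))) \+
      ((fun q => eps * gp (finite_pt y) q) \+ cst (- C))).
    apply: bd_infD; apply: bd_infD.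
    - exact: (kern_bd_inf e_compact g_green sy).
    - by apply: bd_infZ; exact: (gp_pole_infty g_green).
    - by apply: bd_infZ; exact: (gp_bd_inf e_compact g_green sy).
    - by exists `|- C|, 0 => q _.
  have [K HK] := infty_pos eps0 b.
  exists K => q /HK h; rewrite uE -subr_gt0.
  by move: h => /=; congr (0 < _); ring.
Qed.

(** The majorant is - kern y + g(., y): it has the boundary values - log |t - y|, tends to + oo at
    y, and is bounded near infinity, where eps g(., oo) is added. *)
Lemma perron_opp_le_kern y v p : ~ slit y -> y != (0, 0) ->
  perron_class e (fun t => - lnd y (t, 0)) v -> ~ slit p -> p != y ->
  v (finite_pt p) <= gp infty_pt p - lnd y p.
Proof.
move=> sy y0 vP sp py.
rewrite -subr_ge0; apply: (@eps_limit _ _ (gp infty_pt p)) => eps eps0.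
pose u := (fun z : sphere R => (-1) * slnd y z) \+ (fun z : sphere R => (1 + eps) * g z infty_pt).
have oD := @open_domain _ e e_compact y.
have uE q : u (finite_pt q) = gp infty_pt q - lnd y q + eps * gp infty_pt q.
  by rewrite /u /=; rewrite -/(gp infty_pt q); ring.
have uh : harmonic_on (domain e y) u.
  apply: (harmonic_onD oD); last exact: (harmonic_onZ _ oD (@harmonic_domain_infty y)).
  apply: (harmonic_onZ _ oD).
  by apply: harmonic_on_slnd => //; (exact: nslnd || exact: nslnd').
suff : v (finite_pt p) <= u (finite_pt p).
  rewrite uE -subr_ge0 => /le_trans; apply.
  by rewrite le_eqVlt; apply/orP; left; apply/eqP; ring.
apply: (perron_comparison e_compact sy vP uh) => //.
- move=> t et d d0; have d2 : 0 < d / 2 by rewrite divr_gt0.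
  have ty : (t, 0) != y by apply/eqP => ty; apply: sy; exists t.
  have h3 : \forall q \near ((t, 0) : R * R), `|lnd y (t, 0) - lnd y q| < d.
    exact: cvgr_dist_lt (continuous_lnd ty) _ d0.
  apply: filterS h3 => q h sq; rewrite uE.
  have g2 := gp_infty_ge0 e_compact e_regular g_green sq.
  have g3 : 0 <= eps * gp infty_pt q by rewrite mulr_ge0 ?(ltW eps0).
  by move: h; rewrite ltr_norml => /andP[h1 _]; lra.
- move=> C.
  have b : bd_at ((fun q => (1 + eps) * gp infty_pt q) \+ cst (- C)) y.
    apply: bd_at_continuous; apply: cvgD; last exact: cvg_cst.
    apply: cvgM; first exact: cvg_cst.
    by apply: (gp_continuous e_compact g_green inftyD sy).
  apply: filterS (pole_pos ltr01 b) => q hq /hq h; rewrite uE -subr_gt0.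
  by move: h => /=; congr (0 < _); ring.
- move=> C.
  have b : bd_inf ((fun q => (1 + eps) * (gp infty_pt q - ln (modulus q))) \+
      ((fun q => (-1) * (lnd y q - ln (modulus q))) \+ cst (- C))).
    apply: bd_infD; last apply: bd_infD.
    - by apply: bd_infZ; exact: (gp_pole_infty g_green).
    - apply: bd_infZ; have [M _ HM] := lnd_infty (modulus y) (@ltr01 R).
      by exists 1, M => q /HM; apply.
    - by exists `|- C|, 0 => q _.
  have [K HK] := infty_pos eps0 b.
  exists K => q /HK h; rewrite uE -subr_gt0.
  by move: h => /=; congr (0 < _); ring.
Qed.

Lemma perron_le (phi : R -> R) (z0 : sphere R) (C : R) : perron_class e phi !=set0 ->
  (forall v, perron_class e phi v -> v z0 <= C) -> perron e phi z0 <= C.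
Proof.
move=> [v0 v0P] vC; apply: ge_sup; first by exists (v0 z0), v0.
by move=> _ [v vP <-]; exact: vC.
Qed.

(** The kernel at x contains g(x, y); symmetry turns it into g(y, x), the Green function with its
    pole at the given point. *)
Lemma perron_log_finite y (x : R) : ~ slit y -> y != (0, 0) -> ~ e x -> y != (x, 0) ->
  perron_class e (fun t => lnd y (t, 0)) !=set0 ->
  perron e (fun t => lnd y (t, 0)) (real_pt x) <=
  lnd y (x, 0) - g (real_pt x) infty_pt + g (finite_pt y) (real_pt x).
Proof.
move=> sy y0 ex yx ne; have sx : ~ slit (x, 0) by move=> [t et [xt]]; apply: ex; rewrite xt.
have xy : (x, 0) != y by rewrite eq_sym.
apply: perron_le => // v vP; apply: (le_trans (perron_le_kern sy y0 vP sx xy)).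
rewrite /green_kern lerD2l.
exact: (green_sym_le e_compact e_regular g_green sy sx xy).
Qed.

(* Combining two kernels makes the unknown Robin constant cancel: their
   extensions are subtracted at infinity. *)
Lemma perron_log_infty y y' : ~ slit y -> y != (0, 0) -> ~ slit y' -> y' != (0, 0) ->
  perron_class e (fun t => lnd y (t, 0)) !=set0 ->
  perron_class e (fun t => - lnd y' (t, 0)) !=set0 ->
  perron e (fun t => lnd y (t, 0)) infty_pt +
  perron e (fun t => - lnd y' (t, 0)) infty_pt <= g (finite_pt y) infty_pt.
Proof.
move=> sy y0 sy' y'0 ne ne'.
suff H v v' : perron_class e (fun t => lnd y (t, 0)) v ->
    perron_class e (fun t => - lnd y' (t, 0)) v' ->
    v infty_pt + v' infty_pt <= g (finite_pt y) infty_pt.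
  rewrite -lerBrDr; apply: perron_le => // v vP.
  rewrite lerBrDr addrC -lerBrDr; apply: perron_le => // v' v'P.
  by rewrite lerBrDr addrC; exact: H.
move=> vP v'P; apply: le_trans (green_sym_infty e_compact e_regular g_green sy).
apply/ler_addgt0Pr => eps eps0; have e5 : 0 < eps / 5 by rewrite divr_gt0.
have [[vc _] _] := vP; have [[v'c _] _] := v'P.
have [K1 H1] := continuous_infty (vc infty_pt inftyD) e5.
have [K2 H2] := continuous_infty (v'c infty_pt inftyD) e5.
have [K3 H3] := g_infty_continuous e_compact g_green sy e5.
have [K4 _ H4] := lnd_infty (Num.max (modulus y) (modulus y')) e5.
have [M HM] := bounded_modulus (compact_slit e_compact).
have [z] := exists_modulus (Num.max (Num.max (Num.max K1 K2) (Num.max K3 K4))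
   (Num.max M (Num.max (modulus y) (modulus y')))).
rewrite !gt_max => /andP[/andP[/andP[z1 z2] /andP[z3 z4]] /andP[z5 /andP[z6 z7]]].
have sz : ~ slit z by move=> /HM; rewrite leNgt z5.
have zy : z != y by apply: contraTneq z6 => ->; rewrite ltxx.
have zy' : z != y' by apply: contraTneq z7 => ->; rewrite ltxx.
have h1 := perron_le_kern sy y0 vP sz zy.
have h2 := perron_opp_le_kern sy' y'0 v'P sz zy'.
have h3 := H4 z y z4 ltac:(by rewrite le_max lexx).
have h4 := H4 z y' z4 ltac:(by rewrite le_max lexx orbT).
have h5 := H1 z z1; have h6 := H2 z z2; have h7 := H3 z z3.
rewrite /green_kern in h1.
move: h1 h2 h3 h4 h5 h6 h7; rewrite !(ler_norml, ltr_norml).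
move=> h1 h2 /andP[_ h3] /andP[h4 _] /andP[h5 _] /andP[h6 _] /andP[_ h7].
lra.
Qed.

End perron_log.

(** * Harmonic measure *)

Section harmonic_measure.
Context {R : realType} (e : set R) (z : sphere R)
  (omega : probability (measurableTypeR R) R).
Hypotheses (e_compact : compact e) (om : is_harmonic_measure e z omega).

Lemma measurable_e : measurable (e : set (measurableTypeR R)).
Proof. exact: compact_measurable. Qed.

Lemma within_measurable (f : R -> R) : {within e, continuous f} ->
  measurable_fun (e : set (measurableTypeR R)) f.
Proof. exact: (subspace_continuous_measurable_fun measurable_e). Qed.

(** The defining identity of harmonic measure, applied to |f|, equates the integral of |f| with a
    real number. *)
Lemma within_integrable (f : R -> R) : {within e, continuous f} ->
  omega.-integrable e (EFin \o f).
Proof.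
move=> cf; apply/integrableP; split.
  by apply/measurable_EFinP; exact: within_measurable.
have cn : {within e, continuous (fun t => `|f t|)}.
  by move=> t; apply: cvg_norm; exact: cf.
have := om.2 _ cn; under eq_integral do rewrite -abse_EFin.
by move=> ->; rewrite ltry.
Qed.

Lemma perron_mean : mean e (fun phi => perron e phi z).
Proof.
have mE := measurable_e.
split=> [f g cf cg|k f cf|f g cf cg fg|].
- apply: EFin_inj; rewrite EFinD -!om.2 //.
    by rewrite -integralD //; exact: within_integrable.
  by move=> t; apply: cvgD; [exact: cf|exact: cg].
- apply: EFin_inj; rewrite EFinM -!om.2 //.
    by rewrite -integralZl //; exact: within_integrable.
  by move=> t; apply: cvgM; [exact: cvg_cst|exact: cf].
- rewrite -lee_fin -!om.2 //; apply: le_integral => //; try exact: within_integrable.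
  by move=> t; rewrite inE => /fg; rewrite lee_fin.
apply: EFin_inj; rewrite -om.2; last exact: within_continuous_cst.
transitivity (1%:E * omega e)%E; last by rewrite om.1 mul1e.
by rewrite -(@integral_cst _ _ _ omega e mE 1%:E).
Qed.

(** The Perron value of the constant 1 is 1, whereas the supremum of an empty set is 0 by
    convention; so the class of 1 has an element, and a translate of it lies in the class of phi. *)
Lemma perron_class_neq0 (phi : R -> R) (m : R) :
  (forall t, e t -> m <= phi t) -> perron_class e phi !=set0.
Proof.
move=> mphi.
have [v vP] : perron_class e (cst 1) !=set0.
  apply/set0P/eqP => E.
  have [_ _ _] := perron_mean; rewrite /perron E image_set0 sup0 => /esym/eqP.
  by rewrite oner_eq0.
have [[vc vsub] vslit] := vP.
(* Near e, v < 1 + 1, hence v + (m - 2) < m <= phi. *)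
pose c := m - 2; exists (fun y => v y + c); split; first split.
- move=> y yD; have cv : v @ y --> v y := vc y yD.
  exact: (cvgD cv (cvg_cst c)).
- move=> V u rV VD uh y Vy ymax y' Vy'.
  have oV : open V by have [] := rV.
  have ch : harmonic_on V (cst (- c)).
    split; first exact: plane_harmonic_cst (open_finite oV).
    exact: plane_harmonic_cst (open_chart oV).
  have E w : v w - (u \+ cst (- c)) w = v w + c - u w by rewrite /=; ring.
  have := vsub V _ rV VD (harmonic_onD oV uh ch) y Vy; rewrite !E => /(_ _ y' Vy').
  by rewrite E; apply => w Vw; rewrite E; exact: ymax.
- move=> t et eps eps0; apply: filterS (vslit t et _ (@ltr01 R)) => y.
  by rewrite /cst /c; have := mphi t et; lra.
Qed.

End harmonic_measure.

(** * Coordinates sending the pole to infinity *)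

Lemma sphere_cvg {R : realType} (z : sphere R) (f : sphere R -> R) :
  (forall eps, 0 < eps -> \forall z' \near z, `|f z - f z'| < eps) ->
  {for z, continuous f}.
Proof.
move=> h P /nbhs_ballP[eps /= eps0 hP].
by apply: filterS (h eps eps0) => z' hz'; apply: hP.
Qed.

Section coordinates.
Context {R : realType} (e : set R) (g : sphere R -> sphere R -> R) (x : xreal R).
Hypotheses (e_compact : compact e) (e_regular : regular e) (g_green : is_green e g)
  (xe : xcompl e x).
Implicit Types (p q y : R * R) (z : sphere R).
Local Notation slit := (slit e).

(* The coordinate tau = 1 / (x - t) sends a finite x to infinity; when x is
   infinite, tau = t. *)
Definition to_coord (t : R) : R := if x is Some t0 then (t0 - t)^-1 else t.
Definition coord_weight (t : R) : R := if x is Some t0 then `|t0 - t| else 1.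
(** The inverse coordinate on the whole plane: tau = 1 / (t0 - t) gives t = t0 - 1 / tau, with tau =
    0 at infinity. *)
Definition of_coord p : sphere R :=
  if x is Some t0 then if p == (0, 0) then infty_pt else finite_pt ((t0, 0) - inv_pt p)
  else finite_pt p.

(** The values of g on e are unconstrained; with the value 0 there, regularity makes the function
    continuous up to e, and [green_coord] is continuous on the whole plane because the pole is sent
    to infinity. *)
Definition green_ext z : R := if pselect (cdomain e z) then g z (xreal_pt x) else 0.
Definition green_coord p : R := green_ext (of_coord p).

Lemma xcompl_neq (t0 t : R) : x = Some t0 -> e t -> t0 - t != 0.
Proof.
move=> xt et; rewrite subr_eq0; apply/eqP => t0t; apply: xe.
by exists t => //; rewrite xt t0t.
Qed.

Lemma pole_domain : cdomain e (xreal_pt x).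
Proof.
case: x xe => [t0|] h; last exact: cdomain_infty.
by move=> [t et [tt0]]; apply: h; exists t => //; rewrite tt0.
Qed.

Lemma coord_weight_gt0 t : e t -> 0 < coord_weight t.
Proof.
by rewrite /coord_weight; case E : x => [t0|] // et; rewrite normr_gt0 (xcompl_neq E).
Qed.

Lemma inv_pt_real (c : R) : c != 0 -> inv_pt (c, 0) = (c^-1, 0).
Proof.
move=> c0; rewrite /inv_pt /=; congr (_, _); last by rewrite oppr0 mul0r.
by rewrite sqr_modulus /= expr0n addr0 expr2 invfM mulrA divff // mul1r.
Qed.

Lemma to_coordK t : e t -> of_coord (to_coord t, 0) = real_pt t.
Proof.
rewrite /of_coord /to_coord; case E : x => [t0|] // et.
have n0 := xcompl_neq E et; have n1 : (t0 - t)^-1 != 0 by rewrite invr_eq0.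
rewrite xpair_eqE (negbTE n1) /= inv_pt_real // invrK /real_pt.
by congr (Some (_, _)); rewrite /= ?subr0 // opprB addrC subrK.
Qed.

Lemma of_coord_neq p : of_coord p != xreal_pt x.
Proof.
rewrite /of_coord; case E : x => [t0|] //=.
have [//|p0] := eqVneq p (0, 0).
apply/eqP => -[] h1 h2; have := inv_pt_neq0 p0; apply/negP; rewrite negbK.
have a1 : p.1 / modulus p ^+ 2 = 0.
  by apply/eqP; rewrite -oppr_eq0; apply/eqP; move: h1; rewrite -[RHS]addr0 => /addrI.
have a2 : - p.2 / modulus p ^+ 2 = 0.
  by apply/eqP; rewrite -oppr_eq0; apply/eqP; move: h2; rewrite add0r.
by rewrite /inv_pt a1 a2.
Qed.

Lemma of_coord_continuous : continuous of_coord.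
Proof.
rewrite /of_coord; case E : x => [t0|]; last exact: one_point_compactification_some_continuous.
have key p : p != (0, 0) -> {for p, continuous (fun p => finite_pt ((t0, 0) - inv_pt p))}.
  move=> p0; apply: (@continuous_comp _ _ _ (fun p => (t0, 0) - inv_pt p) (@finite_pt R)); last first.
    exact: one_point_compactification_some_continuous.
  apply: cvgB; first exact: cvg_cst.
  have m0 : modulus p ^+ 2 != 0 by rewrite expf_neq0 // gt_eqF // modulus_gt0.
  have cV : (modulus q ^+ 2)^-1 @[q --> p] --> (modulus p ^+ 2)^-1.
    apply: cvgV => //; under eq_fun do rewrite sqr_modulus.
    by rewrite sqr_modulus; exact: sqr_sum_continuous.
  have c1 : q.1 / modulus q ^+ 2 @[q --> p] --> p.1 / modulus p ^+ 2.
    by apply: cvgM cV; exact: cvg_fst.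
  have c2 : - q.2 / modulus q ^+ 2 @[q --> p] --> - p.2 / modulus p ^+ 2.
    by apply: cvgM cV; apply: cvgN; exact: cvg_snd.
  exact: cvg_pair c1 c2.
move=> p; have [->|p0] := eqVneq p (0, 0).
  move=> P; rewrite {1}eqxx => NP.
  have [M MP] := near_inftyP NP.
  have M1 : 0 < `|M| + `|t0| + 1 by rewrite ltr_wpDl // addr_ge0.
  have : \forall q \near ((0, 0) : R * R), modulus q < (`|M| + `|t0| + 1)^-1.
    have := @modulus_continuous R (0, 0).
    rewrite /continuous_at {2}/modulus /= expr0n addr0 sqrtr0 => h.
    by apply: cvgr_lt h _ _; rewrite invr_gt0.
  apply: filterS => q qM.
  change (P (if q == (0, 0) then infty_pt else finite_pt ((t0, 0) - inv_pt q))).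
  have [_|q0] := eqVneq q (0, 0); first exact: (nbhs_singleton NP).
  apply: MP; have m0 := modulus_gt0 q0.
  have h1 : `|M| + `|t0| + 1 <= modulus (inv_pt q).
    by rewrite modulus_inv // -[leLHS]invrK lef_pV2 ?posrE ?invr_gt0 // ltW.
  have h2 := modulus_dist (inv_pt q) (t0, 0); rewrite modulusBC in h2.
  have h3 := le_trans (ler_norm _) h2.
  have h4 : modulus ((t0, 0) : R * R) = `|t0| by rewrite /modulus /= expr0n addr0 sqrtr_sqr.
  by rewrite h4 in h3; have := ler_norm M; lra.
have nE : \forall q \near p, finite_pt ((t0, 0) - inv_pt q) =
    (if q == (0, 0) then infty_pt else finite_pt ((t0, 0) - inv_pt q)).
  have : \forall q \near p, q != (0, 0) by exact: near_neq.
  by apply: filterS => q /negbTE ->.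
rewrite /continuous_at -(nbhs_singleton nE).
exact: cvg_trans (near_eq_cvg nE) (key p p0).
Qed.

Lemma green_ext_continuous z : z <> xreal_pt x -> {for z, continuous green_ext}.
Proof.
have pD := pole_domain; have oD := open_cdomain e_compact.
move=> zx; have [zD|zD] := pselect (cdomain e z); last first.
  have [t et tz] : exists2 t, e t & z = real_pt t.
    by move/contrapT : zD => [t et <-]; exists t.
  apply: sphere_cvg => eps eps0 /=.
  have -> : green_ext z = 0 by rewrite /green_ext; case: pselect => // ?; exfalso.
  have [_ _ _ h] := g_green pD; have := h t et (e_regular et).
  move=> hc.
  have H : \forall z' \near within (cdomain e) (nbhs (real_pt t)),
      `|0 - g z' (xreal_pt x)| < eps by exact: cvgr_dist_lt hc _ eps0.
  have H' : \forall z' \near z, cdomain e z' -> `|0 - g z' (xreal_pt x)| < eps.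
    by rewrite tz; exact: H.
  apply: filterS H' => z' hz'; rewrite /green_ext; case: pselect => [z'D|nD] /=.
    exact: (hz' z'D).
  by rewrite subrr normr0.
have nE : \forall z' \near z, g z' (xreal_pt x) = green_ext z'.
  apply: filterS (open_nbhs_nbhs (conj oD zD)) => z' z'D.
  by rewrite /green_ext; case: pselect.
suff c : {for z, continuous (g^~ (xreal_pt x))}.
  have H : green_ext @ z --> g z (xreal_pt x) by exact: cvg_trans (near_eq_cvg nE) c.
  by rewrite (nbhs_singleton nE) in H.
case: z zx zD {nE} => [p|] zx zD.
  have sp : ~ slit p by apply/cdomain_finite.
  have c := gp_continuous e_compact g_green pD sp zx.
  by move=> P NP; exact: (c P NP).
case E : x zx => [t0|] zx; last by exfalso; exact: zx.
have st : ~ slit (t0, 0).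
  by move=> [t et [tt0]]; apply: xe; exists t => //; rewrite E tt0.
apply: sphere_cvg => eps eps0 /=.
have [M HM] := g_infty_continuous e_compact g_green st eps0.
apply: (infty_near (M := M)) => [|q Mq] /=; first by rewrite subrr normr0.
by rewrite distrC; exact: HM.
Qed.

Lemma green_coord_continuous : continuous green_coord.
Proof.
move=> p; apply: (@continuous_comp _ _ _ of_coord green_ext).
  exact: of_coord_continuous.
by apply: green_ext_continuous; apply/eqP; exact: of_coord_neq.
Qed.

(** Compactness of [a, b] and continuity along the real axis give one height tau for all rho. *)
Lemma green_coord_unif (a b eps : R) : 0 < eps ->
  exists2 tau, 0 < tau & forall rho, a <= rho <= b ->
    green_coord (rho, tau) <= green_coord (rho, 0) + eps.
Proof.
move=> eps0; have e2 : 0 < eps / 2 by rewrite divr_gt0.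
pose P (tau rho : R) := green_coord (rho, tau) <= green_coord (rho, 0) + eps.
have cov : compact `[a, b]%classic by exact: segment_compact.
have H : \forall tau \near 0^'+, `[a, b]%classic `<=` P tau.
  apply: (iffLR (@compact_near_coveringP _ _) cov) => rho0 _; pose rho : R := rho0; rewrite -[rho0]/rho.
  have c : {for (rho, 0), continuous green_coord} := @green_coord_continuous (rho, 0).
  have n : \forall q \near ((rho, 0) : R * R), `|green_coord (rho, 0) - green_coord q| < eps / 2.
    exact: cvgr_dist_lt c _ e2.
  have [d d0 hd] := near_plane n.
  exists (ball rho d, [set tau : R | 0 < tau < d]); first split.
  - exact: nbhsx_ballx.
  - near=> tau; apply/andP; split; first by near: tau; exact: nbhs_right_gt.
    by near: tau; exact: nbhs_right_lt.
  move=> [rho' tau] /= [br /andP[t0 td]]; rewrite /P.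
  have b1 : `|rho' - rho| < d by rewrite distrC.
  have h1 := hd (rho', tau) b1 ltac:(by rewrite /= subr0 gtr0_norm).
  have h2 := hd (rho', 0) b1 ltac:(by rewrite /= subrr normr0).
  move: h1 h2; rewrite !ltr_norml => /andP[h1 h1'] /andP[h2 h2']; lra.
have H0 : \forall tau \near (0:R)^'+, 0 < tau by exact: nbhs_right_gt.
have [tau [t0 Ht]] := filter_ex (filterI H0 H).
by exists tau => // rho rI; apply: Ht; rewrite /= in_itv.
Unshelve. all: by end_near. Qed.

End coordinates.

Lemma within_eq_continuous {R : realType} (e : set R) (f h : R -> R) :
  (forall t, e t -> f t = h t) -> {within e, continuous f} -> {within e, continuous h}.
Proof.
by move=> fh; apply: subspace_eq_continuous => t; rewrite inE => /fh.
Qed.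

(** * Means of log distances in the coordinate tau *)

Section log_means.
Context {R : realType} (e : set R) (g : sphere R -> sphere R -> R) (x : xreal R)
  (omega : probability (measurableTypeR R) R).
Hypotheses (e_compact : compact e) (e_regular : regular e) (g_green : is_green e g)
  (xe : xcompl e x) (omega_hm : is_harmonic_measure e (xreal_pt x) omega).
Implicit Types (p q y : R * R) (z : sphere R).
Local Notation slit := (slit e).
Local Notation L := (fun phi => perron e phi (xreal_pt x)).

Let ML : mean e L := perron_mean e_compact omega_hm.

Lemma mean_eq (f h : R -> R) : {within e, continuous f} ->
  (forall t, e t -> f t = h t) -> L f = L h.
Proof.
have [_ _ Lm _] := ML => cf fh; have ch := within_eq_continuous fh cf.
by apply/eqP; rewrite eq_le; apply/andP; split; apply: Lm => // t et; rewrite fh.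
Qed.

Lemma nonreal_off_slit y : y.2 != 0 -> ~ slit y.
Proof. by move=> y0 [t et yE]; move: y0; rewrite yE eqxx. Qed.

Lemma nonreal_neq0 y : y.2 != 0 -> y != (0, 0).
Proof. by apply: contraNneq => ->. Qed.

Lemma lnd_line_continuous y : y.2 != 0 -> continuous (fun t : R => lnd y (t, 0)).
Proof.
move=> y0 t; apply: (@continuous_comp _ _ _ (fun t : R => modulus ((t, 0) - y)) (@ln R)).
  apply: (@continuous_comp _ _ _ (fun t : R => (t, 0) - y) (@modulus R)); last exact: modulus_continuous.
  apply: (@cvgB _ (R * R)%type); last exact: cvg_cst.
  exact: cvg_pair (@cvg_id _ (nbhs t)) (cvg_cst (0 : R)).
apply: continuous_ln; apply: modulus_sub_gt0.
by apply/eqP => E; move: y0; rewrite -E eqxx.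
Qed.

Lemma lnd_class_neq0 y : y.2 != 0 -> perron_class e (fun t => lnd y (t, 0)) !=set0.
Proof.
move=> y0; apply: (perron_class_neq0 e_compact omega_hm (m := ln `|y.2|)) => t et.
rewrite /lnd ler_ln ?posrE ?normr_gt0 //.
  by rewrite (le_trans _ (modulus_ge2 _)) //= add0r normrN.
by apply: modulus_sub_gt0; apply/eqP => E; move: y0; rewrite -E eqxx.
Qed.

Lemma lnd_opp_class_neq0 y : y.2 != 0 -> perron_class e (fun t => - lnd y (t, 0)) !=set0.
Proof.
move=> y0; have [M HM] := bounded_slit e_compact.
apply: (perron_class_neq0 e_compact omega_hm (m := - ln (M + modulus y))) => t et.
have p0 : 0 < modulus ((t, 0) - y).
  by apply: modulus_sub_gt0; apply/eqP => E; move: y0; rewrite -E eqxx.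
have h : modulus ((t, 0) - y) <= M + modulus y.
  rewrite (le_trans (modulusD _ _)) // modulusN lerD2r.
  by rewrite /modulus /= expr0n addr0 sqrtr_sqr HM.
by rewrite lerN2 /lnd ler_ln ?posrE //; exact: lt_le_trans p0 h.
Qed.

Lemma dist2_modulus p t : dist2 p t = modulus ((t, 0) - p).
Proof. by rewrite /dist2 /modulus /= add0r sqrrN. Qed.

Lemma log_coord_infty p t : x = None ->
  ln (coord_weight x t * dist2 p (to_coord x t)) = lnd p (t, 0).
Proof. by move=> ->; rewrite /coord_weight /to_coord mul1r dist2_modulus. Qed.

(** |t0 - t| |1 / (t0 - t) - p| = |1 - p (t0 - t)| = |p| |t - (t0 - 1/p)|. *)
Lemma log_coord_finite t0 p t : x = Some t0 -> 0 < p.2 -> e t ->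
  ln (coord_weight x t * dist2 p (to_coord x t))
  = ln (modulus p) + lnd ((t0, 0) - inv_pt p) (t, 0).
Proof.
move=> xt p0 et; have d0 := xcompl_neq xe xt et.
have p00 : p != (0, 0) by apply: nonreal_neq0; rewrite gt_eqF.
have m0 := modulus_gt0 p00.
have y2 : ((t, 0) - ((t0, 0) - inv_pt p)).2 != 0.
  rewrite /= !sub0r opprK mulNr oppr_eq0.
  by rewrite mulf_neq0 ?invr_eq0 ?expf_neq0 ?gt_eqF.
have m1 : 0 < modulus ((t, 0) - ((t0, 0) - inv_pt p)).
  by apply: modulus_gt0; exact: nonreal_neq0.
rewrite /lnd -lnM ?posrE //; congr ln; rewrite xt /coord_weight /to_coord.
apply/eqP; rewrite -(@eqrXn2 _ 2) // ?mulr_ge0 ?modulus_ge0 ?sqrtr_ge0 //; apply/eqP.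
rewrite !exprMn real_normK ?num_real // sqr_sqrtr ?addr_ge0 ?sqr_ge0 //.
have E : modulus p ^+ 2 = p.1 ^+ 2 + p.2 ^+ 2 := sqr_modulus p.
rewrite /inv_pt E sqr_modulus /=; have : p.1 ^+ 2 + p.2 ^+ 2 != 0.
  by rewrite -E expf_neq0 // gt_eqF.
move: d0; set a := p.1; set b := p.2; move=> d0 h; field; exact/andP.
Qed.

Lemma log_coord_continuous p : 0 < p.2 ->
  {within e, continuous (fun t => ln (coord_weight x t * dist2 p (to_coord x t)))}.
Proof.
move=> p0; case E : x => [t0|].
  pose y := (t0, 0) - inv_pt p.
  have y2 : y.2 != 0.
    rewrite /= sub0r mulNr opprK mulf_neq0 ?invr_eq0 ?expf_neq0 ?gt_eqF //.
    by apply: modulus_gt0; apply: nonreal_neq0; rewrite gt_eqF.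
  apply: (@within_eq_continuous _ _ (fun t => ln (modulus p) + lnd y (t, 0))).
    by move=> t et; rewrite -E (log_coord_finite E p0 et).
  apply: continuous_subspaceT => t; apply: cvgD; first exact: cvg_cst.
  exact: lnd_line_continuous.
apply: (@within_eq_continuous _ _ (fun t => lnd p (t, 0))).
  by move=> t et; rewrite -E log_coord_infty.
by apply: continuous_subspaceT; apply: lnd_line_continuous; rewrite gt_eqF.
Qed.

(** With y = t0 - 1/p, the term log |t0 - y| = - log |p| of [perron_log_finite] cancels the factor
    |p| from the change of coordinate. *)
Lemma log_mean_finite t0 p : x = Some t0 -> 0 < p.2 ->
  L (fun t => ln (coord_weight x t * dist2 p (to_coord x t)))
  <= green_coord e g x p - g (real_pt t0) infty_pt.
Proof.
move=> xt p0; pose y := (t0, 0) - inv_pt p.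
have p00 : p != (0, 0) by apply: nonreal_neq0; rewrite gt_eqF.
have y2 : y.2 != 0.
  rewrite /= sub0r mulNr opprK mulf_neq0 ?invr_eq0 ?expf_neq0 ?gt_eqF //.
  exact: modulus_gt0.
have cy : {within e, continuous (fun t => lnd y (t, 0))}.
  by apply: continuous_subspaceT; exact: lnd_line_continuous.
rewrite (mean_eq (log_coord_continuous p0) (h := cst (ln (modulus p)) \+ (fun t => lnd y (t, 0)))); last first.
  by move=> t et; rewrite (log_coord_finite xt p0 et).
have [LD _ _ _] := ML; rewrite LD //; last exact: within_continuous_cst.
rewrite (mean_cst _ ML).
have sy := nonreal_off_slit y2.
have et0 : ~ e t0 by move=> et0; apply: xe; exists t0.
have yt0 : y != (t0, 0) by apply/eqP => E; move: y2; rewrite E eqxx.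
have := perron_log_finite e_compact e_regular g_green sy (nonreal_neq0 y2) et0 yt0 (lnd_class_neq0 y2).
have -> : lnd y (t0, 0) = - ln (modulus p).
  rewrite /lnd /y opprB addrC subrK modulus_inv // lnV // posrE; exact: modulus_gt0.
have -> : green_coord e g x p = g (finite_pt y) (real_pt t0).
  rewrite /green_coord /of_coord xt (negbTE p00) /green_ext; case: pselect => //= h.
  by exfalso; apply: h; apply/cdomain_finite.
by rewrite xt /=; lra.
Qed.

(** G is the supremum over the upper half-plane of the means of - log |t - y|, and serves as the
    Robin constant. By [perron_log_infty] each of these means plus that of log |t - p| is at most
    g(p, oo), which bounds the supremum and gives the first property; the second feeds the estimate
    of the capacity. *)
Lemma log_mean_infty : x = None -> exists G : R,
  (forall p, 0 < p.2 ->
    L (fun t => ln (coord_weight x t * dist2 p (to_coord x t)))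
      <= green_coord e g x p - G) /\
  (forall y, 0 < y.2 -> - L (fun t => lnd y (t, 0)) <= G).
Proof.
move=> xn.
have neq0 y : 0 < y.2 -> y.2 != 0 by move=> h; rewrite gt_eqF.
pose S := [set L (fun t => - lnd y (t, 0)) | y in [set y : R * R | 0 < y.2]].
have key p y : 0 < p.2 -> 0 < y.2 ->
    L (fun t => lnd p (t, 0)) + L (fun t => - lnd y (t, 0)) <= g (finite_pt p) infty_pt.
  move=> /neq0 p0 /neq0 y0; rewrite xn /=; apply: perron_log_infty => //;
  by [exact: nonreal_off_slit|exact: nonreal_neq0|exact: lnd_class_neq0|exact: lnd_opp_class_neq0].
have i0 : 0 < ((0, 1) : R * R).2 by rewrite /=.
have supS : has_sup S.
  split; first by exists (L (fun t => - lnd (0, 1) (t, 0))); exists (0, 1).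
  exists (g (finite_pt (0, 1)) infty_pt - L (fun t => lnd (0, 1) (t, 0))).
  by move=> _ [y y0 <-]; have := key _ _ i0 y0; lra.
exists (sup S); split=> [p p0|y y0].
  have -> : (fun t => ln (coord_weight x t * dist2 p (to_coord x t)))
      = fun t => lnd p (t, 0) by apply/funext => t; rewrite log_coord_infty.
  have -> : green_coord e g x p = g (finite_pt p) infty_pt.
    rewrite /green_coord /of_coord xn /green_ext; case: pselect => //= h.
    by exfalso; apply: h; apply/cdomain_finite; apply: nonreal_off_slit; exact: neq0.
  rewrite lerBrDr -lerBrDl; apply: ge_sup; first by case: supS.
  by move=> _ [y y0 <-]; have := key _ _ p0 y0; lra.
have [_ LZ _ _] := ML.
have -> : - L (fun t => lnd y (t, 0)) = L (fun t => - lnd y (t, 0)).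
  have := LZ (-1) (fun t => lnd y (t, 0)).
  rewrite mulN1r => <-.
    by congr (perron _ _ _); apply/funext => t; rewrite mulN1r.
  by apply: continuous_subspaceT; apply: lnd_line_continuous; exact: neq0.
by apply: ub_le_sup; [case: supS|exists y].
Qed.

End log_means.

(** * Critical points of the Green function *)

Lemma local_max_derive {R : realType} (f : R -> R) (u : R) :
  (\forall s \near u, derivable f s 1) -> (\forall s \near u, f s <= f u) ->
  is_derive u 1 f 0.
Proof.
move=> df mf.
have /nbhs_ballP[d /= d0 hd] : \forall s \near u, derivable f s 1 /\ f s <= f u.
  by apply: filterS2 df mf => s h1 h2; split.
have ball_in t : t \in `]u - d, u + d[ -> derivable f t 1 /\ f t <= f u.
  rewrite in_itv /= => /andP[h1 h2]; apply: hd.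
  by rewrite /ball /= ltr_norml; apply/andP; split; lra.
apply: (@derive1_at_max _ f (u - d) (u + d) u).
- lra.
- by move=> t /ball_in[].
- by rewrite in_itv /=; apply/andP; split; lra.
- by move=> t /ball_in[].
Qed.

Lemma derivable_line {R : realType} (u : R * R -> R) (s : R) :
  derivable u (s, 0) (1, 0) -> derivable (fun t => u (t, 0)) s 1.
Proof.
move=> h.
have E : (fun h : R => h^-1 *: ((u \o shift (s, 0)) (h *: ((1, 0) : R * R)) - u (s, 0))) =
   (fun h : R => h^-1 *: (((fun t => u (t, 0)) \o shift s) (h *: (1 : R)) - u (s, 0))).
  apply/funext => k /=; congr (_ *: (u _ - _)).
  by apply/pair_equal_spec; split=> //=; rewrite scaler0 addr0.
exact: (eq_ind _ (fun F : R -> R => cvg (F @ (0 : R)^')) h _ E).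
Qed.

Lemma esum_ge_seq {R : realType} {T : choiceType} (S : set T) (f : T -> R) (C : R) (l : seq T) :
  uniq l -> (forall i, i \in l -> S i) -> (\esum_(i in S) (f i)%:E <= C%:E)%E ->
  \sum_(i <- l) f i <= C.
Proof.
move=> ul lS; rewrite -lee_fin; apply: le_trans.
rewrite -sumEFin; apply: ereal_sup_ubound; exists [set` l].
  by split; [exact: finite_seq|move=> i /lS].
by rewrite -fsbig_seq.
Qed.

Section critical_points.
Context {R : realType} (e : set R) (g : sphere R -> sphere R -> R) (x : xreal R).
Hypotheses (e_compact : compact e) (e_regular : regular e) (g_green : is_green e g)
  (xe : xcompl e x).
Implicit Types (p q y : R * R) (z : sphere R) (c s t : R).
Local Notation slit := (slit e).
Local Notation G := (fun c => green_coord e g x (c, 0)).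

Definition xof_coord c : xreal R :=
  if x is Some t0 then if c == 0 then None else Some (t0 - c^-1) else Some c.

Lemma of_coord_real c : of_coord x (c, 0) = xreal_pt (xof_coord c).
Proof.
rewrite /of_coord /xof_coord; case: x => [t0|] //.
rewrite xpair_eqE eqxx andbT; case: eqVneq => // c0.
by rewrite inv_pt_real //; congr Some; apply/pair_equal_spec; split=> //=; rewrite subr0.
Qed.

Lemma xof_coord_inj : injective xof_coord.
Proof.
rewrite /xof_coord => c c'; case: x => [t0|]; last by case.
have [->|c0] := eqVneq c 0; have [->|c'0] := eqVneq c' 0 => //.
by move=> [/addrI/oppr_inj/invr_inj].
Qed.

Lemma xcompl_domain (y : xreal R) : cdomain e (xreal_pt y) -> xcompl e y.
Proof. by move=> yD [t et ty]; apply: yD; exists t => //; rewrite -ty. Qed.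

Lemma green_coord_domain c : 0 < G c -> cdomain e (xreal_pt (xof_coord c)).
Proof.
rewrite /green_coord /green_ext of_coord_real; case: pselect => //= _.
by rewrite ltxx.
Qed.

Lemma green_coordE c : cdomain e (xreal_pt (xof_coord c)) ->
  G c = g (xreal_pt (xof_coord c)) (xreal_pt x).
Proof. by rewrite /green_coord /green_ext of_coord_real; case: pselect. Qed.

Lemma xof_coord_neq c : xof_coord c != x.
Proof.
by apply/eqP => E; have := of_coord_neq x (c, 0); rewrite of_coord_real E eqxx.
Qed.

Let opD : open (cdomain e `\ xreal_pt x).
Proof. by apply: open_setD1; exact: open_cdomain. Qed.

Let hD := g_green (pole_domain xe).

(** A local maximum in the coordinate is a local maximum in s, since the coordinate is a continuous
    function k of s near s0. *)
Lemma critical_finite c s0 : xof_coord c = Some s0 -> 0 < G c ->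
  (\forall c' \near c, G c' <= G c) ->
  is_derive s0 (1 : R) (fun s => g (real_pt s) (xreal_pt x)) 0.
Proof.
move=> cs Gc mc; have cD := green_coord_domain Gc.
have [[[C _] _] _ _ _] := hD.
have oU := open_finite opD.
have U0 : (@finite_pt R @^-1` (cdomain e `\ xreal_pt x)) (s0, 0).
  split; first by move: cD; rewrite cs.
  move=> E; have := xof_coord_neq c; rewrite cs => /eqP; apply.
  by move: E; case: (x) => [t0 [->]|].
have line : {for s0, continuous (fun s : R => (s, 0 : R))}.
  exact: cvg_pair (@cvg_id _ (nbhs s0)) (cvg_cst (0 : R)).
have Un : \forall s \near s0, (@finite_pt R @^-1` (cdomain e `\ xreal_pt x)) (s, 0).
  exact: line (open_nbhs_nbhs (conj oU U0)).
apply: local_max_derive.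
  apply: filterS Un => s Us.
  have [ds _ _] := C (1, 0) (1, 0) (mem_head _ _) (mem_head _ _) (s, 0) Us.
  exact: (@derivable_line _ (fun q => g (finite_pt q) (xreal_pt x)) s ds).
have [k kc kE] : exists2 k : R -> R, {for s0, continuous k} &
    k s0 = c /\ \forall s \near s0, xof_coord (k s) = Some s.
  move: cs; rewrite /xof_coord; case E : x => [t0|].
    have [//|c0] := eqVneq c 0; move=> [ts].
    have d0 : t0 - s0 != 0 by rewrite -ts opprB addrC subrK invr_eq0.
    exists (fun s => (t0 - s)^-1).
      by apply: cvgV => //; apply: cvgB; [exact: cvg_cst|exact: cvg_id].
    split; first by rewrite -ts opprB addrC subrK invrK.
    have : \forall s \near s0, s != t0.
      have sn : s0 != t0 by apply: contraNneq d0 => ->; rewrite subrr.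
      have /nbhs_ballP[d /= d00 hd] : nbhs s0 (~` [set t0]).
        apply: open_nbhs_nbhs; split; last by apply/eqP.
        by apply: closed_openC; exact: (accessible_closed_set1 (hausdorff_accessible (@norm_hausdorff _ _))).
      by apply/nbhs_ballP; exists d => // s /hd /eqP.
    apply: filterS => s st; have s0' : t0 - s != 0 by rewrite subr_eq0 eq_sym.
    by rewrite invr_eq0 (negbTE s0') invrK opprB addrC subrK.
  move=> [sc]; exists id; first exact: cvg_id.
  by split=> //; apply: (@filterE _ (nbhs s0)).
have Ms : \forall s \near s0, G (k s) <= G c.
  by apply: (kc [set c' | G c' <= G c]); rewrite kE.1.
apply: filterS3 Un kE.2 Ms => s [sD _] ks.
rewrite (green_coordE (c := k s)); last by rewrite ks.
by rewrite (green_coordE cD) ks cs.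
Qed.

(** The same in the chart at infinity: with s = 1/t, the expression t (g(t) - g(oo)) is the
    difference quotient at 0 of s |-> g(1/s). *)
Lemma critical_infty c : xof_coord c = None -> 0 < G c ->
  (\forall c' \near c, G c' <= G c) ->
  critical (fun v => g (xreal_pt v) (xreal_pt x)) (None : xreal R).
Proof.
move=> cs Gc mc; have cD := green_coord_domain Gc.
have [t0 xt] : exists t0, x = Some t0.
  by case E : x => [t0|]; [exists t0|move: cs; rewrite /xof_coord E].
have c0 : c = 0 by move: cs; rewrite /xof_coord xt; case: eqP.
have [[_ [C _]] _ _ _] := hD.
have oU := open_chart opD; set U := _ @^-1` _ in oU C.
have chart0 : chart_infty ((0, 0) : R * R) = infty_pt by rewrite /chart_infty eqxx.
have chartE (s : R) : s != 0 -> chart_infty (s, 0) = real_pt s^-1.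
  move=> s0; rewrite chart_inftyE; last by rewrite xpair_eqE (negbTE s0).
  change (finite_pt (inv_pt (s, 0)) = real_pt s^-1).
  by rewrite inv_pt_real.
have U0 : U (0, 0) by rewrite /U /= chart0; split; rewrite ?xt //; exact: cdomain_infty.
pose k s := g (chart_infty (s, 0)) (xreal_pt x).
have line : {for 0, continuous (fun s : R => (s, 0 : R))}.
  exact: cvg_pair (@cvg_id _ (nbhs (0 : R))) (cvg_cst (0 : R)).
have Un : \forall s \near (0 : R), U (s, 0).
  exact: line (open_nbhs_nbhs (conj oU U0)).
have dk : is_derive (0 : R) (1 : R) k 0.
  apply: local_max_derive.
    apply: filterS Un => s Us.
    have [ds _ _] := C (1, 0) (1, 0) (mem_head _ _) (mem_head _ _) (s, 0) Us.
    exact: (@derivable_line _ (fun q => g (chart_infty q) (xreal_pt x)) s ds).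
  (* The coordinate 1 / (t0 - t) of the point t = 1/s. *)
  pose f s := s / (t0 * s - 1).
  have fc : {for 0, continuous f}.
    apply: cvgM; first exact: cvg_id.
    apply: cvgV; first by rewrite mulr0 sub0r oppr_eq0 oner_eq0.
    apply: cvgB; last exact: cvg_cst.
    by apply: cvgM; [exact: cvg_cst|exact: cvg_id].
  have f0 : f 0 = c by rewrite /f mul0r.
  have Ms : \forall s \near (0 : R), G (f s) <= G c by apply: (fc [set c' | G c' <= G c]); rewrite f0.
  have dn : \forall s \near (0 : R), t0 * s - 1 < 0.
    have h : (t0 * s - 1) @[s --> (0 : R)] --> t0 * 0 - 1.
      apply: cvgB; last exact: cvg_cst.
      by apply: cvgM; [exact: cvg_cst|exact: cvg_id].
    by apply: (cvgr_lt _ h); rewrite mulr0 sub0r oppr_lt0.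
  apply: filterS3 Un Ms dn => s [sD _] Gs ds.
  have kE : chart_infty (s, 0) = xreal_pt (xof_coord (f s)).
    have [->|s0] := eqVneq s 0; first by rewrite f0 cs chart0.
    have d0 : t0 * s - 1 != 0 by rewrite lt_eqF.
    rewrite chartE // /xof_coord xt /f mulf_eq0 invr_eq0 (negbTE s0) (negbTE d0) /=.
    by congr real_pt; rewrite invf_div; field.
  rewrite /k chart0 -[infty_pt]/(xreal_pt None) -cs kE.
  rewrite -(green_coordE cD) -green_coordE //.
  by rewrite -kE.
have H eps : 0 < eps -> exists2 d : R, 0 < d & forall t, d^-1 < `|t| ->
    `|t * (g (real_pt t) (xreal_pt x) - g infty_pt (xreal_pt x))| < eps.
  move=> eps0; have [dv de] := dk.
  have cv : (fun h => h^-1 *: ((k \o shift 0) (h *: 1) - k 0)) @ (0 : R)^' --> 'D_1 k 0 by exact: dv.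
  rewrite de in cv.
  have : \forall h \near (0 : R)^', `|0 - h^-1 *: ((k \o shift 0) (h *: 1) - k 0)| < eps.
    exact: cvgr_dist_lt cv _ eps0.
  move=> /nbhs_ballP[d /= d0 hd]; exists d => // t dt.
  have t0' : t != 0 by rewrite -normr_gt0 (lt_trans _ dt) // invr_gt0.
  have := hd t^-1; rewrite /ball /= sub0r normrN normfV invr_eq0.
  have h1 : `|t|^-1 < d by rewrite -[ltRHS]invrK ltf_pV2 ?posrE ?invr_gt0 // normr_gt0.
  move=> /(_ h1 t0'); rewrite invrK sub0r normrN addr0.
  by rewrite /k chart0 /GRing.scale /= mulr1 chartE ?invr_eq0 // invrK.
split; apply/cvgrPdist_lt => eps /H[d d0 hd].
- near=> t; rewrite sub0r normrN; apply: hd; rewrite (lt_le_trans _ (ler_norm t)) //.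
  by near: t; apply: nbhs_pinfty_gt; rewrite num_real.
- near=> t; rewrite sub0r normrN; apply: hd.
  rewrite -normrN (lt_le_trans _ (ler_norm (- t))) // ltrNr.
  by near: t; apply: nbhs_ninfty_lt; rewrite num_real.
Unshelve. all: by end_near. Qed.

(** The maximum over [a, b] is positive, so it is not attained at the endpoints; it may lie in
    another gap than rho, but it is critical and lies between a and b. *)
Lemma gap_critical a b rho : G a = 0 -> G b = 0 -> a < rho < b -> 0 < G rho ->
  exists c, [/\ a < c < b, G rho <= G c, 0 < G c & green_critical e g x (xof_coord c)].
Proof.
move=> Ga Gb /andP[ar rb] Gr.
have cG : continuous G.
  move=> c; apply: (@continuous_comp _ _ _ (fun c : R => (c, 0 : R)) (green_coord e g x)).
    exact: cvg_pair (@cvg_id _ (nbhs c)) (cvg_cst (0 : R)).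
  exact: green_coord_continuous.
have ab : a <= b by rewrite ltW // (lt_trans ar).
have [c cI cM] := EVT_max ab (continuous_subspaceT cG).
have Grc : G rho <= G c by apply: cM; rewrite in_itv /= !ltW.
have Gc : 0 < G c by exact: lt_le_trans Grc.
move: cI; rewrite in_itv /= !le_eqVlt => /andP[/orP[/eqP ac|ac]].
  by move: Gc; rewrite -ac Ga ltxx.
move=> /orP[/eqP cb|cb]; first by move: Gc; rewrite cb Gb ltxx.
exists c; split => //; first by rewrite ac.
have mc : \forall c' \near c, G c' <= G c.
  have : \forall c' \near c, c' \in `]a, b[ by apply: near_in_itvoo; rewrite in_itv /= ac.
  by apply: filterS => c'; rewrite in_itv /= => /andP[h1 h2]; apply: cM; rewrite in_itv /= !ltW.
have cX := xcompl_domain (green_coord_domain Gc).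
split; last first.
- case E : (xof_coord c) => [s0|]; last exact: critical_infty E Gc mc.
  exact: critical_finite E Gc mc.
- exact: xof_coord_neq.
exists (connected_component (xcompl e) (xof_coord c)).
  by exists (xof_coord c).
exact: connected_component_refl.
Qed.

(** Roots in different intervals between neighbouring nodes are dominated by critical points in
    these intervals, which are distinct; so the sum is bounded by a finite partial sum of the
    Parreau-Widom series. *)
Lemma interlacing_green_sum (C : R) (n : nat) (s r : seq R) :
  (PW e g x <= C%:E)%E -> sorted <%R s -> size s = n.+1 -> size r = n ->
  (forall t, t \in s -> G t = 0) ->
  (forall i, (i < n)%N -> s`_i < r`_i < s`_i.+1) ->
  \sum_(z <- r) G z <= C.
Proof.
move=> PC ss sz rz G0 rs.
(* A root where the Green function is not positive has no critical point attached to it and can only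
   lower the sum. *)
pose D := [seq i <- iota 0 n | 0 < G r`_i].
have Gi i : (i < n)%N -> 0 < G r`_i -> exists c, [/\ s`_i < c < s`_i.+1, G r`_i <= G c, 0 < G c
   & green_critical e g x (xof_coord c)].
  by move=> iN; apply: gap_critical (rs i iN); apply: G0; rewrite mem_nth // sz // ltnW.
pose cc i := if pselect (exists c, [/\ s`_i < c < s`_i.+1, G r`_i <= G c, 0 < G c
   & green_critical e g x (xof_coord c)]) is left h then projT1 (cid h) else 0.
have ccP i : i \in D -> [/\ (i < n)%N, s`_i < cc i < s`_i.+1, G r`_i <= G (cc i), 0 < G (cc i)
   & green_critical e g x (xof_coord (cc i))].
  rewrite mem_filter mem_iota add0n /= => /andP[Gr iN]; rewrite /cc; case: pselect => [h|h].
    by case: cid => c [].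
  by exfalso; apply: h; exact: Gi.
have cinj : {in D &, injective cc}.
  have lt i j : i \in D -> j \in D -> (i < j)%N -> cc i < cc j.
    move=> /ccP[iN /andP[_ h1] _ _ _] /ccP[jN /andP[h2 _] _ _ _] ij.
    apply: lt_trans h1 (le_lt_trans _ h2).
    have sl : sorted <=%R s by apply: sub_sorted ss => ? ? /ltW.
    apply: (sorted_leq_nth le_trans le_refl 0 sl) => //; rewrite inE sz ltnS ?(ltnW jN) //.
  move=> i j iD jD E; case: (ltngtP i j) => // h.
    by have := lt _ _ iD jD h; rewrite E ltxx.
  by have := lt _ _ jD iD h; rewrite E ltxx.
have uD : uniq [seq xof_coord (cc i) | i <- D].
  rewrite (map_inj_in_uniq (f := xof_coord \o cc)).
    by rewrite filter_uniq // iota_uniq.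
  by move=> i j iD jD /xof_coord_inj; exact: cinj.
have := esum_ge_seq uD _ PC; rewrite big_map => H.
apply: le_trans (H _); last by move=> _ /mapP[i /ccP[_ _ _ _ h] ->].
rewrite (big_nth 0) rz /index_iota subn0 big_filter big_mkcond /=.
rewrite [leRHS]big_mkcond /= big_seq_cond [leRHS]big_seq_cond; apply: ler_sum => i /andP[iN _].
case: ifP => Gr; last by rewrite leNgt Gr.
have [|_ _ Gc G1 _] := ccP i; first by rewrite mem_filter Gr.
by rewrite -green_coordE //; exact: green_coord_domain.
Qed.

End critical_points.

(** * Capacity *)

Section monotone_integral.
Context {d} {T : measurableType d} {R : realType} (mu : {measure set T -> \bar R}).
Local Open Scope ereal_scope.

Lemma ge0_integral_mono (D : set T) (f h : T -> \bar R) :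
  (forall t, D t -> 0 <= f t) -> (forall t, D t -> f t <= h t) ->
  \int[mu]_(t in D) f t <= \int[mu]_(t in D) h t.
Proof.
move=> f0 fh; rewrite !ge0_integralE //; last by move=> t Dt; exact: le_trans (f0 t Dt) (fh t Dt).
apply: le_ereal_sup => _ [k /= kf <-]; exists k => //= t.
apply: le_trans (kf t) _; rewrite /patch; case: ifPn => //.
by rewrite inE => /fh.
Qed.

(* Unlike in [le_integral], f and h need not be measurable. *)
Lemma integral_mono (D : set T) (f h : T -> \bar R) :
  (forall t, D t -> f t <= h t) ->
  \int[mu]_(t in D) f t <= \int[mu]_(t in D) h t.
Proof.
move=> fh; rewrite integralE [leRHS]integralE; apply: leeB.
  apply: ge0_integral_mono => t Dt; rewrite !funeposE; last first.
    by rewrite ge_max !le_max lexx (fh t Dt) !orbT.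
  by rewrite le_max lexx orbT.
apply: ge0_integral_mono => t Dt; rewrite !funenegE; last first.
  by rewrite ge_max !le_max lexx leeN2 (fh t Dt) !orbT.
by rewrite le_max lexx orbT.
Qed.

End monotone_integral.

Section capacity.
Context {R : realType} (e : set R).
Hypothesis e_compact : compact e.

Lemma probability_integral_cst (mu : probability (measurableTypeR R) R) (c : R) :
  mu e = 1%E -> (\int[mu]_(t in e) c%:E = c%:E)%E.
Proof.
move=> m1; have mE := measurable_e e_compact.
transitivity (c%:E * mu e)%E; last by rewrite m1 mule1.
by rewrite -(@integral_cst _ _ _ mu e mE c%:E).
Qed.

(** All energies are at least - ln D with D a bound for the diameter of e. This keeps the infimum
    finite; were it - oo, [fine] would turn the infinite exponential into 0. *)
Lemma capacity_ge_energy (mu : probability (measurableTypeR R) R) (G : R) :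
  mu e = 1%E -> (log_energy e mu <= G%:E)%E -> expR (- G) <= capacity e.
Proof.
move=> m1 EG; have [M HM] := bounded_slit e_compact.
pose D := Num.max 1 (M + M); have D0 : 0 < D by rewrite lt_max ltr01.
have low (nu : probability (measurableTypeR R) R) : nu e = 1%E ->
    ((- ln D)%:E <= log_energy e nu)%E.
  move=> n1; rewrite -(probability_integral_cst _ n1).
  apply: integral_mono => s es; rewrite -(probability_integral_cst _ n1).
  apply: integral_mono => t et.
  rewrite EFinN leeN2 -lne_EFin // lee_lne ?in_itv /= ?lee_fin ?leey ?andbT //; last exact: ltW.
  rewrite le_max; apply/orP; right; apply: le_trans (ler_normB _ _) _.
  by rewrite lerD // HM.
pose S' := [set log_energy e nu | nu in [set nu : probability (measurableTypeR R) R | nu e = 1%E]].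
have h1 : (ereal_inf S' <= G%:E)%E.
  by apply: le_trans EG; apply: ereal_inf_lbound; exists mu.
have h2 : ((- ln D)%:E <= ereal_inf S')%E.
  by apply: le_ereal_inf_tmp => _ [nu n1 <-]; exact: low.
rewrite /capacity -/S'; case: (ereal_inf S') h1 h2 => [r| |] //=.
by rewrite !lee_fin => h1 _; rewrite ler_expR lerN2.
Qed.

Lemma lee_real_lt (a b : \bar R) : (forall r : R, (r%:E < a)%E -> (r%:E <= b)%E) -> (a <= b)%E.
Proof.
move=> h; rewrite leNgt; apply/negP; case: b h => [b| |] h; last 2 first.
- by rewrite ltNge leey.
- case: a h => [a| |] h // _; last by have := h 0 (ltry _).
  by have := h (a - 1); rewrite lte_fin ltrBlDr ltrDl ltr01 => /(_ isT).
case: a h => [a| |] h //; last by have := h (b + 1) (ltry _); rewrite lee_fin gerDl ler10.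
rewrite lte_fin => ba; have := h ((b + a) / 2).
by rewrite lte_fin lee_fin => H; have := H (midf_lt ba).2; rewrite leNgt (midf_lt ba).1.
Qed.

(* Monotone convergence, for a limit f that need not be measurable. *)
Lemma mean_limit_le (omega : probability (measurableTypeR R) R) z (u : nat -> R -> R)
    (f : R -> \bar R) (a c : R) :
  is_harmonic_measure e z omega ->
  (forall k, {within e, continuous (u k)}) -> (forall k t, e t -> a <= u k t) ->
  (forall t, e t -> {homo u^~ t : k l / (k <= l)%N >-> k <= l}) ->
  (forall k, perron e (u k) z <= c) ->
  (forall t r, e t -> (r%:E < f t)%E -> exists k, r <= u k t) ->
  (\int[omega]_(t in e) f t <= c%:E)%E.
Proof.
move=> om cu ua ndu uc fu; have [m1 mI] := om.
have mE := measurable_e e_compact.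
pose F (k : nat) (t : R) : \bar R := (u k t - a)%:E.
have F0 k t : e t -> (0 <= F k t)%E by move=> et; rewrite lee_fin subr_ge0 ua.
have cF k : {within e, continuous (fun t => u k t - a)}.
  by move=> t; apply: cvgB; [exact: cu|exact: cvg_cst].
have mF k : measurable_fun (e : set (measurableTypeR R)) (F k).
  by apply/measurable_EFinP; exact: (within_measurable e_compact (cF k)).
have ndF t : e t -> nondecreasing_seq (F^~ t).
  by move=> et k l kl; rewrite lee_fin lerD2r ndu.
have ML := perron_mean e_compact om; have [LD _ _ _] := ML.
have IF k : (\int[omega]_(t in e) F k t <= (c - a)%:E)%E.
  rewrite /F mI // lee_fin.
  have -> : (fun t => u k t - a) = u k \+ cst (- a) by [].
  rewrite LD //; last exact: within_continuous_cst.
  by rewrite (mean_cst _ ML) lerD2r.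
pose H t := limn (F^~ t).
have IH : (\int[omega]_(t in e) H t <= (c - a)%:E)%E.
  rewrite (monotone_convergence omega mE mF F0 ndF); apply: lime_le; last exact: nearW.
  apply: ereal_nondecreasing_is_cvgn => k l kl; apply: ge0_integral_mono => t et.
    exact: F0.
  exact: ndF.
have HE t : e t -> H t = ereal_sup (range (F^~ t)).
  by move=> et; apply/cvg_lim => //; exact: ereal_nondecreasing_cvgn (ndF t et).
have Fge k t : e t -> (F k t <= H t)%E.
  by move=> et; rewrite HE //; apply: ereal_sup_ubound; exists k.
have H0 t : e t -> (0 <= H t)%E by move=> et; exact: le_trans (F0 0%N t et) (Fge _ _ et).
have mH : measurable_fun (e : set (measurableTypeR R)) H.
  apply: (emeasurable_fun_cvg F) => // t et.
  exact: ereal_nondecreasing_is_cvgn (ndF t et).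
have iH : omega.-integrable e H.
  apply/integrableP; split=> //; apply: le_lt_trans (ltry (c - a)).
  by apply: le_trans IH; apply: ge0_integral_mono => // t et; rewrite gee0_abs // H0.
have pw t : e t -> (f t <= H t + a%:E)%E.
  move=> et; apply: lee_real_lt => r /(fu t r et)[k rk].
  apply: le_trans (leeD2r _ (Fge k t et)).
  by rewrite -EFinD lee_fin subrK.
apply: le_trans (integral_mono omega pw) _.
rewrite integralD //; last exact: (within_integrable e_compact om (@within_continuous_cst _ e a)).
by rewrite (probability_integral_cst a m1) -leeBrDr // -EFinB.
Qed.

(** For s in e, - log |t - s| is the increasing limit of - log |t - (s + i eps_k)|, the value + oo
    at t = s included, and these means are at most G. So the potential is at most G at every point
    of e. *)
Lemma log_energy_le (mu : probability (measurableTypeR R) R) z (G : R) :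
  is_harmonic_measure e z mu ->
  (forall y, 0 < y.2 -> - perron e (fun t => lnd y (t, 0)) z <= G) ->
  (log_energy e mu <= G%:E)%E.
Proof.
move=> om HG; have [m1 mI] := om; have [M HM] := bounded_slit e_compact.
rewrite -(probability_integral_cst G m1); apply: integral_mono => s es.
pose D := M + M + 1; pose eps (k : nat) : R := k.+1%:R^-1.
have eps0 k : 0 < eps k by rewrite invr_gt0.
have eps1 k : eps k <= 1 by rewrite invf_le1 // ler1n.
have lndE k t : lnd (s, eps k) (t, 0) = ln (Num.sqrt ((t - s) ^+ 2 + eps k ^+ 2)).
  by rewrite /lnd /modulus /= sub0r sqrrN.
have m0 k t : 0 < (t - s) ^+ 2 + eps k ^+ 2 by rewrite ltr_wpDl ?sqr_ge0 // exprn_gt0.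
have mle k t : Num.sqrt ((t - s) ^+ 2 + eps k ^+ 2) <= `|t - s| + eps k.
  rewrite -(@ler_pXn2r _ 2) ?nnegrE ?sqrtr_ge0 ?addr_ge0 ?(ltW (eps0 k)) //.
  rewrite sqr_sqrtr ?(ltW (m0 _ _)) // [leRHS]sqrrD real_normK ?num_real //.
  by rewrite lerD2r lerDl mulrn_wge0 // mulr_ge0 // ltW.
have small (r : R) : 0 < r -> exists k, eps k < r.
  move=> r0; have [k kr] := ltr_add_invr r0; exists k.
  by rewrite /eps -[ltLHS]add0r.
have cl k : {within e, continuous (fun t => lnd (s, eps k) (t, 0))}.
  by apply: continuous_subspaceT; apply: lnd_line_continuous; rewrite /= gt_eqF.
apply: (mean_limit_le (u := fun k t => - lnd (s, eps k) (t, 0)) (a := - ln D) om).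
- by move=> k t; apply: cvgN; exact: cl.
- move=> k t et; rewrite lerN2 lndE.
  have h : Num.sqrt ((t - s) ^+ 2 + eps k ^+ 2) <= D.
    apply: le_trans (mle k t) _; rewrite /D lerD // (le_trans (ler_normB _ _)) //.
    by rewrite lerD // HM.
  by rewrite ler_ln ?posrE ?sqrtr_gt0 // (lt_le_trans _ h) // sqrtr_gt0.
- move=> t et k l kl; rewrite lerN2 !lndE ler_ln ?posrE ?sqrtr_gt0 //.
  rewrite ler_wsqrtr // lerD2l lerXn2r ?nnegrE ?(ltW (eps0 _)) //.
  by rewrite /eps lef_pV2 ?posrE // ler_nat.
- move=> k; apply: le_trans (HG (s, eps k) (eps0 k)).
  have ML := perron_mean e_compact om; have [_ LZ _ _] := ML.
  rewrite -mulN1r -(LZ _ _ (cl k)) le_eqVlt; apply/orP; left; apply/eqP.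
  by congr (perron _ _ _); apply/funext => t; rewrite mulN1r.
move=> t r et rf; have k0 (k : nat) : 0 < Num.sqrt ((t - s) ^+ 2 + eps k ^+ 2).
  by rewrite sqrtr_gt0.
suff [k kr] : exists k, `|t - s| + eps k <= expR (- r).
  exists k; rewrite lndE lerNr -[leRHS]expRK ler_ln ?posrE ?expR_gt0 //.
  exact: le_trans (mle k t) kr.
have [st|st] := eqVneq s t.
  by have [k kr] := small _ (expR_gt0 (- r)); exists k; rewrite st subrr normr0 add0r ltW.
have d0 : 0 < `|s - t| by rewrite normr_gt0 subr_eq0.
have d1 : `|t - s| < expR (- r).
  by move: rf; rewrite lne_EFin // lte_fin ltrNr -ltr_expR lnK ?posrE // distrC.
have [k kr] := small (expR (- r) - `|t - s|) (eq_ind _ is_true d1 _ (esym (subr_gt0 _ _))).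
by exists k; lra.
Qed.

End capacity.

(** * Polynomial majorants of the weight *)

Section bernstein.
Context {R : realType}.
Implicit Types (l : {poly R}) (phi psi : nat -> R).

(* Bernstein polynomials in the variable l: the value at t is the mean of phi
   under the binomial law of n trials with success probability l.[t]. *)
Fixpoint bernstein l n phi : {poly R} :=
  if n is n.+1 then (1 - l) * bernstein l n phi + l * bernstein l n (phi \o S)
  else (phi 0%N)%:P.

Lemma bernstein_mono l t n phi psi : 0 <= l.[t] <= 1 -> (forall i, phi i <= psi i) ->
  (bernstein l n phi).[t] <= (bernstein l n psi).[t].
Proof.
move=> /andP[l0 l1]; elim: n phi psi => [|n IH] phi psi h /=; first by rewrite !hornerC.
by rewrite !hornerE lerD // ler_wpM2l // ?subr_ge0 // IH // => i; exact: h.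
Qed.

(** The second moment of a shifted binomial variable: squared mean plus variance. The shift c is
    general because the recursion replaces phi by phi \o S. *)
Lemma bernstein_quadratic l t n (a b c : R) :
  (bernstein l n (fun i => a + b * (i%:R + c) ^+ 2)).[t]
  = a + b * ((n%:R * l.[t] + c) ^+ 2 + n%:R * l.[t] * (1 - l.[t])).
Proof.
elim: n c => [|n IH] c /=; first by rewrite hornerC; ring.
have -> : (fun i => a + b * (i%:R + c) ^+ 2) \o S
    = (fun i => a + b * (i%:R + (c + 1)) ^+ 2).
  by apply/funext => i /=; rewrite -natr1; ring.
by rewrite !hornerE !IH -natr1; ring.
Qed.

(** Chebyshev's argument: since |D| <= eta + D^2 / eta, the difference between f t and f at a node
    is bounded by a quadratic function of the index, whose binomial mean is explicit. *)
Lemma lipschitz_poly (f : R -> R) (K M eps : R) : 0 <= K -> 0 < M -> 0 < eps ->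
  (forall s t, `|f s - f t| <= K * `|s - t|) ->
  exists Q : {poly R}, forall t, `|t| <= M -> `|f t - Q.[t]| <= eps.
Proof.
move=> K0 M0 eps0 lip.
pose C := K * (M + M) + 1; have C0 : 0 < C by rewrite ltr_wpDl // mulr_ge0 // addr_ge0 // ltW.
(* Then C eta = eps / 2, and n is taken so large that the variance term C / (eta n) is at most eps /
   2. *)
pose eta := eps / 2 / C; have eta0 : 0 < eta by rewrite !divr_gt0.
have [n nP] : exists n : nat, C / (eta * (eps / 2)) < n%:R.
  by exists (Num.bound (C / (eta * (eps / 2)))); apply: archi_boundP; rewrite !(divr_ge0, mulr_ge0) ?ltW // divr_gt0.
have n0 : 0 < n%:R :> R.
  by apply: lt_trans nP; rewrite divr_gt0 // mulr_gt0 // divr_gt0.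
pose l : {poly R} := (M + M)^-1 *: ('X + M%:P).
pose node (i : nat) := (M + M) * (i%:R / n%:R) - M.
exists (bernstein l n (f \o node)) => t tM.
have MM : 0 < M + M by rewrite addr_gt0.
have lt : l.[t] = (t + M) / (M + M) by rewrite !hornerE mulrC.
have tl : t = (M + M) * l.[t] - M.
  by rewrite lt mulrCA divff ?gt_eqF // mulr1 addrK.
have l01 : 0 <= l.[t] <= 1.
  move: tM; rewrite ler_norml => /andP[h1 h2].
  by rewrite lt divr_ge0 ?ler_pdivrMr ?mul1r /=; lra.
have quad i : `|f t - f (node i)| <= C * eta + C / eta / n%:R ^+ 2 * (i%:R + - (n%:R * l.[t])) ^+ 2.
  set D := i%:R / n%:R - l.[t].
  have E : (i%:R + - (n%:R * l.[t])) ^+ 2 = n%:R ^+ 2 * D ^+ 2.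
    by rewrite /D; field; rewrite gt_eqF.
  have -> : C / eta / n%:R ^+ 2 * (i%:R + - (n%:R * l.[t])) ^+ 2 = C * (D ^+ 2 / eta).
    by rewrite E; field; rewrite !gt_eqF.
  rewrite -mulrDr; have DD : `|t - node i| = (M + M) * `|D|.
    rewrite {1}tl /node -(gtr0_norm MM) -normrM (gtr0_norm MM) distrC; congr `|_|.
    by rewrite /D; ring.
  apply: le_trans (lip _ _) _; rewrite DD mulrA.
  have h1 : `|D| <= eta + D ^+ 2 / eta.
    rewrite -(ler_pM2r eta0) mulrDl mulfVK ?gt_eqF // -real_normK ?num_real //.
    by have := sqr_ge0 (`|D| - eta); have := mulr_ge0 (normr_ge0 D) (ltW eta0); rewrite sqrrB -!expr2; lra.
  apply: le_trans (ler_wpM2l (ltW C0) h1); rewrite ler_wpM2r //.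
  by rewrite /C lerDl.
have bound : C * eta + C / eta / n%:R ^+ 2 * ((n%:R * l.[t] + - (n%:R * l.[t])) ^+ 2
    + n%:R * l.[t] * (1 - l.[t])) <= eps.
  rewrite subrr expr0n add0r.
  have -> : C * eta = eps / 2 by rewrite /eta mulrCA divff ?gt_eqF // mulr1.
  have -> : C / eta / n%:R ^+ 2 * (n%:R * l.[t] * (1 - l.[t])) = C / eta / n%:R * (l.[t] * (1 - l.[t])).
    by field; rewrite !gt_eqF.
  have h : C / eta / n%:R <= eps / 2.
    rewrite !ler_pdivrMr //; move: nP.
    have e0 : 0 < eta * (eps / 2) by rewrite mulr_gt0 // divr_gt0.
    by rewrite (ltr_pdivrMr _ _ e0) => /ltW; lra.
  have : l.[t] * (1 - l.[t]) <= 1 by move: l01 => /andP[? ?]; nra.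
  have : 0 <= C / eta / n%:R by rewrite !divr_ge0 // ltW.
  have : 0 <= l.[t] * (1 - l.[t]) by move: l01 => /andP[? ?]; rewrite mulr_ge0 // subr_ge0.
  move: h; set X := C / eta / _; set Y := _ * (1 - _) => h Y0 X0 Y1; nra.
rewrite ler_distlC; apply/andP; split.
- have h := bernstein_mono n l01 (phi := fun i => (f t - C * eta) + - (C / eta / n%:R ^+ 2) * (i%:R + - (n%:R * l.[t])) ^+ 2)
    (psi := f \o node) _.
  rewrite bernstein_quadratic in h; apply: le_trans (h _); first by lra.
  by move=> i /=; have := ler_norm (f t - f (node i)); have := quad i; lra.
- have h := bernstein_mono n l01 (psi := fun i => (f t + C * eta) + (C / eta / n%:R ^+ 2) * (i%:R + - (n%:R * l.[t])) ^+ 2)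
    (phi := f \o node) _.
  rewrite bernstein_quadratic in h; apply: le_trans (h _) _; last by lra.
  by move=> i /=; have := ler_norm (f (node i) - f t); have := quad i; rewrite distrC; lra.
Qed.

End bernstein.

Lemma within_continuous_ln {R : realType} (e : set R) (f : R -> R) :
  (forall t, e t -> 0 < f t) -> {within e, continuous f} ->
  {within e, continuous (fun t => ln (f t))}.
Proof.
move=> f0; rewrite !subspace_continuousP => cf t et.
exact: (cvg_comp _ _ (cf t et) (continuous_ln (f0 t et))).
Qed.

Lemma lipschitz_continuous {R : realType} (f : R -> R) (K : R) :
  (forall s t, `|f s - f t| <= K * `|s - t|) -> continuous f.
Proof.
move=> lip t; apply/cvgrPdist_lt => eps eps0; have K0 : 0 < `|K| + 1 by rewrite ltr_wpDl.
near=> s; have h : `|t - s| < eps / (`|K| + 1).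
  by near: s; apply: cvgr_dist_lt; rewrite ?divr_gt0 //; exact: cvg_id.
apply: le_lt_trans (lip _ _) _; rewrite ltr_pdivlMr // mulrC in h; apply: le_lt_trans h.
by rewrite ler_wpM2r // (le_trans (ler_norm K)) // lerDl.
Unshelve. all: by end_near. Qed.

Section weight.
Context {R : realType} (e : set R) (w : R -> R).
Hypotheses (e_compact : compact e) (w_weight : weight e w).

Lemma weight_bounded : exists2 B, 0 <= B & forall t, e t -> w t <= B.
Proof.
have [w0 usc _] := w_weight.
have H : \forall B \near +oo, e `<=` [set t | e t -> w t <= B].
  apply: (iffLR (@compact_near_coveringP _ _) e_compact) => t et.
  have n : \forall s \near t, e s -> w s < w t + 1 by apply: usc; rewrite // ltrDl.
  exists ([set s | e s -> w s < w t + 1], [set B | w t + 1 < B]); first split => //=.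
    by apply: nbhs_pinfty_gt; rewrite num_real.
  by move=> [s B] /= [h1 h2] es; rewrite ltW // (lt_trans (h1 es)).
have H0 : \forall B \near +oo, 0 < (B : R) by apply: nbhs_pinfty_gt; rewrite num_real.
have [B [B0 HB]] := filter_ex (filterI H0 H).
by exists B => [|t et]; [exact: ltW|exact: HB].
Qed.

(* Lipschitz majorants of w decreasing to w. *)
Definition supconv (k : nat) (t : R) : R :=
  sup [set Num.max 0 (w s - k%:R * `|s - t|) | s in e] + k.+1%:R^-1.

Let E k t := [set Num.max 0 (w s - k%:R * `|s - t|) | s in e].

Let supE k t : e !=set0 -> has_sup (E k t).
Proof.
move=> [s0 es0]; have [B B0 HB] := weight_bounded; split.
  by exists (Num.max 0 (w s0 - k%:R * `|s0 - t|)); exists s0.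
exists B => _ [s es <-]; rewrite ge_max B0 /= lerBlDr (le_trans (HB s es)) // lerDl.
by rewrite mulr_ge0.
Qed.

Hypothesis e_neq0 : e !=set0.

Lemma supconv_ge k t : k.+1%:R^-1 <= supconv k t.
Proof.
rewrite /supconv lerDr; have [s0 es0] := e_neq0.
apply: le_trans (ub_le_sup (supE k t e_neq0).2 _); last by exists s0.
by rewrite le_max lexx.
Qed.

Lemma supconv_gt0 k t : 0 < supconv k t.
Proof. by apply: lt_le_trans (supconv_ge k t); rewrite invr_gt0. Qed.

Lemma supconv_weight k t : e t -> w t <= supconv k t.
Proof.
move=> et; apply: (@le_trans _ _ (sup (E k t))); last by rewrite lerDl invr_ge0.
apply: le_trans (ub_le_sup (supE k t e_neq0).2 _); last by exists t.
by rewrite subrr normr0 mulr0 subr0 le_max lexx orbT.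
Qed.

Lemma supconv_lipschitz k s t : `|supconv k s - supconv k t| <= k%:R * `|s - t|.
Proof.
have key a b : supconv k a <= supconv k b + k%:R * `|a - b|.
  rewrite /supconv addrAC lerD2r; apply: ge_sup; first by case: (supE k a e_neq0).
  move=> _ [r er <-].
  apply: (@le_trans _ _ (Num.max 0 (w r - k%:R * `|r - b|) + k%:R * `|a - b|)).
    have h : k%:R * `|r - b| <= k%:R * `|r - a| + k%:R * `|a - b|.
      by rewrite -mulrDr ler_wpM2l // ler_distD.
    have h0 : 0 <= k%:R * `|a - b| by rewrite mulr_ge0.
    rewrite ge_max; apply/andP; split; first by rewrite addr_ge0 // le_max lexx.
    apply: (@le_trans _ _ (w r - k%:R * `|r - b| + k%:R * `|a - b|)); first by lra.
    by rewrite lerD2r le_max lexx orbT.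
  by rewrite lerD2r; apply: ub_le_sup; [case: (supE k b e_neq0)|exists r].
have := key s t; have := key t s; rewrite (distrC t s) ler_norml => h1 h2.
by apply/andP; split; lra.
Qed.

Lemma supconv_le B k t : 0 <= B -> (forall s, e s -> w s <= B) -> supconv k t <= B + 1.
Proof.
move=> B0 HB; rewrite /supconv lerD //; last by rewrite invf_le1 // ler1n.
apply: ge_sup; first by case: (supE k t e_neq0).
move=> _ [r er <-]; rewrite ge_max B0 /= lerBlDr (le_trans (HB r er)) // lerDl.
by rewrite mulr_ge0.
Qed.

Lemma supconv_nonincreasing k l t : (k <= l)%N -> supconv l t <= supconv k t.
Proof.
move=> kl; rewrite /supconv lerD //; last by rewrite lef_pV2 ?posrE // ler_nat.
apply: ge_sup; first by case: (supE l t e_neq0).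
move=> _ [r er <-].
apply: le_trans (ub_le_sup (supE k t e_neq0).2 _); last by exists r.
have h : k%:R * `|r - t| <= l%:R * `|r - t| by rewrite ler_wpM2r // ler_nat.
rewrite ge_max !le_max lexx /=; apply/orP; right; lra.
Qed.

(** By upper semi-continuity w < a within distance d of t; farther away the penalty k |s - t| is at
    least k d >= B once k is large. *)
Lemma supconv_limit t (A : R) : e t -> w t < A -> exists k, supconv k t <= A.
Proof.
move=> et wA; have [w0 usc _] := w_weight; have [B B0 HB] := weight_bounded.
pose a := (w t + A) / 2; have [wa aA] := midf_lt wA.
have /nbhs_ballP[d /= d0 hd] : \forall s \near t, e s -> w s < a by exact: usc.
have Aa : 0 < A - a by rewrite subr_gt0.
have [k1 hk1] := ltr_add_invr Aa; rewrite add0r in hk1.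
pose k2 := Num.bound (B / d); have hk2 : B / d < k2%:R by apply: archi_boundP; rewrite divr_ge0 // ltW.
pose k := maxn k1 k2; exists k.
have i1 : k.+1%:R^-1 <= A - a.
  by apply: le_trans (ltW hk1); rewrite lef_pV2 ?posrE // ler_nat ltnS leq_maxl.
have i2 : B <= k%:R * d.
  by rewrite -ler_pdivrMr // (le_trans (ltW hk2)) // ler_nat leq_maxr.
have a0 : 0 <= a by exact: le_trans (w0 t et) (ltW wa).
rewrite /supconv -[leRHS](subrK a) [leRHS]addrC.
apply: lerD => //; apply: ge_sup; first by case: (supE k t e_neq0).
move=> _ [s es <-]; rewrite ge_max a0 /=.
have [st|st] := ltP `|t - s| d.
  have : w s < a by exact: hd.
  by have : 0 <= k%:R * `|s - t| by [rewrite mulr_ge0]; lra.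
have : k%:R * d <= k%:R * `|s - t| by rewrite ler_wpM2l // distrC.
by have := HB s es; lra.
Qed.

(** Q approximates 1 / u from below for a Lipschitz majorant u of w. The passage through u is needed
    because log w may be discontinuous or - oo. *)
Lemma weight_polynomial (omega : probability (measurableTypeR R) R) z (b : R) :
  is_harmonic_measure e z omega ->
  (\int[omega]_(t in e) lne (w t)%:E < b%:E)%E ->
  exists Q : {poly R}, [/\ forall t, e t -> 0 < Q.[t],
    forall t, e t -> w t * Q.[t] <= 1 & - perron e (fun t => ln Q.[t]) z <= b].
Proof.
move=> om Ib; have [B B0 HB] := weight_bounded; have [w0 _ _] := w_weight.
have ML := perron_mean e_compact om; have [LD LZ Lm _] := ML.
have B1 : 0 < B + 1 by rewrite ltr_wpDl.
have csc k : {within e, continuous (fun t => ln (supconv k t))}.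
  apply: within_continuous_ln; first by move=> *; exact: supconv_gt0.
  by apply: continuous_subspaceT; exact: lipschitz_continuous (@supconv_lipschitz k).
have LN (f : R -> R) : {within e, continuous f} -> perron e (fun t => - f t) z = - perron e f z.
  move=> cf; rewrite -mulN1r -(LZ _ _ cf); congr (perron _ _ _).
  by apply/funext => t; rewrite mulN1r.
(* Otherwise all the means of log supconv are at least b, and monotone convergence for their
   negatives gives int log w >= b. *)
have [k kb] : exists k, perron e (fun t => ln (supconv k t)) z < b.
  apply: contrapT => /forallNP h.
  have H k : b <= perron e (fun t => ln (supconv k t)) z by rewrite leNgt; exact/negP/h.
  pose f t : \bar R := (- lne (w t)%:E)%E.
  have IF : (\int[omega]_(t in e) f t <= (- b)%:E)%E.
    apply: (mean_limit_le e_compact (u := fun k t => - ln (supconv k t)) (a := - ln (B + 1)) om).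
    - by move=> k t; apply: cvgN; exact: csc.
    - by move=> k t et; rewrite lerN2 ler_ln ?posrE ?supconv_gt0 // supconv_le.
    - by move=> t et k l kl; rewrite lerN2 ler_ln ?posrE ?supconv_gt0 // supconv_nonincreasing.
    - by move=> k; rewrite LN // lerN2.
    move=> t r et rf; have [|k kr] := @supconv_limit t (expR (- r)) et.
      have := w0 t et; rewrite le_eqVlt => /orP[/eqP <-|wt]; first exact: expR_gt0.
      by rewrite /f lne_EFin // -EFinN lte_fin ltrNr in rf; rewrite -[ltLHS]lnK ?posrE // ltr_expR.
    by exists k; rewrite lerNr -[leRHS]expRK ler_ln ?posrE ?expR_gt0 ?supconv_gt0.
  have : (b%:E <= \int[omega]_(t in e) lne (w t)%:E)%E; last by rewrite leNgt Ib.
  have -> : (\int[omega]_(t in e) lne (w t)%:E = - \int[omega]_(t in e) f t)%E.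
    rewrite -integralN; first by apply: eq_integral => t _; rewrite /f oppeK.
    (* log w is bounded above on e, so its positive part has a finite integral and the sign can be
       moved out of the integral. *)
    have Hm : (\int[omega]_(t in e) f^\- t <= (Num.max (ln (B + 1)) 0)%:E)%E.
      rewrite -(probability_integral_cst e_compact _ om.1).
      apply: ge0_integral_mono => t et; first by rewrite funenegE le_max lexx orbT.
      rewrite funenegE /f oppeK ge_max !lee_fin le_max lexx orbT andbT.
      have := w0 t et; rewrite le_eqVlt => /orP[/eqP <-|wt]; first by rewrite le0_lneNy ?leNye.
      rewrite lne_EFin // lee_fin le_max ler_ln ?posrE //.
      by rewrite (le_trans (HB t et)) // lerDl.
    have Hp : (0 <= \int[omega]_(t in e) f^\- t)%E by apply: integral_ge0.
    rewrite /adde_def; move: Hm Hp; case: (\int[omega]_(t in e) f^\- t)%E => [r| |] //=.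
    by rewrite !andbF.
  by rewrite leeNr -EFinN.
set u := supconv k in kb *; pose c : R := k.+1%:R^-1; have c0 : 0 < c by rewrite invr_gt0.
pose dl := b - perron e (fun t => ln (u t)) z; have dl0 : 0 < dl by rewrite subr_gt0.
have u0 t : 0 < u t := supconv_gt0 k t.
have uB t : u t <= B + 1 by exact: supconv_le.
(* Approximating 1/u - eps within eps yields 1/u - 2 eps <= Q <= 1/u, and u <= B + 1 gives 2 eps <=
   (1 - exp(- dl)) / u. *)
pose eps := (B + 1)^-1 * (1 - expR (- dl)) / 2.
have ed : expR (- dl) < 1 by rewrite -expR0 ltr_expR oppr_lt0.
have eps0 : 0 < eps by rewrite divr_gt0 // mulr_gt0 ?invr_gt0 // subr_gt0.
have lipV s t : `|((u s)^-1 - eps) - ((u t)^-1 - eps)| <= k%:R / c ^+ 2 * `|s - t|.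
  have -> : (u s)^-1 - eps - ((u t)^-1 - eps) = (u t - u s) / (u s * u t).
    by field; rewrite !gt_eqF.
  rewrite normrM normfV (gtr0_norm (mulr_gt0 (u0 s) (u0 t))) ler_pdivrMr ?mulr_gt0 //.
  rewrite distrC; apply: le_trans (supconv_lipschitz k s t) _.
  have -> : k%:R / c ^+ 2 * `|s - t| * (u s * u t) = k%:R * `|s - t| * (u s * u t / c ^+ 2).
    by field; rewrite gt_eqF.
  rewrite ler_peMr ?mulr_ge0 // ler_pdivlMr ?exprn_gt0 // mul1r expr2.
  by apply: ler_pM; rewrite ?(ltW c0) //; exact: supconv_ge.
have [M HM] := bounded_slit e_compact.
have M1 : 0 < `|M| + 1 by rewrite ltr_wpDl.
have K0 : 0 <= k%:R / c ^+ 2 by rewrite divr_ge0 // exprn_ge0 // ltW.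
have [Q QP] := lipschitz_poly K0 M1 eps0 lipV.
have Qe t : e t -> expR (- dl) / u t <= Q.[t] <= (u t)^-1.
  move=> et; have tM : `|t| <= `|M| + 1.
    by rewrite (le_trans (HM t et)) // (le_trans (ler_norm M)) // lerDl.
  have := QP t tM; rewrite ler_norml => /andP[h1 h2]; apply/andP; split; last by lra.
  have h3 : eps + eps <= (u t)^-1 * (1 - expR (- dl)).
    have -> : eps + eps = (B + 1)^-1 * (1 - expR (- dl)) by rewrite /eps; lra.
    by rewrite ler_wpM2r ?subr_ge0 ?(ltW ed) // lef_pV2 ?posrE.
  by move: h3; rewrite mulrBr mulr1 mulrC; lra.
have Q0 t : e t -> 0 < Q.[t].
  by move=> /Qe/andP[h _]; apply: lt_le_trans h; rewrite divr_gt0 // expR_gt0.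
have cQ : {within e, continuous (fun t => ln Q.[t])}.
  by apply: within_continuous_ln Q0 _; apply: continuous_subspaceT; exact: continuous_horner.
exists Q; split=> // [t et|].
  have /andP[_ h] := Qe t et; apply: le_trans (ler_wpM2l (w0 t et) h) _.
  by rewrite ler_pdivrMr // mul1r; exact: supconv_weight.
rewrite -(LN _ cQ); apply: (@le_trans _ _ (perron e ((fun t => ln (u t)) \+ cst dl) z)).
  apply: Lm.
  - by move=> t; apply: cvgN; exact: cQ.
  - by move=> t; apply: cvgD; [exact: csc|exact: cvg_cst].
  move=> t et /=; have /andP[h _] := Qe t et.
  have : ln (expR (- dl) / u t) <= ln Q.[t].
    by rewrite ler_ln ?posrE ?Q0 // divr_gt0 // expR_gt0.
  rewrite lnM ?posrE ?expR_gt0 ?invr_gt0 // expRK lnV ?posrE //.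
  by rewrite /cst; lra.
rewrite (LD _ _ (csc k) (@within_continuous_cst _ e dl)).
by rewrite (mean_cst _ ML) /dl addrC subrK.
Qed.

End weight.

(** * Widom factors *)

Lemma limn_esup_ub {R : realType} (u : nat -> \bar R) (c : \bar R) N :
  (forall n, (N <= n)%N -> (u n <= c)%E) -> (limn_esup u <= c)%E.
Proof.
move=> h; rewrite /limn_esup limf_esupE.
apply: (@le_trans _ _ (ereal_sup (u @` [set n | (N <= n)%N]))).
  by apply: ereal_inf_lbound; exists [set n | (N <= n)%N] => //; exact: nbhs_infty_ge.
by apply: ge_ereal_sup => _ [n /= Nn <-]; exact: h.
Qed.

Lemma lee_real_gt {R : realType} (a b : \bar R) :
  (forall r : R, (b < r%:E)%E -> (a <= r%:E)%E) -> (a <= b)%E.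
Proof.
move=> h; rewrite -leeN2; apply: lee_real_lt => r rb.
rewrite leeNr -EFinN; apply: h.
by rewrite EFinN -lteNr.
Qed.

(** * Change of coordinate in polynomials *)

Section homogenization.
Context {R : realType}.
Implicit Types (A B T : {poly R}).

(** The polynomial A^n T(B / A) for T of degree at most n; at a zero of A only its top term T_n B^n
    survives. *)
Definition homog n A B T : {poly R} := \sum_(k < n.+1) T`_k *: (A ^+ (n - k) * B ^+ k).

Lemma size_homog n A B T : (size A <= 2)%N -> (size B <= 2)%N ->
  (size (homog n A B T) <= n.+1)%N.
Proof.
move=> sA sB; apply: leq_trans (size_sum _ _ _) _; apply/bigmax_leqP => k _.
apply: leq_trans (size_scale_leq _ _) _.
have sX (C : {poly R}) i : (size C <= 2)%N -> (size (C ^+ i) <= i.+1)%N.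
  move=> sC; apply: leq_trans (size_poly_exp_leq _ _) _; rewrite ltnS.
  by rewrite -[leqRHS]mul1n leq_mul2r -subn1 leq_subLR sC orbT.
apply: leq_trans (size_polyMleq _ _) _.
have h1 := sX A (n - k)%N sA; have h2 := sX B k sB.
rewrite -subn1 leq_subLR; apply: leq_trans (leq_add h1 h2) _.
by rewrite addSn addnS subnK // -ltnS.
Qed.

Lemma horner_homog n A B T t : (size T <= n.+1)%N -> A.[t] != 0 ->
  (homog n A B T).[t] = A.[t] ^+ n * T.[B.[t] / A.[t]].
Proof.
move=> sT At; rewrite /homog horner_sum (horner_coef_wide _ sT) mulr_sumr.
apply: eq_bigr => k _; rewrite hornerZ hornerM !horner_exp expr_div_n.
have kn : (k <= n)%N by rewrite -ltnS.
have -> : A.[t] ^+ n = A.[t] ^+ (n - k) * A.[t] ^+ k by rewrite -exprD subnK.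
by field; exact: expf_neq0.
Qed.

Lemma horner_homog_root n A B T t : A.[t] = 0 -> (homog n A B T).[t] = T`_n * B.[t] ^+ n.
Proof.
move=> At; rewrite /homog horner_sum big_ord_recr /= big1 ?add0r => [|k _].
  by rewrite subnn expr0 mul1r hornerZ horner_exp.
by rewrite hornerZ hornerM !horner_exp At expr0n subn_eq0 leqNgt ltn_ord /= mul0r mulr0.
Qed.

End homogenization.

Lemma horner_complex {R : realType} (p : {poly R}) (t : R) :
  (map_poly (real_complex R) p).[t%:C%C] = (p.[t])%:C%C.
Proof. exact: horner_map. Qed.

Lemma normc_real {R : realType} (t : R) : Normc.normc t%:C%C = `|t|.
Proof. by rewrite /Normc.normc /= expr0n addr0 sqrtr_sqr. Qed.

Section extremal.
Context {R : realType} (e : set R) (w : R -> R).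

(** A set that is not bounded above has supremum 0 by convention, which also satisfies the
    inequality. *)
Lemma wnorm_ge0 P : weight e w -> 0 <= wnorm e w P.
Proof.
move=> [w0 _ winf]; rewrite /wnorm; set S := [set _ | _ in _].
have [t [et _]] := infinite_setN0 winf.
have nn (z : R[i]) : 0 <= Normc.normc z by case: z => a b; rewrite /Normc.normc sqrtr_ge0.
have [h|h] := pselect (has_ubound S); last first.
  by rewrite sup_out // => -[_]; exact: h.
apply: le_trans (ub_le_sup h _); last by exists t.
by rewrite mulr_ge0 // w0.
Qed.

Lemma wnorm_le (p : {poly R}) (C : R) : weight e w ->
  (forall t, e t -> w t * `|p.[t]| <= C) ->
  wnorm e w (map_poly (real_complex R) p) <= C.
Proof.
move=> [_ _ winf] h; have [t [et _]] := infinite_setN0 winf.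
apply: ge_sup; first by exists (w t * Normc.normc (map_poly (real_complex R) p).[t%:C%C]), t.
by move=> _ [s es <-]; rewrite horner_complex normc_real h.
Qed.

Lemma inf_wnorm_le (S : set {poly R[i]}) P : weight e w -> S P ->
  inf [set wnorm e w P | P in S] <= wnorm e w P.
Proof.
move=> ww SP; apply: ge_inf; last by exists P.
by exists 0 => _ [Q SQ <-]; exact: wnorm_ge0.
Qed.

End extremal.

Section assembly.
Context {R : realType} (e : set R) (g : sphere R -> sphere R -> R) (x : xreal R)
  (omega : probability (measurableTypeR R) R) (w : R -> R).
Hypotheses (e_compact : compact e) (e_regular : regular e) (g_green : is_green e g)
  (xe : xcompl e x) (omega_hm : is_harmonic_measure e (xreal_pt x) omega)
  (w_weight : weight e w).
Local Notation L := (fun phi => perron e phi (xreal_pt x)).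
Local Notation m := (to_coord x).
Local Notation a := (coord_weight x).

Let e_infinite : infinite_set e.
Proof. by have [_ _] := w_weight; apply: sub_infinite_set => t []. Qed.

Let e_neq0 : e !=set0 := infinite_setN0 e_infinite.

Lemma to_coord_continuous : {within e, continuous m}.
Proof.
rewrite subspace_continuousP => t et; apply: cvg_within_filter.
rewrite /to_coord; case E : x => [t0|]; last exact: cvg_id.
apply: cvgV; first exact: xcompl_neq E et.
by apply: cvgB; [exact: cvg_cst|exact: cvg_id].
Qed.

Lemma to_coord_inj t t' : e t -> e t' -> m t = m t' -> t = t'.
Proof.
move=> et et'; rewrite /to_coord; case: x => [t0|] //.
by move=> /invr_inj/addrI/oppr_inj.
Qed.

Let K := m @` e.

Let K_compact : compact K.
Proof. exact: continuous_compact to_coord_continuous e_compact. Qed.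

Lemma green_coord_eq0 t : e t -> green_coord e g x (m t, 0) = 0.
Proof.
move=> et; rewrite /green_coord (to_coordK xe et) /green_ext; case: pselect => // h.
by exfalso; apply: h; exists t.
Qed.

Lemma coord_points n : exists s, [/\ uniq s, size s = n.+1 & forall y, y \in s -> K y].
Proof.
have [B BS nB] := infinite_set_fset n.+1 e_infinite.
have Be t : t \in take n.+1 (finmap.enum_fset B) -> e t by move=> /mem_take tB; exact: BS.
exists [seq m t | t <- take n.+1 (finmap.enum_fset B)]; split.
- rewrite map_inj_in_uniq ?take_uniq ?finmap.fset_uniq // => t t' /Be et /Be et'.
  exact: to_coord_inj.
- by rewrite size_map size_takel.
- by move=> y /mapP[t /Be et ->]; exists t.
Qed.

Lemma coord_poly n (Q : {poly R}) : (size Q <= n.+1)%N -> exists q0 : {poly R},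
  (size q0 <= n.+1)%N /\ forall t, e t -> a t ^+ n * `|q0.[m t]| = `|Q.[t]|.
Proof.
move=> sQ; rewrite /coord_weight /to_coord; case E : x => [t0|]; last first.
  by exists Q; split=> // t _; rewrite expr1n mul1r.
(* X^n Q(t0 - 1/X), evaluated below at 1 / (t0 - t). *)
exists (homog n 'X (t0%:P * 'X - 1) Q); split.
  apply: size_homog; first by rewrite size_polyX.
  apply: leq_trans (size_polyD _ _) _; rewrite size_polyN geq_max size_poly1 andbT mul_polyC.
  by apply: leq_trans (size_scale_leq _ _) _; rewrite size_polyX.
move=> t et; have d0 := xcompl_neq xe E et.
rewrite horner_homog ?hornerX ?invr_eq0 // normrM normrX mulrA -exprMn -normrM.
rewrite divff // normr1 expr1n mul1r; congr `|Q.[_]|.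
by rewrite !hornerE; field.
Qed.

Lemma near_extremal (G C eps : R) (n : nat) (Q : {poly R}) :
  (forall p, 0 < p.2 -> L (fun t => ln (a t * dist2 p (m t))) <= green_coord e g x p - G) ->
  (PW e g x <= C%:E)%E -> 0 < eps -> (size Q <= n.+1)%N -> (forall t, e t -> 0 < Q.[t]) ->
  exists T : {poly R}, [/\ (size T <= n.+1)%N, 0 < T`_n,
    forall t, e t -> a t ^+ n * `|T.[m t]| <= (1 + eps) * Q.[t]
    & L (fun t => ln Q.[t]) <= ln (2 * T`_n) - n%:R * G + C].
Proof.
move=> HG PWC eps0 sQ Q0; have [q0 [sq0 q0Q]] := coord_poly sQ.
have a0 t : e t -> 0 < a t by exact: coord_weight_gt0.
have qQ t : e t -> a t ^+ n * `|q0.[m t]| = Q.[t].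
  by move=> et; rewrite q0Q // gtr0_norm // Q0.
have q0n0 t : e t -> q0.[m t] != 0.
  move=> et; apply/eqP => E; have := Q0 t et; rewrite -qQ // E normr0 mulr0.
  by rewrite ltxx.
pose f tau := `|q0.[tau]|.
have fc : continuous f by move=> tau; apply: cvg_norm; exact: continuous_horner.
have K0 : K !=set0 by have [t et] := e_neq0; exists (m t), t.
have f0 tau : K tau -> 0 < f tau by move=> [t et <-]; rewrite normr_gt0 q0n0.
have [c cK fmin] := compact_EVT_min K0 K_compact (continuous_subspaceT fc).
have [c' cK' fmax] := compact_EVT_max K0 K_compact (continuous_subspaceT fc).
have /compact_bounded[B [_ KB]] := K_compact.
have KB' tau : K tau -> `|tau| <= B + 1 by apply: KB; rewrite ltrDl.
(* The additive tolerance eps min f becomes the factor 1 + eps on K. *)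
have th0 : 0 < eps * f c by rewrite mulr_gt0 // f0 //; move: cK; rewrite inE.
have [s0 [us0 sz0 s0K s0T]] := near_optimal_nodes KB' f0 (coord_points n) th0.
pose s := sort <=%R s0; have ps : perm_eq s0 s by rewrite perm_sym perm_sort.
have us : uniq s by rewrite sort_uniq.
have sz : size s = n.+1 by rewrite size_sort.
have ss : sorted <%R s by rewrite lt_sorted_uniq_le us sort_le_sorted.
have sK y : y \in s -> K y by rewrite mem_sort; exact: s0K.
rewrite (perm_node_poly f ps) in s0T; set T := node_poly f s in s0T.
have Ty y : y \in s -> T.[y] = f y * Num.sg (nodal s y y) by exact: node_poly_at.
have Tn : T`_n = node_cost f s by rewrite -(coef_node_poly f us) sz.
exists T; split.
- by rewrite -sz size_node_poly.
- rewrite Tn /node_cost; case: (s) sz us sK => // y s' _ _ sK; rewrite big_cons.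
  rewrite ltr_wpDr //; first by rewrite sumr_ge0 // => z _; rewrite divr_ge0 // normr_ge0.
  apply: divr_gt0; last by rewrite normr_gt0 nodal_diag_neq0.
  by apply: f0; apply: sK; exact: mem_head.
- move=> t et; have Kt : K (m t) by exists t.
  apply: (@le_trans _ _ (a t ^+ n * ((1 + eps) * f (m t)))).
    rewrite ler_wpM2l ?exprn_ge0 ?(ltW (a0 t et)) //; apply: le_trans (s0T _ Kt) _.
    by rewrite mulrDl mul1r lerD2l ler_wpM2l ?(ltW eps0) // fmin // inE.
  by rewrite mulrCA qQ.
have cQ : {within e, continuous (fun t => ln Q.[t])}.
  by apply: within_continuous_ln Q0 _; apply: continuous_subspaceT; exact: continuous_horner.
have EQ t : e t -> ln Q.[t] = ln (a t ^+ n * `|q0.[m t]|) by move=> et; rewrite qQ.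
rewrite (mean_eq e_compact omega_hm cQ EQ).
apply: (@main_inequality _ e L n m a G C (f c') (green_coord e g x) s q0 T).
- exact: perron_mean e_compact omega_hm.
- exact: a0.
- by move=> t et; apply: fmax; rewrite inE; exists t.
- exact: q0n0.
- exact: within_eq_continuous EQ cQ.
- by move=> p p0; exact: log_coord_continuous.
- exact: HG.
- by move=> de de0; exact: green_coord_unif.
- move=> r rz rs; apply: (interlacing_green_sum e_compact e_regular g_green xe PWC ss sz rz) => // y /sK[t et <-].
  exact: green_coord_eq0.
- exact: ss.
- exact: sz.
- by rewrite -sz size_node_poly.
- exact: sq0.
- move=> y ys; rewrite Ty // -mulrA -normrEsg; apply: mulr_gt0; first by apply: f0; exact: sK.
  by rewrite normr_gt0 nodal_diag_neq0.
- move=> y ys; rewrite Ty // normrM normr_sg nodal_diag_neq0 mulr1 /f normr_id //.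
Qed.

Lemma residual_le n t0 (T : {poly R}) (D : R) : x = Some t0 ->
  (size T <= n.+1)%N -> 0 < T`_n ->
  (forall t, e t -> w t * (a t ^+ n * `|T.[m t]|) <= D) ->
  inf [set wnorm e w P | P in residual_polys n t0] <= D / T`_n.
Proof.
move=> xt sT A0 TD.
have horner1 t : (1 : {poly R}).[t] = 1 by rewrite hornerE.
have hornerB t : (t0%:P - 'X).[t] = t0 - t by rewrite !hornerE.
(* (t0 - t)^n T(1 / (t0 - t)) divided by T_n, which takes the value 1 at t0. *)
pose p := (T`_n)^-1 *: homog n (t0%:P - 'X) 1 T.
have sp : (size p <= n.+1)%N.
  apply: leq_trans (size_scale_leq _ _) _; apply: size_homog; last by rewrite size_poly1.
  by rewrite -opprB size_polyN size_XsubC.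
apply: le_trans (inf_wnorm_le w_weight (P := map_poly (real_complex R) p) _) _.
  split; first by rewrite size_map_poly.
  rewrite horner_complex /p hornerZ horner_homog_root ?hornerB ?subrr //.
  by rewrite horner1 expr1n mulr1 mulVf ?gt_eqF.
apply: wnorm_le => // t et; have d0 := xcompl_neq xe xt et.
rewrite /p hornerZ horner_homog ?hornerB // horner1 mul1r.
rewrite normrM normfV (gtr0_norm A0) mulrCA mulrC ler_wpM2r ?invr_ge0 ?(ltW A0) //.
by have := TD t et; rewrite /coord_weight /to_coord xt normrM normrX.
Qed.

Lemma monic_le n (T : {poly R}) (D : R) : x = None ->
  (size T <= n.+1)%N -> 0 < T`_n ->
  (forall t, e t -> w t * (a t ^+ n * `|T.[m t]|) <= D) ->
  inf [set wnorm e w P | P in @monic_polys R n] <= D / T`_n.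
Proof.
move=> xt sT A0 TD; pose p := (T`_n)^-1 *: T.
have A1 : T`_n != 0 by rewrite gt_eqF.
have sT' : size T = n.+1.
  apply/eqP; rewrite eqn_leq sT /= ltnNge; apply/negP => h.
  by move: A1; rewrite nth_default ?eqxx.
have lT : lead_coef T = T`_n by rewrite lead_coefE sT'.
apply: le_trans (inf_wnorm_le w_weight (P := map_poly (real_complex R) p) _) _.
  split; first by rewrite size_map_poly size_scale ?invr_eq0.
  by rewrite map_monic monicE lead_coefZ lT mulVf.
apply: wnorm_le => // t et.
rewrite /p hornerZ normrM normfV (gtr0_norm A0) mulrCA mulrC ler_wpM2r ?invr_ge0 ?(ltW A0) //.
by have := TD t et; rewrite /coord_weight /to_coord xt expr1n mul1r.
Qed.

Lemma widom_bound (C : R) (Q : {poly R}) n : (PW e g x <= C%:E)%E ->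
  (forall t, e t -> 0 < Q.[t]) -> (forall t, e t -> w t * Q.[t] <= 1) ->
  (size Q <= n.+1)%N ->
  widom e g w x n <= 2 * expR (C - L (fun t => ln Q.[t])).
Proof.
move=> PWC Q0 wQ sQ; have [w0 _ _] := w_weight.
(* For finite x, G = g(x, oo) is the exponent in the Widom factor. For x infinite, G comes from
   [log_mean_infty], and its second property bounds the capacity below by exp(- G). *)
have [G [HG Wd]] : exists G : R, (forall p, 0 < p.2 ->
      L (fun t => ln (a t * dist2 p (m t))) <= green_coord e g x p - G) /\
    forall T : {poly R}, forall D, 0 <= D -> (size T <= n.+1)%N -> 0 < T`_n ->
    (forall t, e t -> w t * (a t ^+ n * `|T.[m t]|) <= D) ->
    widom e g w x n <= expR (n%:R * G) * (D / T`_n).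
  case E : x => [t0|].
    exists (g (real_pt t0) infty_pt); split=> [p p0|T D D0 sT A0 TD].
      by have := log_mean_finite e_compact e_regular g_green xe omega_hm E p0; rewrite E.
    rewrite /widom ler_wpM2l ?expR_ge0 //; apply: residual_le => //.
    by rewrite E.
  have [G [HG HL]] := log_mean_infty e_compact e_regular g_green omega_hm E.
  exists G; split=> [p p0|T D D0 sT A0 TD]; first by rewrite -E; exact: HG.
  have TD' : inf [set wnorm e w P | P in @monic_polys R n] <= D / T`_n.
    by apply: monic_le => //; rewrite E.
  have cap : expR (- G) <= capacity e.
    by apply: (capacity_ge_energy e_compact omega_hm.1); apply: log_energy_le e_compact _ _ _ omega_hm HL.
  have c0 : 0 < capacity e by apply: lt_le_trans cap; exact: expR_gt0.
  rewrite /widom; apply: le_trans (ler_wpM2l _ TD') _; first by rewrite invr_ge0 exprn_ge0 // ltW.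
  rewrite ler_wpM2r ?divr_ge0 ?(ltW A0) // expRM_natl -exprVn lerXn2r ?nnegrE ?invr_ge0 ?(ltW c0) ?expR_ge0 //.
  by rewrite -[leRHS]invrK -expRN lef_pV2 ?posrE ?expR_gt0.
apply/ler_addgt0Pr => d d0; set X := 2 * expR _.
have X0 : 0 < X by rewrite mulr_gt0 // expR_gt0.
(* With this eps the factor 1 + eps turns the bound X into X + d. *)
have eps0 : 0 < d / X by rewrite divr_gt0.
have [T [sT A0 TD LT]] := near_extremal HG PWC eps0 sQ Q0.
apply: le_trans (Wd T (1 + d / X) _ sT A0 _) _; first by rewrite addr_ge0 // ltW.
  move=> t et; apply: le_trans (ler_wpM2l (w0 t et) (TD t et)) _.
  by rewrite mulrCA ler_piMr ?wQ // addr_ge0 // ltW.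
have -> : X + d = (1 + d / X) * X by rewrite mulrDl mul1r divfK ?gt_eqF.
rewrite mulrCA ler_wpM2l //; first by rewrite addr_ge0 // ltW.
rewrite ler_pdivrMr //; set A := T`_n in A0 LT *.
have -> : X * A = expR (C - L (fun t => ln Q.[t]) + ln (2 * A)).
  by rewrite expRD lnK ?posrE ?mulr_gt0 // /X; ring.
by rewrite ler_expR; lra.
Qed.

End assembly.

Theorem theorem3p2 (R : realType) (e : set R) (g : sphere R -> sphere R -> R)
    (x : xreal R) (omega : probability (measurableTypeR R) R) (w : R -> R)
    (e_compact : compact e)
    (e_regular : regular e)
    (g_green : is_green e g)
    (x_notin_e : xcompl e x)
    (e_PW : parreau_widom e g x)
    (omega_hm : is_harmonic_measure e (xreal_pt x) omega)
    (w_weight : weight e w) :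
  (limn_esup (fun n => (widom e g w x n)%:E)
     <= 2%:E * szego e omega w * expeR (PW e g x))%E.
Proof.
have [_ _ winf] := w_weight.
have e_neq0 : e !=set0 by have [t [et _]] := infinite_setN0 winf; exists t.
have PW0 : (0 <= PW e g x)%E.
  by apply: ereal_sup_ubound; exists set0; rewrite ?fsbig_set0 //; exact: fsets_set0.
have [C PWC] : exists C, PW e g x = C%:E.
  by move: e_PW PW0; rewrite /parreau_widom; case: (PW e g x) => [C| |] //; exists C.
(* Comparing with every real r above the right-hand side treats a vanishing Szego factor like any
   other. *)
rewrite PWC /=; apply: lee_real_gt => r; rewrite /szego.
set I := (\int[omega]_(t in e) lne (w t)%:E)%E => Ir.
have Sge : (0 <= expeR I)%E by exact: expeR_ge0.
have r0 : 0 < r.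
  rewrite -lte_fin; apply: le_lt_trans Ir.
  by rewrite !mule_ge0 // lee_fin expR_ge0.
(* Solves 2 exp(I) exp(C) < r for I. I = - oo is allowed, and I = + oo would make the right-hand
   side infinite. *)
have Ib : (I < (ln (r / 2) - C)%:E)%E.
  move: Ir; case: I Sge => [i| |] //= _; last by rewrite ltNyr.
    rewrite -!EFinM !lte_fin => h.
    rewrite ltrBrDr -ltr_expR lnK ?posrE ?divr_gt0 // expRD ltr_pdivlMr //.
    by rewrite [_ * 2]mulrC mulrA.
  by rewrite gt0_muley ?lte_fin // gt0_mulye ?lte_fin ?expR_gt0 // ltNge leey.
have [Q [Q0 wQ Qb]] := weight_polynomial e_compact w_weight e_neq0 omega_hm Ib.
(* Q is fixed before n, so it is admissible for all large n with a bound independent of n. *)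
apply: (limn_esup_ub (N := size Q)) => n sQ; rewrite lee_fin.
have PWC' : (PW e g x <= C%:E)%E by rewrite PWC.
apply: le_trans (widom_bound e_compact e_regular g_green x_notin_e omega_hm w_weight PWC' Q0 wQ (leqW sQ)) _.
have -> : r = 2 * expR (C + (ln (r / 2) - C)).
  by rewrite addrC subrK lnK ?posrE ?divr_gt0 // mulrC divfK.
by rewrite ler_pM2l // ler_expR lerD2l.
Qed.
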